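(* Let $\alpha\in(0,1)$, let $X$ be a Banach space, let $u_0\in X$, and let $f:[0,\infty)\times X\to X$ be a continuous function which is locally Lipschitz and maps bounded sets onto bounded sets (i.e. the image under $f$ of every bounded set is bounded). Then the problem $$cD_t^\alpha u(t)=f(t,u(t)),\quad t>0,\qquad u(0)=u_0,$$ either has a global solution in $[0,\infty)$, or there exists $\omega\in(0,\infty)$ such that the local solution $u:[0,\omega)\to X$ does not admit a continuation and satisfies $$\limsup_{t\to\omega^-}\|u(t)\|_X=\infty.$$
   Context: For $\beta>0$ let $g_\beta(t)=t^{\beta-1}/\Gamma(\beta)$ for $t>0$ and $g_\beta(t)=0$ for $t\le 0$; for $h\in L^1(0,\tau;X)$ (Bochner integrable) put $J_t^\beta h(t)=(h*g_\beta)(t)=\int_0^t g_\beta(t-r)h(r)\,dr$. Caputo derivative: for $\alpha\in(0,1)$, $\tau>0$ and $h\in C([0,\tau],X)$ with $h*g_{1-\alpha}\in W^{1,1}(0,\tau;X)$, $$cD_t^\alpha h(t):=\frac{d}{dt}\,J_t^{1-\alpha}\big(h-h(0)\big)(t)\quad\text{for a.e. } t\in[0,\tau].$$ $C^\alpha([0,\tau],X)$ denotes the set of $u\in C([0,\tau],X)$ such that $cD_t^\alpha u$ is defined and belongs to $C([0,\tau],X)$ (i.e. has a continuous representative, with which it is identified). Locally Lipschitz: for each $(t_0,x_0)\in[0,\infty)\times X$ there are $L,r>0$ such that $\|f(t,x)-f(t,y)\|_X\le L\|x-y\|_X$ for all $(t,x),(t,y)\in B_r(t_0,x_0)$ (ball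 in $[0,\infty)\times X$). Solutions: a local solution on $[0,\tau]$, $0<\tau<\infty$, is a function $u\in C^\alpha([0,\tau],X)$ with $u(0)=u_0$ satisfying the equation on $[0,\tau]$. A global solution is a function $u:[0,\infty)\to X$ that belongs to $C^\alpha([0,\tau],X)$ for every $\tau>0$ and satisfies the problem. A local solution on $[0,\omega)$ is a function $u:[0,\omega)\to X$ whose restriction to $[0,\tau]$ is the (unique) local solution on $[0,\tau]$ for every $\tau\in(0,\omega)$. It admits a continuation if there are $\tau^*\ge\omega$ and a local solution on $[0,\tau^*]$ coinciding with $u$ on $[0,\omega)$. *)

(* Defs.v *)
From HB Require Import structures.
From mathcomp Require Import all_boot all_order all_algebra.
From mathcomp Require Import all_classical all_reals all_analysis.

Set Implicit Arguments.
Unset Strict Implicit.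
Unset Printing Implicit Defensive.

Import Order.TTheory GRing.Theory Num.Theory.
Import numFieldNormedType.Exports.

Local Open Scope classical_set_scope.
Local Open Scope ring_scope.

(* Functions on an interval are represented by total functions on R, of which
   only the restriction to that interval is ever constrained or used.          *)

Section Bochner.
Context d (T : measurableType d) (R : realType) (X : completeNormedModType R).
Variables (mu : {measure set T -> \bar R}) (D : set T).
Implicit Types (s : {fimfun T >-> X}) (f : T -> X).

Definition bochner_simple s :=
  forall x : X, measurable (D `&` s @^-1` [set x]) /\
    (x != 0 -> (mu (D `&` s @^-1` [set x]) < +oo)%E).

Definition bochner_sintegral s : X :=
  \sum_(x \in [set: X]) fine (mu (D `&` s @^-1` [set x])) *: x.

Definition bochner_approx f (s : nat -> {fimfun T >-> X}) :=
  [/\ forall n, bochner_simple (s n),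
      {ae mu, forall x, D x -> s n x @[n --> \oo] --> f x} &
      (\int[mu]_(x in D) (`|f x - s n x|)%:E)%E @[n --> \oo] --> 0%E].

Definition bochner_integrable f := exists s : nat -> {fimfun T >-> X}, bochner_approx f s.

Definition is_bochner_integral f (v : X) :=
  exists2 s : nat -> {fimfun T >-> X}, bochner_approx f s & bochner_sintegral (s n) @[n --> \oo] --> v.

(* The value is 0 when f is not Bochner integrable. *)
Definition bochner_integral f : X := xget 0 (is_bochner_integral f).

End Bochner.

Section FractionalCalculus.
Context (R : realType) (X : completeNormedModType R).
Let leb := @lebesgue_measure R.
Implicit Types (h w : R -> X) (tau alpha beta : R).

Definition Gamma beta : R :=
  \int[leb]_(t in `]0, +oo[) (t `^ (beta - 1) * expR (- t)).

Definition g beta (t : R) : R :=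
  if 0 < t then t `^ (beta - 1) / Gamma beta else 0.

Definition J beta h (t : R) : X :=
  bochner_integral leb `]0, t[ (fun r => g beta (t - r) *: h r).

(* C^1 functions with compact support in (0, tau); they are the test functions
   in the definition of W^{1,1}(0, tau; X) through the weak derivative.        *)
Definition C1c tau (phi : R -> R) :=
  [/\ forall t, derivable phi t 1,
      continuous (derive1 phi) &
      exists a b, [/\ 0 < a, b < tau & forall t, t \notin `[a, b] -> phi t = 0]].

Definition weak_derivative tau h w := forall phi, C1c tau phi ->
  bochner_integral leb `]0, tau[ (fun t => derive1 phi t *: h t) =
  - bochner_integral leb `]0, tau[ (fun t => phi t *: w t).

Definition W11 tau h :=
  bochner_integrable leb `]0, tau[ h /\
  exists2 w, bochner_integrable leb `]0, tau[ w & weak_derivative tau h w.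

(* "w is (a representative of) cD_t^alpha h on [0, tau]" *)
Definition caputo_derivative alpha tau h w :=
  [/\ {within `[0, tau], continuous h},
      W11 tau (J (1 - alpha) h) &
      {ae leb, forall t, t \in `]0, tau[ ->
         is_derive t 1 (J (1 - alpha) (fun r => h r - h 0)) (w t)}].

(* h belongs to C^alpha([0, tau], X) if and only if
   continuous_caputo alpha tau h w for some w, unique on [0, tau]. *)
Definition continuous_caputo alpha tau h w :=
  {within `[0, tau], continuous w} /\ caputo_derivative alpha tau h w.

End FractionalCalculus.

Section CauchyProblem.
Context (R : realType) (X : completeNormedModType R).
Variables (alpha : R) (f : R * X -> X) (u0 : X).
Implicit Types (u v : R -> X) (tau omega : R).

Definition locally_lipschitz := forall (t0 : R) (x0 : X), 0 <= t0 ->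
  exists L r : R, [/\ 0 < L, 0 < r & forall (t : R) (x y : X), 0 <= t ->
    ball (t0, x0) r (t, x) -> ball (t0, x0) r (t, y) ->
    `|f (t, x) - f (t, y)| <= L * `|x - y|].

Definition maps_bounded_to_bounded := forall A : set (R * X),
  A `<=` [set p | 0 <= p.1] -> bounded_set A -> bounded_set (f @` A).

Definition local_solution tau u := u 0 = u0 /\
  exists2 w, continuous_caputo alpha tau u w &
    forall t, t \in `[0, tau] -> w t = f (t, u t).

Definition global_solution u := forall tau, 0 < tau -> local_solution tau u.

Definition unique_local_solution tau u := local_solution tau u /\
  forall v, local_solution tau v -> forall t, t \in `[0, tau] -> v t = u t.

Definition local_solution_upto omega u :=
  forall tau, 0 < tau < omega -> unique_local_solution tau u.

Definition admits_continuation omega u := exists tau v,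
  [/\ omega <= tau, local_solution tau v &
      forall t, t \in `[0, omega[ -> v t = u t].

End CauchyProblem.

(* Main.v *)
(* For locally bounded right-hand sides, the problem is equivalent to the integral
   equation u = u0 + J^alpha f(., u): one direction is J^(1-alpha) J^alpha = J^1, the
   other one uses in addition that a primitive whose derivative vanishes almost
   everywhere is constant. Near a point c up to which a solution is given, the
   Lipschitz condition makes v |-> u0 + J^alpha f(., v) a contraction of the functions
   which extend it, since the J^alpha-mass of [c, c + d] tends to 0 with d; hence
   uniqueness and extension beyond c. If the supremum omega of the existence times is
   finite and u is bounded near omega, then f(., u) is bounded, so that
   u0 + J^alpha f(., u) is continuous up to omega; this solution on [0, omega] could be
   extended, against the choice of omega. *)
From HB Require Import structures.
Require Import Defs.
From mathcomp Require Import all_boot all_order all_algebra finmap.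
From mathcomp Require Import all_classical all_reals all_analysis.
From mathcomp Require Import measurable_realfun ring lra.
Import numFieldNormedType.Exports.
Local Open Scope classical_set_scope.
Local Open Scope ring_scope.

Set Implicit Arguments.
Unset Strict Implicit.
Unset Printing Implicit Defensive.
Import Order.TTheory GRing.Theory Num.Theory.

(** * Bochner integral over sets of finite measure *)

(** Fubini's theorem is applied to nonnegative real kernels only. The composition of fractional
    integrals of complementary orders is computed on step functions, where it is the Beta integral
    B(a, b) = Gamma(a) Gamma(b), and carried to continuous vector-valued functions by uniform
    approximation. Strong measurability holds up to a null set, so norms need not be measurable:
    estimates use lower integrals and measurable representatives of the norms. A derivative given
    almost everywhere does not determine a function. The missing absolute continuity comes from the
    W^{1,1} condition: tested against C^1 approximations of indicators, the weak derivative bounds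
    the increments of J^(1-alpha) u by integrals of an integrable function. That condition bears on
    J^(1-alpha) u, the equation on J^(1-alpha) (u - u0); they differ by a multiple of t^(1-alpha)
    u0, whose derivative is integrable but unbounded at 0. The operator J^alpha has memory, so a
    solution cannot be restarted at c from its value there: the whole past is kept and the iteration
    changes values beyond c only. *)

Section FinitelyValued.
Context d (T : measurableType d) (R : realType).
Variables (mu : {measure set T -> \bar R}) (D : set T).
Hypotheses (mD : measurable D) (finD : (mu D < +oo)%E).

(** The target is an arbitrary type, so that two simple functions can be joined into one function
    with values in a product, on whose fibres both are constant. Since [D] has finite measure, the
    finiteness condition of [bochner_simple] holds automatically. *)
Definition finitely_valued (Y : Type) (s : T -> Y) :=
  finite_set (range s) /\ forall y, measurable (D `&` s @^-1` [set y]).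

Lemma finitely_valued_preimage (Y : Type) (s : T -> Y) (B : set Y) :
  finitely_valued s -> measurable (D `&` s @^-1` B).
Proof.
move=> [fs ms].
rewrite (_ : _ `&` _ = \bigcup_(y in range s `&` B) (D `&` s @^-1` [set y])).
  by apply: fin_bigcup_measurable => //; exact: finite_setIl.
apply/seteqP; split=> [x [Dx Bx]|x [y [_ By] [Dx /= sy]]].
  by exists (s x) => //; split=> //; exists x.
by split=> //=; rewrite /preimage/= sy.
Qed.

Lemma finitely_valued_comp (Y Z : Type) (s : T -> Y) (phi : Y -> Z) :
  finitely_valued s -> finitely_valued (phi \o s).
Proof.
move=> fs; split; last first.
  by move=> z; rewrite comp_preimage; exact: finitely_valued_preimage.
by rewrite -(image_comp s phi); apply: finite_image; exact: fs.1.
Qed.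

Lemma finitely_valued_pair (Y Z : Type) (s : T -> Y) (t : T -> Z) :
  finitely_valued s -> finitely_valued t ->
  finitely_valued (fun x => (s x, t x)).
Proof.
move=> fs ft; split.
  apply: (@sub_finite_set _ _ (range s `*` range t)).
    by move=> _ [x _ <-]; split; exists x.
  by apply: finite_setX; [exact: fs.1|exact: ft.1].
move=> [y z].
rewrite (_ : _ `&` _ = (D `&` s @^-1` [set y]) `&` (D `&` t @^-1` [set z])).
  by apply: measurableI; [exact: fs.2|exact: ft.2].
apply/seteqP; split=> x /= => [[Dx [<- <-]]//|[[Dx <-] [_ <-]]//].
Qed.

Lemma finitely_valued_measurable d' (Y : Type) (Z : measurableType d')
    (s : T -> Y) (phi : Y -> Z) :
  finitely_valued s -> measurable_fun D (phi \o s).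
Proof.
move=> fs _ B _; rewrite comp_preimage; exact: finitely_valued_preimage.
Qed.

Lemma finitely_valued_cst (Y : Type) (y : Y) : finitely_valued (cst y).
Proof.
split; first by apply: (sub_finite_set _ (finite_set1 y)) => _ [x _ <-].
move=> z; have [->|yz] := pselect (y = z).
  by rewrite (_ : _ `&` _ = D) //; apply/seteqP; split=> x //= [].
by rewrite (_ : _ `&` _ = set0) //; apply/seteqP; split=> x //= [].
Qed.

Lemma finitely_valued_patch (Y : Type) (s : T -> Y) (y0 : Y) (A : set T) :
  measurable A -> finitely_valued s ->
  finitely_valued (fun x => if x \in A then s x else y0).
Proof.
move=> mA fs.
have fA : finitely_valued (fun x => x \in A).
  split; first exact: finite_finset.
  move=> b; case: b.
    rewrite (_ : _ `&` _ = D `&` A); first exact: measurableI.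
    apply/seteqP; split=> x /= [Dx Ax]; split=> //; first exact: set_mem.
    exact: mem_set.
  rewrite (_ : _ `&` _ = D `\` A); first exact: measurableD.
  apply/seteqP; split=> x /= [Dx Ax]; split=> //.
    by move: Ax => /negbT; rewrite notin_setE.
  by apply/negbTE; rewrite notin_setE.
exact: (finitely_valued_comp (fun p : bool * Y => if p.1 then p.2 else y0)
  (finitely_valued_pair fA fs)).
Qed.

Lemma finitely_valued_fin_num (Y : Type) (s : T -> Y) (B : set Y) :
  finitely_valued s -> mu (D `&` s @^-1` B) \is a fin_num.
Proof.
move=> fs; rewrite ge0_fin_numE//; apply: le_lt_trans finD.
by apply: le_measure => //; apply/mem_set => //; exact: finitely_valued_preimage.
Qed.

Definition fiber_measure (Y : Type) (s : T -> Y) (y : Y) : R :=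
  fine (mu (D `&` s @^-1` [set y])).

Lemma fiber_measure_ge0 (Y : Type) (s : T -> Y) y : 0 <= fiber_measure s y.
Proof. exact: fine_ge0. Qed.

Lemma fiber_measure_comp (Y : choiceType) (Z : choiceType) (s : T -> Y)
    (phi : Y -> Z) z : finitely_valued s ->
  fiber_measure (phi \o s) z =
  \sum_(y <- fset_set (range s) | phi y == z) fiber_measure s y.
Proof.
move=> fs; rewrite /fiber_measure.
rewrite (_ : D `&` _ = \bigcup_(y in range s `&` phi @^-1` [set z])
    (D `&` s @^-1` [set y])); last first.
  apply/seteqP; split=> [x [Dx Bx]|x [y [_ By] [Dx /= sy]]].
    by exists (s x) => //; split=> //; exists x.
  by split=> //=; rewrite sy.
have ff : finite_set (range s `&` phi @^-1` [set z]).
  by apply: finite_setIl; exact: fs.1.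
rewrite measure_fin_bigcup//; last 2 first.
  by move=> y1 y2 _ _ [x [/= [_ <-] [_ <-]]].
  by move=> y _; exact: fs.2.
rewrite fsbig_finite//= -sum_fine; last first.
  by move=> y _; exact: finitely_valued_fin_num.
rewrite -big_filter; apply: perm_big; apply: uniq_perm.
- exact: finmap.fset_uniq.
- exact/filter_uniq/finmap.fset_uniq.
move=> y; rewrite mem_filter !in_fset_set//; last exact: fs.1.
rewrite in_setI andbC; congr (_ && _).
by apply/idP/eqP => [/set_mem//|yz]; exact: mem_set.
Qed.

Definition simple_integral (X : normedModType R) (s : T -> X) : X :=
  \sum_(x \in [set: X]) fiber_measure s x *: x.

(** The fibres of [phi \o s] are finite disjoint unions of fibres of [s]. With a pair of functions
    as [s] and projections or their sum as [phi], all integrals are written over a common partition,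
    which yields additivity and the norm bounds. *)
Lemma simple_integral_comp (X : normedModType R) (Y : choiceType) (s : T -> Y)
    (phi : Y -> X) : finitely_valued s ->
  simple_integral (phi \o s) =
  \sum_(y <- fset_set (range s)) fiber_measure s y *: phi y.
Proof.
move=> fs; rewrite /simple_integral.
have fphi := (finitely_valued_comp phi fs).1.
rewrite -(@fsbig_widen _ _ _ _ (range (phi \o s)))//; last first.
  move=> x [_ /= xs]; rewrite /fiber_measure (_ : _ `&` _ = set0).
    by rewrite measure0 scale0r.
  by apply/seteqP; split=> t //= [_ tx]; apply: xs; exists t.
rewrite fsbig_finite//=.
under eq_bigr do rewrite fiber_measure_comp// scaler_suml.
rewrite (exchange_big_dep xpredT)//=; apply: eq_big_seq => y ys.
rewrite big_mkcond (bigD1_seq (phi y))//=; [|  |exact: finmap.fset_uniq].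
  by rewrite eqxx big1 ?addr0// => x; rewrite eq_sym => /negbTE ->.
rewrite in_fset_set// inE; move: ys; rewrite in_fset_set; last exact: fs.1.
by rewrite inE => -[x _ <-]; exists x.
Qed.

Lemma integral_finitely_valued (Y : choiceType) (s : T -> Y) (phi : Y -> R) :
  finitely_valued s -> (forall y, 0 <= phi y) ->
  (\int[mu]_(x in D) (phi (s x))%:E =
   (\sum_(y <- fset_set (range s)) fiber_measure s y * phi y)%:E)%E.
Proof.
move=> fs phi0.
have DE : D = \big[setU/set0]_(y <- fset_set (range s)) (D `&` s @^-1` [set y]).
  rewrite bigsetU_fset_set; last exact: fs.1.
  apply/seteqP; split=> [x Dx|x [y _ []]//].
  by exists (s x).
rewrite [in LHS]DE ge0_integral_bigsetU//.
- rewrite -sumEFin; apply: eq_bigr => y _.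
  rewrite (eq_integral (fun=> (phi y)%:E)); last first.
    by move=> x; rewrite inE => -[_ /= ->].
  rewrite integral_cst//; last exact: fs.2.
  rewrite muleC EFinM; congr (_ * _)%E.
  rewrite /fiber_measure fineK//; exact: finitely_valued_fin_num.
- by move=> y; exact: fs.2.
- by move=> y1 y2 _ _ [x [/= [_ <-] [_ <-]]].
- rewrite -DE; apply/measurable_EFinP.
  exact: (finitely_valued_measurable phi fs).
- by move=> x _; rewrite lee_fin.
Qed.

Lemma integral_finitely_valued_lty (Y : choiceType) (s : T -> Y) (phi : Y -> R) :
  finitely_valued s -> (forall y, 0 <= phi y) ->
  (\int[mu]_(x in D) (phi (s x))%:E < +oo)%E.
Proof. by move=> fs phi0; rewrite integral_finitely_valued// ltry. Qed.

Section Vector.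
Variable X : normedModType R.
Implicit Types s t : T -> X.

Lemma simple_integralD s t : finitely_valued s -> finitely_valued t ->
  simple_integral (fun x => s x + t x) = simple_integral s + simple_integral t.
Proof.
move=> fs ft; have fp := finitely_valued_pair fs ft.
rewrite (simple_integral_comp (fun p => p.1 + p.2) fp).
rewrite (simple_integral_comp fst fp) (simple_integral_comp snd fp).
by rewrite -big_split/=; apply: eq_bigr => p _; rewrite scalerDr.
Qed.

Lemma simple_integralB_norm s t : finitely_valued s -> finitely_valued t ->
  (`|simple_integral s - simple_integral t|%:E <=
   \int[mu]_(x in D) (`|s x - t x|)%:E)%E.
Proof.
move=> fs ft; have fp := finitely_valued_pair fs ft.
rewrite (integral_finitely_valued (phi := fun p => `|p.1 - p.2|) fp)//.
rewrite (simple_integral_comp fst fp) (simple_integral_comp snd fp).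
rewrite lee_fin -sumrB; apply: le_trans (ler_norm_sum _ _ _) _.
apply: ler_sum => p _; rewrite -scalerBr normrZ ger0_norm//.
exact: fiber_measure_ge0.
Qed.

Lemma simple_integral_norm s : finitely_valued s ->
  (`|simple_integral s|%:E <= \int[mu]_(x in D) (`|s x|)%:E)%E.
Proof.
move=> fs; rewrite (integral_finitely_valued (phi := fun p => `|p|) fs)//.
rewrite (simple_integral_comp id fs) lee_fin.
apply: le_trans (ler_norm_sum _ _ _) _.
apply: ler_sum => p _; rewrite normrZ ger0_norm//.
exact: fiber_measure_ge0.
Qed.

End Vector.

Lemma simple_integral_lin (X : normedModType R) (Y : normedModType R)
    (L : {linear X -> Y}) (s : T -> X) : finitely_valued s ->
  simple_integral (L \o s) = L (simple_integral s).
Proof.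
move=> fs; rewrite (simple_integral_comp L fs) (simple_integral_comp id fs).
by rewrite linear_sum; apply: eq_bigr => y _; rewrite linearZ.
Qed.

End FinitelyValued.

(** * Monotonicity of the integral for nonnegative functions that may fail to be measurable *)

Section LowerIntegral.
Import HBSimple HBNNSimple.
Context d (T : measurableType d) (R : realType).
Variables (mu : {measure set T -> \bar R}) (D : set T).
Hypothesis mD : measurable D.

Lemma ae_null (N : set T) (P : T -> Prop) : measurable N -> mu N = 0%E ->
  (forall x, ~ N x -> P x) -> {ae mu, forall x, P x}.
Proof.
move=> mN N0 NP; exists N; split=> // x /= nP.
by apply: contrapT => nN; apply: nP; exact: NP.
Qed.

Lemma ae_nullP (P : T -> Prop) : {ae mu, forall x, P x} ->
  exists N, [/\ measurable N, mu N = 0%E & forall x, ~ N x -> P x].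
Proof.
move=> [N [mN N0 NP]]; exists N; split=> // x nN.
by apply: contrapT => nP; exact/nN/NP.
Qed.

(* Neither function is assumed to be measurable: for nonnegative functions
   [\int] is then the lower integral. *)
Lemma lower_integral_le (f g : T -> \bar R) :
  (forall x, D x -> (0 <= f x)%E) -> (forall x, D x -> (f x <= g x)%E) ->
  (\int[mu]_(x in D) f x <= \int[mu]_(x in D) g x)%E.
Proof.
move=> f0 fg; have g0 x : D x -> (0 <= g x)%E.
  by move=> Dx; exact: le_trans (f0 _ Dx) (fg _ Dx).
rewrite !ge0_integralE//; apply: le_ereal_sup => _ [h /= hf <-].
exists h => // x; apply: le_trans (hf x) _.
by rewrite !patchE; case: ifPn => // /set_mem; exact: fg.
Qed.

(** A simple function below [f] is measurable and almost everywhere below [g], so that measurability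
    is asked of [g] alone. Norms of almost everywhere limits are compared in this way with
    measurable representatives. *)
Lemma lower_integral_ae_le (f g : T -> \bar R) :
  (forall x, D x -> (0 <= f x)%E) -> (forall x, D x -> (0 <= g x)%E) ->
  measurable_fun D g -> {ae mu, forall x, D x -> (f x <= g x)%E} ->
  (\int[mu]_(x in D) f x <= \int[mu]_(x in D) g x)%E.
Proof.
move=> f0 g0 mg fg; rewrite [leLHS]ge0_integralE//.
apply: ub_ereal_sup => _ [h /= hf <-].
rewrite -integralT_nnsfun [leRHS]integral_mkcond.
apply: ae_ge0_le_integral => //.
- by move=> x _; rewrite lee_fin; exact: fun_ge0.
- by apply/measurable_EFinP; exact: measurable_funP.
- by move=> x _; rewrite patchE; case: ifPn => // /set_mem; exact: g0.
- exact/(measurable_restrictT _ mD).1.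
apply: filterS fg => x fg _; have := hf x.
rewrite !patchE; case: ifPn => //= /set_mem Dx hfx.
exact: le_trans hfx (fg Dx).
Qed.

End LowerIntegral.

Lemma ereal_cvg0_lt (R : realType) (e : nat -> \bar R) :
  e n @[n --> \oo] --> 0%E -> forall eps : R, 0 < eps ->
  \forall n \near \oo, (e n < eps%:E)%E.
Proof.
move=> e0 eps eps0; exact: (e0 _ (@nbhs_open_ereal_lt R 0 (fun=> eps) eps0)).
Qed.

(** * Strong measurability *)

Section StronglyMeasurable.
Import HBSimple.
Context d (T : measurableType d) (R : realType).
Variables (mu : {measure set T -> \bar R}) (D : set T).
Hypothesis mD : measurable D.

Definition strongly_measurable (X : normedModType R) (f : T -> X) :=
  exists2 s : nat -> T -> X, (forall n, finitely_valued D (s n)) &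
    {ae mu, forall x, D x -> s n x @[n --> \oo] --> f x}.

Lemma strongly_measurable_finite (X : normedModType R) (f : T -> X) :
  finitely_valued D f -> strongly_measurable f.
Proof. by move=> ff; exists (fun=> f) => //; apply: aeW => x _; exact: cvg_cst. Qed.

Lemma strongly_measurable_cst (X : normedModType R) (x : X) :
  strongly_measurable (cst x).
Proof. exact/strongly_measurable_finite/finitely_valued_cst. Qed.

Lemma strongly_measurable_comp2 (X Y Z : normedModType R) (op : X * Y -> Z)
    (f : T -> X) (g : T -> Y) : continuous op ->
  strongly_measurable f -> strongly_measurable g ->
  strongly_measurable (fun x => op (f x, g x)).
Proof.
move=> cop [s fs sf] [t ft tg]; exists (fun n x => op (s n x, t n x)).
  move=> n; exact: (finitely_valued_comp op (finitely_valued_pair (fs n) (ft n))).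
apply: filterS2 sf tg => x sf tg Dx.
exact: (cvg_comp _ _ (cvg_pair (sf Dx) (tg Dx)) (cop (f x, g x))).
Qed.

Lemma strongly_measurableD (X : normedModType R) (f g : T -> X) :
  strongly_measurable f -> strongly_measurable g ->
  strongly_measurable (fun x => f x + g x).
Proof. exact: (strongly_measurable_comp2 (@add_continuous _)). Qed.

Lemma strongly_measurableZ (X : normedModType R) (k : T -> R) (f : T -> X) :
  strongly_measurable (k : T -> R^o) -> strongly_measurable f ->
  strongly_measurable (fun x => k x *: f x).
Proof. exact: (strongly_measurable_comp2 (@scale_continuous _ _)). Qed.

Lemma strongly_measurableB (X : normedModType R) (f g : T -> X) :
  strongly_measurable f -> strongly_measurable g ->
  strongly_measurable (fun x => f x - g x).
Proof.
move=> sf sg; apply: strongly_measurableD => //.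
rewrite (_ : (fun x => - g x) = (fun x => cst (-1) x *: g x)).
  by apply: strongly_measurableZ => //; exact: strongly_measurable_cst.
by apply/funext => x; rewrite scaleN1r.
Qed.

Lemma strongly_measurable_measurable (k : T -> R) :
  measurable_fun D k -> strongly_measurable (k : T -> R^o).
Proof.
move=> /measurable_EFinP mk; have [s sk] := approximation_sfun mD mk.
exists (fun n => HBSimple.SimpleFun.sort (s n)).
  move=> n; split => // y; apply: measurableI => //.
by apply: aeW => x Dx; have /fine_cvgP[] := sk x Dx.
Qed.

Lemma finitely_valued_norm (X : normedModType R) (s : T -> X) :
  finitely_valued D s -> measurable_fun D (fun x => `|s x|).
Proof.
by move=> fs; apply: (@finitely_valued_measurable _ _ _ _ _ _ s Num.Def.normr).
Qed.

(** The values of [f] on a null set are arbitrary, so the norm of [f] may fail to be measurable.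
    Setting it to 0 on a measurable null set outside which the simple functions converge gives a
    measurable minorant that is almost everywhere equal to it. *)
Lemma strongly_measurable_norm (X : normedModType R) (f : T -> X) :
  strongly_measurable f -> exists m : T -> R,
  [/\ measurable_fun D m, forall x, 0 <= m x, forall x, m x <= `|f x| &
      {ae mu, forall x, D x -> m x = `|f x|}].
Proof.
move=> [s fs /ae_nullP[N [mN N0 sf]]].
exists (fun x => if x \in N then 0 else `|f x|); split.
- apply: (@measurable_fun_cvg _ _ _ _ (fun n x => if x \in N then 0 else `|s n x|)).
    move=> n; rewrite (_ : (fun x => _) =
        (fun x => Num.Def.normr (if x \in ~` N then s n x else 0))).
      apply: finitely_valued_norm.
      by apply: finitely_valued_patch => //; exact: measurableC.
    by apply/funext => x; rewrite in_setC; case: (x \in N); rewrite /= ?normr0.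
  move=> x Dx; case: ifPn => [_|]; first exact: cvg_cst.
  by rewrite notin_setE => Nx; apply: cvg_norm; exact: sf.
- by move=> x; case: ifP.
- by move=> x; case: ifP.
- apply: (ae_null mN N0) => x Nx _; case: ifPn => // /set_mem //.
Qed.

End StronglyMeasurable.

(** * Bochner integral: existence, domination, additivity *)

Section BochnerIntegral.
Context d (T : measurableType d) (R : realType).
Variables (mu : {measure set T -> \bar R}) (D : set T).
Hypotheses (mD : measurable D) (finD : (mu D < +oo)%E).
Variable X : completeNormedModType R.
Implicit Types f g : T -> X.

Definition approximated f (s : nat -> T -> X) :=
  [/\ forall n, finitely_valued D (s n),
      {ae mu, forall x, D x -> s n x @[n --> \oo] --> f x} &
      (\int[mu]_(x in D) (`|f x - s n x|)%:E)%E @[n --> \oo] --> 0%E].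

Lemma bochner_approxE f (s : nat -> {fimfun T >-> X}) :
  bochner_approx mu D f s <-> approximated f s.
Proof.
split=> -[ss sf s0]; split=> // n.
  by split=> [|y]; [exact: fimfunP|exact: (ss n y).1].
move=> y; split=> [|_]; first exact: (ss n).2.
rewrite -ge0_fin_numE//.
exact: (finitely_valued_fin_num mD finD _ (ss n)).
Qed.

Lemma approximated_fimfun f (s : nat -> T -> X) : approximated f s ->
  exists2 s' : nat -> {fimfun T >-> X}, bochner_approx mu D f s' &
    forall n, s' n = s n :> (T -> X).
Proof.
move=> fs; have [ss _ _] := fs.
pose s' n := fimfun_Sub (mem_set (ss n).1 : s n \in fimfun).
by exists s' => //; apply/bochner_approxE.
Qed.

Lemma bochner_integrableE f :
  bochner_integrable mu D f <-> exists s, approximated f s.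
Proof.
split=> [[s /bochner_approxE fs]|[s /approximated_fimfun[s' fs' _]]].
  by exists (fun n => s n).
by exists s'.
Qed.

Lemma is_bochner_integralE f v : is_bochner_integral mu D f v <->
  exists2 s, approximated f s & simple_integral mu D (s n) @[n --> \oo] --> v.
Proof.
split=> [[s /bochner_approxE fs sv]|[s /approximated_fimfun[s' fs' ss'] sv]].
  by exists (fun n => s n).
exists s' => //; rewrite (_ : (fun n => _) = (fun n => simple_integral mu D (s n)))//.
by apply/funext => n; rewrite -ss'.
Qed.

(** Lower integrals need not be subadditive. The norms on the right are replaced by their measurable
    minorants [m] and [p], whose integrals do add up, and the triangle inequality is needed almost
    everywhere only. *)
Lemma integral_norm_triangle f s t : strongly_measurable mu D f ->
  finitely_valued D s -> finitely_valued D t ->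
  (\int[mu]_(x in D) (`|s x - t x|)%:E <=
   \int[mu]_(x in D) (`|f x - s x|)%:E + \int[mu]_(x in D) (`|f x - t x|)%:E)%E.
Proof.
move=> sf fs ft.
have [m [mm m0 mle mE]] := strongly_measurable_norm mD
  (strongly_measurableB mD sf (strongly_measurable_finite mu fs)).
have [p [mp p0 ple pE]] := strongly_measurable_norm mD
  (strongly_measurableB mD sf (strongly_measurable_finite mu ft)).
apply: (@le_trans _ _ (\int[mu]_(x in D) ((m x)%:E + (p x)%:E))%E).
  apply: lower_integral_ae_le => //.
  - by move=> x _; rewrite adde_ge0// lee_fin.
  - by apply: emeasurable_funD; exact/measurable_EFinP.
  apply: filterS2 mE pE => x mE pE Dx; rewrite -EFinD lee_fin mE// pE//.
  rewrite (_ : s x - t x = (f x - t x) - (f x - s x)).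
    by rewrite [leRHS]addrC; exact: ler_normB.
  by rewrite opprB [RHS]addrC addrA subrK.
rewrite ge0_integralD//; [|by move=> x _; rewrite lee_fin| |
  by move=> x _; rewrite lee_fin|]; last 2 first.
- exact/measurable_EFinP.
- exact/measurable_EFinP.
by apply: leeD; apply: lower_integral_le => // x _; rewrite lee_fin.
Qed.

Lemma approximated_strongly_measurable f s :
  approximated f s -> strongly_measurable mu D f.
Proof. by move=> [fs sf _]; exists s. Qed.

Lemma approximated_near f s : approximated f s -> forall eps : R, 0 < eps ->
  \forall n \near \oo, (\int[mu]_(x in D) (`|f x - s n x|)%:E < eps%:E)%E.
Proof. by move=> [_ _ s0] eps eps0; exact: ereal_cvg0_lt. Qed.

Lemma simple_integral_near f s t : strongly_measurable mu D f ->
  finitely_valued D s -> finitely_valued D t -> forall a b : R,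
  (\int[mu]_(x in D) (`|f x - s x|)%:E < a%:E)%E ->
  (\int[mu]_(x in D) (`|f x - t x|)%:E < b%:E)%E ->
  `|simple_integral mu D s - simple_integral mu D t| < a + b.
Proof.
move=> sf fs ft a b sa tb; rewrite -lte_fin.
apply: le_lt_trans (simple_integralB_norm mD finD fs ft) _.
apply: le_lt_trans (integral_norm_triangle sf fs ft) _.
by rewrite EFinD lteD.
Qed.

Lemma approximated_cvg f s : approximated f s ->
  cvg (simple_integral mu D (s n) @[n --> \oo]).
Proof.
move=> fs; have sf := approximated_strongly_measurable fs.
apply/cauchy_cvgP/cauchy_exP => eps eps0.
have e2 : 0 < eps / 2 by rewrite divr_gt0.
have [N _ NP] := approximated_near fs e2.
exists (simple_integral mu D (s N)); exists N => // n /= Nn.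
rewrite -ball_normE /ball_/= [eps]splitr; apply: (simple_integral_near sf).
- by have [] := fs.
- by have [] := fs.
- exact: NP (leqnn N).
- exact: NP.
Qed.

Lemma approximated_unique f s t (v w : X) : approximated f s -> approximated f t ->
  simple_integral mu D (s n) @[n --> \oo] --> v ->
  simple_integral mu D (t n) @[n --> \oo] --> w -> v = w.
Proof.
move=> fs ft sv tw; have sf := approximated_strongly_measurable fs.
apply/eqP; rewrite -subr_eq0 -normr_le0; apply/ler_addgt0Pr => eps eps0.
rewrite add0r.
have nst : `|simple_integral mu D (s n) - simple_integral mu D (t n)|
    @[n --> \oo] --> `|v - w| by apply: cvg_norm; exact: cvgB.
apply: (cvgr_to_le nst).
have e2 : 0 < eps / 2 by rewrite divr_gt0.
near=> n; rewrite [eps]splitr; apply/ltW/(simple_integral_near sf).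
- by have [] := fs.
- by have [] := ft.
- by near: n; exact: (approximated_near fs e2).
- by near: n; exact: (approximated_near ft e2).
Unshelve. all: by end_near. Qed.

Lemma bochner_integral_approximated f s : approximated f s ->
  simple_integral mu D (s n) @[n --> \oo] --> bochner_integral mu D f.
Proof.
move=> fs; have /cvg_ex[v sv] := approximated_cvg fs.
have fv : is_bochner_integral mu D f v by apply/is_bochner_integralE; exists s.
rewrite /bochner_integral; case: xgetP => [w _ /is_bochner_integralE[t ft tw]|].
  by rewrite -(approximated_unique fs ft sv tw).
by move=> /(_ v).
Qed.

Lemma bochner_integral_unique f s (v : X) : approximated f s ->
  simple_integral mu D (s n) @[n --> \oo] --> v -> bochner_integral mu D f = v.
Proof.
move=> fs sv; have := bochner_integral_approximated fs.
by move=> /(approximated_unique fs fs sv).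
Qed.

(** The simple functions that converge to [f] are truncated by the norm of [f], after which
    dominated convergence gives convergence in mean. *)
Lemma bochner_integrable_dominated f (k : T -> R) :
  strongly_measurable mu D f -> mu.-integrable D (EFin \o k) ->
  {ae mu, forall x, D x -> `|f x| <= k x} -> bochner_integrable mu D f.
Proof.
move=> sf ik fk; have [s fs scv] := sf.
have [m [mm m0 mle mE]] := strongly_measurable_norm mD sf.
(* The factor 2 makes the truncation eventually inactive where [f x != 0], since the norm of [s n x]
   tends to that of [f x], which is less than its double. Where [f x = 0] the truncation forces
   [t n x = 0]. *)
pose A n := D `&` [set x | `|s n x| <= 2 * m x].
have mA n : measurable (A n).
  apply: measurable_fun_le => //.
    exact: finitely_valued_norm.
  exact: measurable_funM.
pose t n x := if x \in A n then s n x else 0.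
have ft n : finitely_valued D (t n) by exact: finitely_valued_patch.
have tle n x : `|t n x| <= 2 * m x.
  rewrite /t; case: ifPn => [/set_mem[]//|_].
  by rewrite normr0 mulr_ge0.
have tcv : {ae mu, forall x, D x -> t n x @[n --> \oo] --> f x}.
  apply: filterS2 mE scv => x mE scv Dx.
  have [fx0|fx0] := eqVneq (f x) 0.
    rewrite fx0 (_ : t ^~ x = cst 0); first exact: cvg_cst.
    apply/funext => n; apply/eqP; rewrite -normr_le0.
    by apply: le_trans (tle n x) _; rewrite mE// fx0 normr0 mulr0.
  apply: cvg_trans (scv Dx); apply: near_eq_cvg.
  have : `|s n x| @[n --> \oo] --> `|f x| by apply: cvg_norm; exact: scv.
  move=> /cvgr_le /(_ (2 * `|f x|)); rewrite mulr_natl mulr2n ltrDl normr_gt0.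
  move=> /(_ fx0); apply: filterS => n sn; rewrite /t mem_set//.
  by split=> //=; rewrite mE// mulr_natl mulr2n.
apply/bochner_integrableE; exists t; split => //.
have /choice[p pP] : forall n, exists p : T -> R, [/\ measurable_fun D p,
    forall x, 0 <= p x, forall x, p x <= `|f x - t n x| &
    {ae mu, forall x, D x -> p x = `|f x - t n x|}].
  move=> n; apply: (strongly_measurable_norm mD); apply: strongly_measurableB => //.
  exact: strongly_measurable_finite.
have pE : {ae mu, forall x, forall n, D x -> p n x = `|f x - t n x|}.
  apply/ae_foralln => n; by have [] := pP n.
(* The norm of [f x] is at most [k x] and that of [t n x] at most [2 * k x]. *)
have ik3 : mu.-integrable D (EFin \o (fun x => 3 * k x)).
  by have := integrableZl mD 3 ik; apply: eq_integrable.
have := @dominated_convergence _ _ _ mu D mD (fun n => EFin \o p n) (cst 0%E)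
  (EFin \o (fun x => 3 * k x)).
case.
- by move=> n; apply/measurable_EFinP; have [] := pP n.
- exact: measurable_cst.
- apply: filterS2 pE tcv => x pE tcv Dx.
  apply/fine_cvgP; split; first exact: nearW.
  rewrite (_ : fine \o _ = (fun n => `|f x - t n x|)); last first.
    by apply/funext => n /=; rewrite pE.
  rewrite -[X in _ --> X](normr0 X) -(subrr (f x)).
  by apply: cvg_norm; apply: cvgB; [exact: cvg_cst|exact: tcv].
- exact: ik3.
- apply: filterS3 pE mE fk => x pE mE fk n Dx /=.
  rewrite lee_fin pE// normr_id; apply: le_trans (ler_normB _ _) _.
  have := fk Dx; have := tle n x; rewrite mE//; lra.
move=> _ _; rewrite integral0 => p0.
apply: (squeeze_cvge _ (cvg_cst 0%E) p0); apply: nearW => n.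
rewrite integral_ge0//=.
apply: lower_integral_ae_le => //.
- by move=> x _; rewrite lee_fin; have [] := pP n.
- by apply/measurable_EFinP; have [] := pP n.
by apply: filterS pE => x pE Dx; rewrite lee_fin pE.
Qed.

Lemma bochner_integrable_strongly_measurable f :
  bochner_integrable mu D f -> strongly_measurable mu D f.
Proof. by move=> /bochner_integrableE[s]; exact: approximated_strongly_measurable. Qed.

Lemma bochner_integrable_dominating f : bochner_integrable mu D f ->
  exists m : T -> R, [/\ forall x, 0 <= m x, mu.-integrable D (EFin \o m) &
    {ae mu, forall x, D x -> `|f x| <= m x}].
Proof.
move=> /bochner_integrableE[s fs]; have sf := approximated_strongly_measurable fs.
have [m [mm m0 mle mE]] := strongly_measurable_norm mD sf.
exists m; split => //; last by apply: filterS mE => x mE Dx; rewrite mE.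
apply/integrableP; split; first exact/measurable_EFinP.
(* The norm of [f] is at most that of [f - s N], of integral less than 1, plus that of [s N], a
   finitely valued function. *)
have [N _ NP] := approximated_near fs (@ltr01 R).
have [/(_ N) fsN _ _] := fs.
have [p [mp p0 ple pE]] := strongly_measurable_norm mD
  (strongly_measurableB mD sf (strongly_measurable_finite mu fsN)).
apply: (@le_lt_trans _ _ (\int[mu]_(x in D) ((p x)%:E + `|s N x|%:E))%E).
  apply: lower_integral_ae_le => //.
  - by move=> x _; rewrite adde_ge0// lee_fin.
  - apply: emeasurable_funD; apply/measurable_EFinP => //.
    exact: (finitely_valued_norm fsN).
  apply: filterS2 mE pE => x mE pE Dx /=; rewrite -EFinD lee_fin pE// mE//.
  by rewrite normr_id -lerBlDr; exact: lerB_dist.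
rewrite ge0_integralD//; [|by move=> x _; rewrite lee_fin| |]; last 2 first.
- exact/measurable_EFinP.
- apply/measurable_EFinP; exact: (finitely_valued_norm fsN).
apply: lte_add_pinfty; last first.
  exact: (integral_finitely_valued_lty (phi := Num.Def.normr) mD finD fsN).
apply: (@le_lt_trans _ _ (\int[mu]_(x in D) `|f x - s N x|%:E)%E).
  by apply: lower_integral_le => // x _; rewrite lee_fin.
apply: lt_trans (NP N (leqnn N)) _; exact: ltry.
Qed.

Lemma bochner_integral_norm f (k : T -> R) :
  bochner_integrable mu D f -> mu.-integrable D (EFin \o k) ->
  (forall x, D x -> 0 <= k x) -> {ae mu, forall x, D x -> `|f x| <= k x} ->
  (`|bochner_integral mu D f|%:E <= \int[mu]_(x in D) (k x)%:E)%E.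
Proof.
move=> /bochner_integrableE[s fs] ik k0 fk.
have sf := approximated_strongly_measurable fs.
have mk : measurable_fun D k by apply/measurable_EFinP; exact: measurable_int ik.
have /cvgr_dist_lt scv := bochner_integral_approximated fs.
apply/lee_addgt0Pr => eps eps0.
have e2 : 0 < eps / 2 by rewrite divr_gt0.
near \oo => n.
have fsn : finitely_valued D (s n) by have [] := fs.
have [p [mp p0 ple pE]] := strongly_measurable_norm mD
  (strongly_measurableB mD sf (strongly_measurable_finite mu fsn)).
have sle : (`|simple_integral mu D (s n)|%:E <=
    \int[mu]_(x in D) (k x)%:E + \int[mu]_(x in D) (p x)%:E)%E.
  apply: le_trans (simple_integral_norm mD finD fsn) _.
  rewrite -ge0_integralD//; last 3 first.
  - exact/measurable_EFinP.
  - by move=> x _; rewrite lee_fin.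
  - exact/measurable_EFinP.
  apply: lower_integral_ae_le => //.
  - by move=> x Dx; rewrite adde_ge0// lee_fin//; exact: k0.
  - by apply: emeasurable_funD; exact/measurable_EFinP.
  apply: filterS2 pE fk => x pE fk Dx; rewrite -EFinD lee_fin pE//.
  have := fk Dx; have := ler_normB (f x) (f x - s n x).
  by rewrite opprB addrCA subrr addr0; lra.
have ple2 : (\int[mu]_(x in D) (p x)%:E <= (eps / 2)%:E)%E.
  apply: (@le_trans _ _ (\int[mu]_(x in D) `|f x - s n x|%:E)%E).
    by apply: lower_integral_le => // x _; rewrite lee_fin.
  by apply: ltW; near: n; exact: approximated_near.
apply: (@le_trans _ _ ((eps / 2)%:E + `|simple_integral mu D (s n)|%:E)%E).
  rewrite -EFinD lee_fin -lerBlDr; apply: le_trans (lerB_dist _ _) _.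
  by apply: ltW; near: n; exact: scv.
rewrite [eps in leRHS]splitr EFinD addeA [leRHS]addeC; apply: leeD => //.
by apply: le_trans sle _; exact: leeD.
Unshelve. all: by end_near. Qed.

Lemma bochner_integral_ae f g : {ae mu, forall x, D x -> f x = g x} ->
  bochner_integrable mu D f ->
  bochner_integrable mu D g /\ bochner_integral mu D g = bochner_integral mu D f.
Proof.
move=> fg /bochner_integrableE[s fs].
have gs : approximated g s.
  have [ss sf s0] := fs; split => //.
    by apply: filterS2 fg sf => x fg sf Dx; rewrite -fg//; exact: sf.
  apply: (squeeze_cvge _ (cvg_cst 0%E) s0); apply: nearW => n.
  rewrite integral_ge0//=.
  have [p [mp p0 ple pE]] := strongly_measurable_norm mD
    (strongly_measurableB mD (approximated_strongly_measurable fs)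
      (strongly_measurable_finite mu (ss n))).
  apply: (@le_trans _ _ (\int[mu]_(x in D) (p x)%:E)%E); last first.
    by apply: lower_integral_le => // x _; rewrite lee_fin.
  apply: lower_integral_ae_le => //.
  - by move=> x _; rewrite lee_fin.
  - exact/measurable_EFinP.
  by apply: filterS2 fg pE => x fg pE Dx; rewrite lee_fin pE// fg.
split; first by apply/bochner_integrableE; exists s.
exact: bochner_integral_unique gs (bochner_integral_approximated fs).
Qed.

Lemma bochner_integralD f g :
  bochner_integrable mu D f -> bochner_integrable mu D g ->
  bochner_integrable mu D (fun x => f x + g x) /\
  bochner_integral mu D (fun x => f x + g x) =
  bochner_integral mu D f + bochner_integral mu D g.
Proof.
move=> /bochner_integrableE[s fs] /bochner_integrableE[t gt].
have [ss sf s0] := fs; have [tt tg t0] := gt.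
have fgst : approximated (fun x => f x + g x) (fun n x => s n x + t n x).
  split.
  - move=> n.
    exact: (finitely_valued_comp (fun p => p.1 + p.2)
      (finitely_valued_pair (ss n) (tt n))).
  - by apply: filterS2 sf tg => x sf tg Dx; apply: cvgD; [exact: sf|exact: tg].
  have st0 : (\int[mu]_(x in D) (`|f x - s n x|)%:E +
      \int[mu]_(x in D) (`|g x - t n x|)%:E)%E @[n --> \oo] --> 0%E.
    by rewrite -[X in _ --> X](adde0 0%E); apply: cvgeD.
  apply: (squeeze_cvge _ (cvg_cst 0%E) st0); apply: nearW => n.
  rewrite integral_ge0//=.
  have [p [mp p0 ple pE]] := strongly_measurable_norm mD
    (strongly_measurableB mD (approximated_strongly_measurable fs)
      (strongly_measurable_finite mu (ss n))).
  have [q [mq q0 qle qE]] := strongly_measurable_norm mD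
    (strongly_measurableB mD (approximated_strongly_measurable gt)
      (strongly_measurable_finite mu (tt n))).
  apply: (@le_trans _ _ (\int[mu]_(x in D) ((p x)%:E + (q x)%:E))%E).
    apply: lower_integral_ae_le => //.
    - by move=> x _; rewrite adde_ge0// lee_fin.
    - by apply: emeasurable_funD; exact/measurable_EFinP.
    apply: filterS2 pE qE => x pE qE Dx; rewrite -EFinD lee_fin pE// qE//.
    by rewrite opprD addrACA; exact: ler_normD.
  rewrite ge0_integralD//; [|by move=> x _; rewrite lee_fin| |
    by move=> x _; rewrite lee_fin|]; last 2 first.
  - exact/measurable_EFinP.
  - exact/measurable_EFinP.
  by apply: leeD; apply: lower_integral_le => // x _; rewrite lee_fin.
split; first by apply/bochner_integrableE; eexists; exact: fgst.
apply: (bochner_integral_unique fgst).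
rewrite (_ : (fun n => _) = (fun n => simple_integral mu D (s n) +
    simple_integral mu D (t n))); last first.
  by apply/funext => n; rewrite simple_integralD.
by apply: cvgD; exact: bochner_integral_approximated.
Qed.

End BochnerIntegral.

(** * Bochner integral: linear maps, real integrands, restriction *)

Section BochnerIntegralOperations.
Context d (T : measurableType d) (R : realType).
Variables (mu : {measure set T -> \bar R}) (D : set T).
Hypotheses (mD : measurable D) (finD : (mu D < +oo)%E).

(** Composing an approximating sequence with [L] multiplies the errors in mean by at most [K]. The
    maps of interest are multiplication of vectors by a fixed scalar and of a fixed vector by
    scalars. *)
Lemma bochner_integral_linear (X Y : completeNormedModType R) (L : X -> Y)
    (K : R) (f : T -> X) :
  linear L -> continuous L -> 0 <= K -> (forall x, `|L x| <= K * `|x|) ->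
  bochner_integrable mu D f ->
  bochner_integrable mu D (L \o f) /\
  bochner_integral mu D (L \o f) = L (bochner_integral mu D f).
Proof.
move=> linL cL K0 LK /(bochner_integrableE mD finD)[s fs].
have [ss sf s0] := fs.
pose L' : {linear X -> Y} := HB.pack L (GRing.isLinear.Build R X Y *:%R L linL).
have LB x y : L x - L y = L (x - y) by rewrite -[L]/(L' : X -> Y) linearB.
have Lfs : approximated mu D (L \o f) (fun n => L \o s n).
  split.
  - by move=> n; exact: finitely_valued_comp.
  - apply: filterS sf => x sf Dx.
    by apply: (cvg_comp _ _ (sf Dx)); exact: cL.
  apply: (@squeeze_cvge _ _ _ _ (cst 0%E) _
      (fun n => K%:E * \int[mu]_(x in D) (`|f x - s n x|)%:E)%E).
  - apply: nearW => n; rewrite integral_ge0//=.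
    have [p [mp p0 ple pE]] := strongly_measurable_norm mD
      (strongly_measurableB mD (approximated_strongly_measurable fs)
        (strongly_measurable_finite mu (ss n))).
    apply: (@le_trans _ _ (\int[mu]_(x in D) (K%:E * (p x)%:E))%E).
      apply: lower_integral_ae_le => //.
      + by move=> x _; rewrite -EFinM lee_fin mulr_ge0.
      + by apply/measurable_EFinP; apply: measurable_funM.
      by apply: filterS pE => x pE Dx; rewrite -EFinM lee_fin pE// LB.
    rewrite ge0_integralZl_EFin//; [|by move=> x _; rewrite lee_fin|]; last first.
      exact/measurable_EFinP.
    apply: lee_pmul => //; first by apply: integral_ge0 => x _; rewrite lee_fin.
    by apply: lower_integral_le => // x _; rewrite lee_fin.
  - exact: cvg_cst.
  by rewrite -(mule0 K%:E); apply: cvgeZl.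
split; first by apply/(bochner_integrableE mD finD); eexists; exact: Lfs.
apply: (bochner_integral_unique mD finD Lfs).
rewrite (_ : (fun n => _) = (fun n => L (simple_integral mu D (s n)))); last first.
  by apply/funext => n; exact: (simple_integral_lin mD finD L').
apply: (cvg_comp _ _ (bochner_integral_approximated mD finD fs)).
exact: cL.
Qed.

Lemma bochner_integralZ (X : completeNormedModType R) (c : R) (f : T -> X) :
  bochner_integrable mu D f ->
  bochner_integrable mu D (fun x => c *: f x) /\
  bochner_integral mu D (fun x => c *: f x) = c *: bochner_integral mu D f.
Proof.
apply: (@bochner_integral_linear X X ( *:%R c) `|c|) => //.
- by move=> a u v; rewrite scalerDr !scalerA mulrC.
- exact: scaler_continuous.
- by move=> x; rewrite normrZ.
Qed.

Lemma bochner_integralB (X : completeNormedModType R) (f g : T -> X) :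
  bochner_integrable mu D f -> bochner_integrable mu D g ->
  bochner_integrable mu D (fun x => f x - g x) /\
  bochner_integral mu D (fun x => f x - g x) =
  bochner_integral mu D f - bochner_integral mu D g.
Proof.
move=> fi /(bochner_integralZ (-1))[gi gE].
have [fgi fgE] := bochner_integralD mD finD fi gi.
rewrite (_ : (fun x => f x - g x) = (fun x => f x + -1 *: g x)).
  by rewrite fgE gE scaleN1r.
by apply/funext => x; rewrite scaleN1r.
Qed.

Lemma Rintegral_finitely_valued (s : T -> R) : finitely_valued D s ->
  \int[mu]_(x in D) s x = simple_integral mu D (s : T -> R^o).
Proof.
move=> fs; rewrite /Rintegral integralE.
rewrite (eq_integral (fun x => (Num.max (s x) 0)%:E)); last first.
  by move=> x _; rewrite funeposE EFin_max.
rewrite (eq_integral (fun x => (Num.max (- s x) 0)%:E)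
  (fun x => ((EFin \o s)^\-)%E x)); last first.
  by move=> x _; rewrite funenegE EFin_max.
rewrite (integral_finitely_valued mD finD (phi := fun y => Num.max y 0) fs);
  last by move=> y; rewrite le_max lexx orbT.
rewrite (integral_finitely_valued mD finD (phi := fun y => Num.max (- y) 0) fs);
  last by move=> y; rewrite le_max lexx orbT.
rewrite -EFinB/= (simple_integral_comp mD finD (id : R -> R^o) fs) -sumrB.
apply: eq_bigr => y _; rewrite -mulrBr; congr (_ * _).
case: (leP 0 y) => y0.
  by rewrite max_r ?subr0// oppr_le0.
by rewrite max_l ?sub0r ?opprK// oppr_ge0 ltW.
Qed.

(** An approximating sequence of simple functions converges to [k] in mean, hence its integrals
    converge to the Lebesgue integral as well. *)
Lemma bochner_integral_real (k : T -> R) : mu.-integrable D (EFin \o k) ->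
  bochner_integrable mu D (k : T -> R^o) /\
  bochner_integral mu D (k : T -> R^o) = \int[mu]_(x in D) k x.
Proof.
move=> ik.
have mk : measurable_fun D k by apply/measurable_EFinP; exact: measurable_int ik.
have ki : bochner_integrable mu D (k : T -> R^o).
  apply: (bochner_integrable_dominated (k := fun x => `|k x|) mD finD).
  - exact: strongly_measurable_measurable.
  - exact: integrable_norm ik.
  - exact: aeW.
split => //; have /(bochner_integrableE mD finD)[s ks] := ki.
apply: (bochner_integral_unique mD finD ks).
apply/cvgrPdist_lt => eps eps0; near=> n.
have [/(_ n) fs _ _] := ks.
have si : mu.-integrable D (EFin \o s n).
  apply/integrableP; split.
    apply/measurable_EFinP.
    by apply: (@finitely_valued_measurable _ _ _ _ _ _ (s n) id).
  exact: (integral_finitely_valued_lty (phi := Num.Def.normr) mD finD fs).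
have kB : mu.-integrable D (EFin \o (fun x => k x - s n x)).
  exact: (integrableB mD ik si).
rewrite -(Rintegral_finitely_valued fs) -RintegralB//.
apply: le_lt_trans (le_normr_Rintegral mD kB) _.
rewrite -lte_fin /Rintegral fineK//.
  by near: n; exact: (approximated_near ks).
exact: (integrable_fin_num mD (integrable_norm kB)).
Unshelve. all: by end_near. Qed.

(** Explicit Bochner integrals are reduced to real integrals in this way. *)
Lemma bochner_integral_cst_vec (X : completeNormedModType R) (k : T -> R)
    (v : X) : mu.-integrable D (EFin \o k) ->
  bochner_integrable mu D (fun x => k x *: v) /\
  bochner_integral mu D (fun x => k x *: v) = (\int[mu]_(x in D) k x) *: v.
Proof.
move=> /bochner_integral_real[ki <-].
apply: (@bochner_integral_linear R^o X (fun a => a *: v) `|v|) => //.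
- by move=> a x y; rewrite scalerDl scalerA.
- exact: scalel_continuous.
- by move=> x; rewrite normrZ mulrC.
Qed.

Lemma bochner_integral_restrict (X : completeNormedModType R) (A : set T)
    (f : T -> X) : measurable A -> A `<=` D -> bochner_integrable mu A f ->
  bochner_integrable mu D (fun x => if x \in A then f x else 0) /\
  bochner_integral mu D (fun x => if x \in A then f x else 0) =
  bochner_integral mu A f.
Proof.
move=> mA AD; have finA : (mu A < +oo)%E.
  by apply: le_lt_trans finD; apply: le_measure => //; exact: mem_set.
move=> /(bochner_integrableE mA finA)[s fs].
pose s' n x := if x \in A then s n x else 0.
have Ain n y : A `&` s' n @^-1` [set y] = A `&` s n @^-1` [set y].
  by apply/seteqP; split=> x [Ax] /=; rewrite /s' mem_set.
have [ss sf s0] := fs.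
have fs' : approximated mu D (fun x => if x \in A then f x else 0) s'.
  split.
  - move=> n; split.
      apply: (@sub_finite_set _ _ (range (s n) `|` [set 0])).
        move=> _ [x _ <-]; rewrite /s'; case: ifP => _; last by right.
        by left; exists x.
      by rewrite finite_setU; split; [exact: (ss n).1|exact: finite_set1].
    move=> y; rewrite -(setDUK AD) setIUl; apply: measurableU.
      by rewrite Ain; exact: (ss n).2.
    have [->|y0] := eqVneq y 0.
      rewrite (_ : _ `&` _ = D `\` A); first exact: measurableD.
      apply/seteqP; split=> [x /= [[Dx Ax] _]//|x /= [Dx Ax]]; split=> //.
      by rewrite /s' memNset.
    rewrite (_ : _ `&` _ = set0)//; apply/seteqP; split=> x //= [[Dx Ax]].
    by rewrite /s' memNset// => y0'; move: y0; rewrite -y0' eqxx.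
  - apply: filterS sf => x sf Dx; rewrite /s'; case: ifPn => [/set_mem|_].
      exact: sf.
    exact: cvg_cst.
  rewrite (_ : (fun n => _) =
    (fun n => \int[mu]_(x in A) `|f x - s n x|%:E)%E)//.
  apply/funext => n; rewrite integral_mkcond [RHS]integral_mkcond.
  apply: eq_integral => x _; rewrite !patchE /s'.
  case: (boolP (x \in A)) => [/set_mem Ax|_]; first by rewrite mem_set//; exact: AD.
  by rewrite subrr normr0 if_same.
split; first by apply/(bochner_integrableE mD finD); eexists; exact: fs'.
apply: (bochner_integral_unique mD finD fs').
rewrite (_ : (fun n => _) = (fun n => simple_integral mu A (s n))).
  exact: bochner_integral_approximated.
apply/funext => n; apply: eq_fsbigr => x _.
(* Extension by 0 enlarges only the fibre over 0, and the measure of that fibre is multiplied by the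
   vector 0. *)
have [->|x0] := eqVneq x 0; first by rewrite !scaler0.
congr (fine (mu _) *: _); rewrite -Ain.
apply/seteqP; split=> [t [Dt st]|t [At st]]; split=> //; last exact: AD.
by apply: contrapT => nAt; move: x0; rewrite -st /s' memNset// eqxx.
Qed.

End BochnerIntegralOperations.

(** * The kernels [t^(beta - 1)] and the Gamma function *)

Section ImproperFTC.
Context {R : realType}.
Local Notation leb := (@lebesgue_measure R).

(** The integrand may be unbounded at the end points, as a power with negative exponent is at 0. The
    ordinary theorem is applied on closed intervals that exhaust []a, b[], and monotone convergence
    concludes. *)
Lemma ge0_FTC2_oo (f F : R -> R) (a b : R) : a < b ->
  (forall x, x \in `]a, b[ -> 0 <= f x) -> {in `]a, b[, continuous f} ->
  (forall x, x \in `]a, b[ -> is_derive x 1 F (f x)) ->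
  F x @[x --> a^'+] --> F a -> F x @[x --> b^'-] --> F b ->
  (\int[leb]_(x in `]a, b[) (f x)%:E = (F b - F a)%:E)%E.
Proof.
move=> ab f0 cf dF Fa Fb.
(* Starting from the denominator 3 keeps [[a + e n, b - e n]] nondegenerate for every [n]. *)
pose e n : R := (b - a) / (n.+3)%:R.
have ba0 : 0 < b - a by rewrite subr_gt0.
have e0 n : 0 < e n by rewrite divr_gt0.
have e3 n : e n <= (b - a) / 3.
  by rewrite ler_pM2l// lef_pV2 ?posrE// ler_nat.
have ecv : e n @[n --> \oo] --> 0.
  rewrite -(mulr0 (b - a)); apply: cvgMr.
  have : harmonic (n + 2)%N @[n --> \oo] --> (0 : R).
    by rewrite (cvg_shiftn 2); exact: cvg_harmonic.
  apply: cvg_trans; apply: near_eq_cvg; apply: nearW => n.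
  by rewrite /harmonic/= addn2.
pose an n := a + e n; pose bn n := b - e n.
have sub n : `[an n, bn n] `<=` `]a, b[.
  move=> x /=; rewrite !in_itv/= /an /bn => /andP[ax xb].
  by have := e0 n; lra.
have abn n : an n < bn n by rewrite /an /bn; have := e3 n; lra.
have mf : measurable_fun `]a, b[ f.
  apply: open_continuous_measurable_fun; first exact: interval_open.
  by move=> x; rewrite inE; exact: cf.
have Fn n : (\int[leb]_(x in `[an n, bn n]) (f x)%:E = (F (bn n))%:E - (F (an n))%:E)%E.
  have dFn x : x \in `[an n, bn n] -> is_derive x 1 F (f x).
    by move=> xab; apply: dF; exact: (sub n).
  apply: continuous_FTC2 => //.
  - apply: continuous_in_subspaceT => x; rewrite inE => /sub xab.
    by apply: cf; rewrite inE.
  - have cF x : x \in `[an n, bn n] -> {for x, continuous F}.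
      move=> /dFn [dx _]; apply: differentiable_continuous.
      exact/derivable1_diffP.
    split.
    + by move=> x /subset_itv_oo_cc /dFn [].
    + apply: cvg_at_right_filter; apply: cF.
      by rewrite in_itv/= lexx ltW.
    + apply: cvg_at_left_filter; apply: cF.
      by rewrite in_itv/= lexx ltW.
  - move=> x /subset_itv_oo_cc /dFn dx; rewrite derive1E.
    by rewrite derive_val.
have cvg1 : (\int[leb]_(x in `[an n, bn n]) (f x)%:E)%E @[n --> \oo] -->
    (F b - F a)%:E.
  under eq_fun do rewrite Fn -EFinB.
  apply: cvg_EFin; first exact: nearW.
  apply: cvgB.
    move/cvg_at_leftP : Fb; apply; split.
      by move=> n; rewrite /bn ltrBlDr ltrDl.
    by rewrite -[X in _ --> X]subr0; apply: cvgB => //; exact: cvg_cst.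
  move/cvg_at_rightP : Fa; apply; split.
    by move=> n; rewrite /an ltrDl.
  by rewrite -[X in _ --> X]addr0; apply: cvgD => //; exact: cvg_cst.
pose h n := (EFin \o f) \_ `[an n, bn n].
have hE x : x \in `]a, b[ -> \forall n \near \oo, h n x = (f x)%:E.
  rewrite in_itv/= => /andP[ax xb].
  have d0 : 0 < Num.min (x - a) (b - x) by rewrite lt_min !subr_gt0 ax.
  have /cvgr_lt/(_ _ d0) := ecv; apply: filterS => n.
  rewrite lt_min => /andP[n1 n2]; rewrite /h patchE mem_set//= in_itv/=.
  by rewrite /an /bn; apply/andP; split; lra.
have cvg2 : (\int[leb]_(x in `]a, b[) h n x)%E @[n --> \oo] -->
    (\int[leb]_(x in `]a, b[) (f x)%:E)%E.
  rewrite (_ : (\int[leb]_(x in `]a, b[) (f x)%:E)%E =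
      (\int[leb]_(x in `]a, b[) limn (h ^~ x))%E); last first.
    apply: eq_integral => x; rewrite inE/= => xab; apply/esym.
    by apply: lim_near_cst => //; exact: hE.
  apply: cvg_monotone_convergence => //.
  - move=> n; apply: (measurable_restrict _ _ _).1 => //=.
    by apply/measurable_EFinP; apply: measurable_funS mf => //; exact: subIsetl.
  - move=> n x xab; rewrite /h patchE; case: ifPn => // _.
    by rewrite lee_fin f0.
  - move=> x xab; apply/nondecreasing_seqP => n; rewrite /h !patchE.
    case: ifPn => [/set_mem/=|_]; last first.
      by case: ifPn => // _; rewrite lee_fin f0.
    rewrite in_itv/= => /andP[x1 x2]; rewrite mem_set//= in_itv/=.
    have : e n.+1 <= e n by rewrite ler_pM2l// lef_pV2 ?posrE// ler_nat.
    by move: x1 x2; rewrite /an /bn => x1 x2 ee; apply/andP; split; lra.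
apply: (cvg_unique _ cvg2) => //.
apply: cvg_trans cvg1; apply: near_eq_cvg; apply: nearW => n.
rewrite -integral_mkcondr; congr (integral _ _ _).
by apply/esym/setIidr; exact: sub.
Qed.

End ImproperFTC.

(** * Affine substitution in Lebesgue integrals *)

Section AffineSubstitution.
Context {R : realType}.
Local Notation leb := (@lebesgue_measure R).

(** By uniqueness of the Lebesgue measure, it suffices to compare the measures of intervals []u,
    v]]. *)
Lemma lebesgue_measure_affine (c k : R) (A : set R) : k != 0 ->
  measurable A -> leb A = (`|k|%:E * leb ((fun x => (c + k * x)%R) @^-1` A))%E.
Proof.
move=> k0 mA; pose phi : R -> measurableTypeR R := fun x => c + k * x.
have mphi : measurable_fun [set: R] phi.
  by apply: measurable_funD => //; apply: measurable_funM.
pose nu : {measure set (measurableTypeR R) -> \bar R} :=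
  mscale (NngNum (normr_ge0 k)) (pushforward leb phi).
apply: (@lebesgue_measure_unique R (nu mphi) _ _ mA) => _ [[u v]/= _ <-].
rewrite /nu/= /mscale/= /pushforward/= -[LHS]/(leb `]u, v]).
have [k_gt0|k_lt0|k00] := ltgtP 0 k; last by rewrite -k00 eqxx in k0.
  rewrite (_ : phi @^-1` _ = `](u - c) / k, (v - c) / k]%classic); last first.
    apply/seteqP; split=> x /=; rewrite !in_itv/= /phi ltr_pdivrMr// ler_pdivlMr//;
      rewrite ltrBlDl lerBrDl mulrC//.
  rewrite !lebesgue_measure_itv/= !lte_fin.
  rewrite ltr_pM2r ?invr_gt0// ltrD2r; case: ifPn => uv; last by rewrite mule0.
  by rewrite -!EFinD -EFinM gtr0_norm//; congr EFin; field; exact/lt0r_neq0.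
(* For negative [k] the map reverses the order, so the closed end moves to the left. *)
rewrite (_ : phi @^-1` _ = `[(v - c) / k, (u - c) / k[%classic); last first.
  apply/seteqP; split=> x /=; rewrite !in_itv/= /phi ler_ndivrMr// ltr_ndivlMr//;
    rewrite ltrBlDl lerBrDl mulrC andbC//.
rewrite !lebesgue_measure_itv/= !lte_fin.
rewrite ltr_nM2r ?invr_lt0// ltrD2r; case: ifPn => uv; last by rewrite mule0.
by rewrite -!EFinD -EFinM ltr0_norm//; congr EFin; field; exact/ltr0_neq0.
Qed.

Lemma ge0_integral_affine (c k : R) (f : R -> \bar R) : k != 0 ->
  measurable_fun [set: R] f -> (forall x, (0 <= f x)%E) ->
  (\int[leb]_x f x = `|k|%:E * \int[leb]_x f (c + k * x)%R)%E.
Proof.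
move=> k0 mf f0; pose phi : R -> measurableTypeR R := fun x => c + k * x.
have mphi : measurable_fun [set: R] phi.
  by apply: measurable_funD => //; apply: measurable_funM.
pose nu : {measure set (measurableTypeR R) -> \bar R} :=
  mscale (NngNum (normr_ge0 k)) (pushforward leb phi).
rewrite (@eq_measure_integral _ _ _ setT (nu mphi)); last first.
  by move=> A mA _; exact: lebesgue_measure_affine.
by rewrite ge0_integral_mscale//= ge0_integral_pushforward.
Qed.

End AffineSubstitution.

(** * Power kernels and their primitives *)

Section PowerKernel.
Context {R : realType}.
Local Notation leb := (@lebesgue_measure R).
Implicit Types (a b beta x t : R).

(** The kernel of fractional integration without its Gamma factor. The cut at 0 turns convolutions
    into integrals over the whole line, with the limits of integration encoded in the supports. *)
Definition power_kernel beta x : R := if 0 < x then x `^ (beta - 1) else 0.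

Definition power_primitive beta x : R := if 0 < x then x `^ beta else 0.

Lemma power_kernel_ge0 beta x : 0 <= power_kernel beta x.
Proof. by rewrite /power_kernel; case: ifP => // _; exact: powR_ge0. Qed.

Lemma power_primitive_ge0 beta x : 0 <= power_primitive beta x.
Proof. by rewrite /power_primitive; case: ifP => // _; exact: powR_ge0. Qed.

Lemma measurable_power_kernel beta : measurable_fun [set: R] (power_kernel beta).
Proof.
by apply: measurable_fun_ifT => //; exact: measurable_fun_ltr.
Qed.

Lemma measurable_power_primitive beta :
  measurable_fun [set: R] (power_primitive beta).
Proof.
by apply: measurable_fun_ifT => //; exact: measurable_fun_ltr.
Qed.

Lemma power_primitive_nondecreasing beta : 0 < beta ->
  {homo power_primitive beta : x y / x <= y}.
Proof.
move=> b0 x y xy; rewrite {1}/power_primitive; case: ifPn => [x0|_]; last first.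
  exact: power_primitive_ge0.
rewrite /power_primitive (lt_le_trans x0 xy).
have y0 := lt_le_trans x0 xy.
by apply: ge0_ler_powR => //; rewrite ?nnegrE ltW.
Qed.

Lemma power_primitive_lt beta eps : 0 < beta -> 0 < eps -> exists2 delta : R,
  0 < delta & forall x, x <= delta -> power_primitive beta x < eps.
Proof.
move=> b0 e0; pose d := (eps / 2) `^ beta^-1.
have d0 : 0 < d by rewrite powR_gt0// divr_gt0.
exists d => // x xd.
apply: le_lt_trans (power_primitive_nondecreasing b0 xd) _.
rewrite /power_primitive d0 /d -powRrM mulVf ?lt0r_neq0// powRr1.
  by rewrite ltr_pdivrMr// ltr_pMr// ltr1n.
by rewrite divr_ge0 ?ltW.
Qed.

Lemma is_derive_power_primitive beta x : 0 < x ->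
  is_derive x 1 (power_primitive beta) (beta * power_kernel beta x).
Proof.
move=> x0; rewrite /power_kernel x0.
apply: (@near_eq_is_derive _ _ _ (fun y => y `^ beta)) => //.
- near=> y; rewrite /power_primitive ifT//; near: y; exact: lt_nbhsr.
- exact: is_derive1_powR.
Unshelve. all: by end_near. Qed.

Lemma continuous_power_primitive beta : 0 < beta -> continuous (power_primitive beta).
Proof.
move=> b0 x; have [x0|x0] := ltP 0 x.
  have [dx _] := is_derive_power_primitive beta x0.
  by apply: differentiable_continuous; exact/derivable1_diffP.
have px0 : power_primitive beta x = 0 by rewrite /power_primitive ltNge x0.
apply/cvgrPdist_lt => eps eps0; have [d d0 dP] := power_primitive_lt b0 eps0.
near=> y; rewrite px0 sub0r normrN ger0_norm ?power_primitive_ge0//.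
apply/dP/ltW; near: y; exact: lt_nbhsl (le_lt_trans x0 d0).
Unshelve. all: by end_near. Qed.

Lemma continuous_power_kernel beta x : 0 < x -> {for x, continuous (power_kernel beta)}.
Proof.
(* [power_kernel beta] is [power_primitive (beta - 1)] by definition, and a differentiable function
   is continuous. *)
move=> x0; have [dx _] := @is_derive_power_primitive (beta - 1) _ x0.
by apply: differentiable_continuous; exact/derivable1_diffP.
Qed.

(** For [0 <= a] the singularity of the kernel lies at an end point at worst, and the improper
    fundamental theorem applies. For [a < 0] the part of the interval left of 0 contributes
    nothing. *)
Lemma integral_power_kernel beta a b : 0 < beta -> a <= b ->
  (\int[leb]_(x in `]a, b[) (power_kernel beta x)%:E =
   ((power_primitive beta b - power_primitive beta a) / beta)%:E)%E.
Proof.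
move=> b0; rewrite le_eqVlt => /orP[/eqP <-|ab].
  by rewrite set_itvoo0 integral_set0 subrr mul0r.
have main u : 0 <= u -> u < b ->
    (\int[leb]_(x in `]u, b[) (power_kernel beta x)%:E =
     ((power_primitive beta b - power_primitive beta u) / beta)%:E)%E.
  move=> u0 ub; rewrite mulrBl.
  apply: (@ge0_FTC2_oo _ _ (fun x => power_primitive beta x / beta)) => //.
  - by move=> x _; exact: power_kernel_ge0.
  - move=> x; rewrite in_itv/= => /andP[ux _].
    by apply: continuous_power_kernel; exact: le_lt_trans ux.
  - move=> x; rewrite in_itv/= => /andP[ux _].
    have dx := @is_derive_power_primitive beta _ (le_lt_trans u0 ux).
    rewrite (_ : power_kernel beta x = beta^-1 *: (beta * power_kernel beta x)).
      rewrite (_ : (fun _ => _) = beta^-1 \*: power_primitive beta).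
        exact: is_deriveZ.
      by apply/funext => y /=; rewrite mulrC.
    by rewrite /GRing.scale/= mulrA mulVf ?mul1r// lt0r_neq0.
  - apply: cvgMl; apply: cvg_at_right_filter; exact: continuous_power_primitive.
  - apply: cvgMl; apply: cvg_at_left_filter; exact: continuous_power_primitive.
have [a0|a0] := leP 0 a; first exact: main.
have -> : power_primitive beta a = power_primitive beta 0.
  by rewrite /power_primitive ltxx ltNge ltW.
have [b0'|b0'] := ltP 0 b; last first.
  rewrite (_ : power_primitive beta b = power_primitive beta 0); last first.
    by rewrite /power_primitive ltxx ltNge b0'.
  rewrite subrr mul0r; apply: integral0_eq => x /=; rewrite in_itv/= => /andP[_ xb].
  by rewrite /power_kernel ltNge (le_trans (ltW xb) b0').
rewrite -main// integral_mkcond [RHS]integral_mkcond; apply: eq_integral => x _.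
rewrite !patchE; have [x0|x0] := ltP 0 x.
  congr (if _ then _ else _); apply/idP/idP => /set_mem/=; rewrite !in_itv/= => /andP[ax xb];
  by apply/mem_set; rewrite /= in_itv/= ?x0 ?(lt_trans a0 x0).
by rewrite /power_kernel ltNge x0 !if_same.
Qed.

Lemma integral_power_kernel_reflect beta a b t : 0 < beta -> a <= b ->
  (\int[leb]_(x in `]a, b[) (power_kernel beta (t - x))%:E =
   ((power_primitive beta (t - a) - power_primitive beta (t - b)) / beta)%:E)%E.
Proof.
move=> b0 ab; have tab : t - b <= t - a by rewrite lerD2l lerN2.
rewrite -(integral_power_kernel b0 tab).
rewrite integral_mkcond [RHS]integral_mkcond.
rewrite [RHS](@ge0_integral_affine _ t (-1)) ?oppr_eq0 ?oner_eq0//.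
- rewrite normrN1 mul1e; apply: eq_integral => x _; rewrite !patchE mulN1r.
  congr (if _ then _ else _); apply/idP/idP => /set_mem/=; rewrite !in_itv/= => /andP[xa xb];
  by apply/mem_set; rewrite /= in_itv/=; apply/andP; split; lra.
- apply: (measurable_restrictT _ _).1 => //.
  by apply/measurable_EFinP; apply: measurable_funTS; exact: measurable_power_kernel.
- by move=> x; rewrite patchE; case: ifPn => // _; rewrite lee_fin power_kernel_ge0.
Qed.

End PowerKernel.

(** * Beta and Gamma integrals *)

Section BetaGamma.
Context {R : realType}.
Local Notation leb := (@lebesgue_measure R).
Implicit Types (a b beta q r t : R).

Lemma power_kernel_scale beta k x : 0 < k ->
  power_kernel beta (k * x) = k `^ (beta - 1) * power_kernel beta x.
Proof.
move=> k0; rewrite /power_kernel pmulr_rgt0//; case: ifPn => [x0|_].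
  by rewrite powRM// ltW.
by rewrite mulr0.
Qed.

(** Euler's Beta integral B(a, b) for [q = 0] and [t = 1]; for [q < t] in general, B(a, b) times the
    power a + b - 1 of t - q. *)
Definition kernel_convolution a b q t : \bar R :=
  (\int[leb]_r (power_kernel a (t - r) * power_kernel b (r - q))%:E)%E.

Lemma measurable_kernel_product a b q t : measurable_fun [set: R]
  (fun r => (power_kernel a (t - r) * power_kernel b (r - q))%:E).
Proof.
apply/measurable_EFinP; apply: measurable_funM.
  by apply: measurableT_comp; [exact: measurable_power_kernel|exact: measurable_funB].
by apply: measurableT_comp; [exact: measurable_power_kernel|exact: measurable_funB].
Qed.

Lemma kernel_convolution_ge0 a b q t : (0 <= kernel_convolution a b q t)%E.
Proof.
by apply: integral_ge0 => r _; rewrite lee_fin mulr_ge0// power_kernel_ge0.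
Qed.

Lemma kernel_convolution0 a b q t : t <= q -> kernel_convolution a b q t = 0%E.
Proof.
move=> tq; apply: integral0_eq => r _; rewrite /power_kernel !subr_gt0.
by have [rt|] := ltP r t; rewrite ?mul0r// ltNge (le_trans (ltW rt) tq) mulr0.
Qed.

(** The substitution r = q + (t - q) s produces the factor (t - q)^(a + b - 1), which is 1 for
    complementary orders. *)
Lemma kernel_convolution_cst a b q t : a + b = 1 -> q < t ->
  kernel_convolution a b q t = kernel_convolution a b 0 1.
Proof.
move=> ab qt; have k0 : 0 < t - q by rewrite subr_gt0.
rewrite /kernel_convolution (@ge0_integral_affine _ q (t - q)) ?lt0r_neq0//; last 2 first.
- exact: measurable_kernel_product.
- by move=> r; rewrite lee_fin mulr_ge0// power_kernel_ge0.
rewrite gtr0_norm//.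
under eq_integral => s _.
  rewrite (_ : t - (q + (t - q) * s) = (t - q) * (1 - s)); last by ring.
  rewrite (_ : q + (t - q) * s - q = (t - q) * s); last by ring.
  rewrite !power_kernel_scale// mulrACA -powRD; last first.
    by rewrite (lt0r_neq0 k0) implybT.
  rewrite (_ : a - 1 + (b - 1) = -1); last by rewrite addrACA ab; ring.
  rewrite powR_inv1 ?(ltW k0)// EFinM.
  rewrite -[X in power_kernel b X]subr0; over.
rewrite ge0_integralZl_EFin//.
- by rewrite muleA -EFinM divff ?lt0r_neq0// mul1e.
- by move=> r _; rewrite lee_fin mulr_ge0// power_kernel_ge0.
- exact: measurable_kernel_product.
- by rewrite invr_ge0 ltW.
Qed.

Definition gamma_integral beta : \bar R :=
  (\int[leb]_x (power_kernel beta x * expR (- x))%:E)%E.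

Lemma measurable_gamma_integrand beta : measurable_fun [set: R]
  (fun x => (power_kernel beta x * expR (- x))%:E).
Proof.
apply/measurable_EFinP; apply: measurable_funM; first exact: measurable_power_kernel.
by apply: measurableT_comp => //; exact: measurable_expR.
Qed.

Lemma gamma_integrand_ge0 beta x : (0 <= (power_kernel beta x * expR (- x))%:E)%E.
Proof. by rewrite lee_fin mulr_ge0 ?power_kernel_ge0// expR_ge0. Qed.

Lemma GammaE beta : Gamma beta = fine (gamma_integral beta).
Proof.
rewrite /Gamma /Rintegral /gamma_integral; congr fine.
rewrite integral_mkcond; apply: eq_integral => x _.
rewrite patchE /power_kernel; have [x0|x0] := ltP 0 x.
  by rewrite mem_set//= in_itv/= x0.
by rewrite memNset ?mul0r//= in_itv/= andbT; apply/negP; rewrite -leNgt.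
Qed.

Lemma integral_expRN : (\int[leb]_(x in [set` `]0, +oo[%R]) (expR (- x))%:E = 1)%E.
Proof.
rewrite integral_itv_obnd_cbnd; last first.
  by apply/measurable_EFinP/measurable_funTS; apply: measurableT_comp.
rewrite -(integral_exponential_pdf (@ltr01 R)) integral_mkcond.
apply: eq_integral => x _; rewrite patchE; case: ifPn => [/set_mem/=|].
  by rewrite in_itv/= andbT => x0; rewrite exponential_pdfE// mul1r mulN1r.
by rewrite notin_setE/= => x0; rewrite /exponential_pdf patchE memNset.
Qed.

(** The integrand is at most x^(beta - 1) before 1 and at most e^(-x) from 1 on, the latter because
    beta < 1; both bounds are integrable on their ranges. *)
Lemma gamma_integral_fin_num beta : 0 < beta < 1 ->
  gamma_integral beta \is a fin_num.
Proof.
move=> /andP[b0 b1]; rewrite ge0_fin_numE; last first.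
  by apply: integral_ge0 => x _; exact: gamma_integrand_ge0.
pose h1 : R -> \bar R := (fun x => (power_kernel beta x)%:E) \_ `]0, 1[.
pose h2 : R -> \bar R := (fun x => (expR (- x))%:E) \_ `]0, +oo[.
have mh1 : measurable_fun [set: R] h1.
  apply: (measurable_restrictT _ _).1 => //; apply/measurable_EFinP/measurable_funTS.
  exact: measurable_power_kernel.
have mh2 : measurable_fun [set: R] h2.
  apply: (measurable_restrictT _ _).1 => //; apply/measurable_EFinP/measurable_funTS.
  by apply: measurableT_comp => //.
have h10 x : (0 <= h1 x)%E.
  by rewrite /h1 patchE; case: ifPn => // _; rewrite lee_fin power_kernel_ge0.
have h20 x : (0 <= h2 x)%E.
  by rewrite /h2 patchE; case: ifPn => // _; rewrite lee_fin expR_ge0.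
apply: (@le_lt_trans _ _ (\int[leb]_x (h1 x + h2 x))%E).
  apply: ge0_le_integral => //.
  - by move=> x _; exact: gamma_integrand_ge0.
  - exact: measurable_gamma_integrand.
  - exact: emeasurable_funD.
  move=> x _; have [x0|x0] := ltP 0 x; last first.
    by rewrite /power_kernel ltNge x0 mul0r adde_ge0.
  have [x1|x1] := ltP x 1.
    apply: (@le_trans _ _ (h1 x)); last by rewrite leeDl.
    rewrite /h1 patchE mem_set/= ?in_itv/= ?x0// lee_fin.
    by rewrite ler_piMr ?power_kernel_ge0// -expR0 ler_expR oppr_le0 ltW.
  apply: (@le_trans _ _ (h2 x)); last by rewrite leeDr.
  rewrite /h2 patchE mem_set/= ?in_itv/= ?x0// lee_fin.
  rewrite ler_piMl ?expR_ge0// /power_kernel x0 -[leRHS](powRr0 x) ler_powR//.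
  by rewrite subr_le0 ltW.
rewrite ge0_integralD// -!integral_mkcond integral_expRN integral_power_kernel//.
by rewrite -EFinD ltry.
Qed.

(** On []0, 1[] the integrand is at least e^(-1), since the exponent beta - 1 is negative. *)
Lemma Gamma_gt0 beta : 0 < beta < 1 -> 0 < Gamma beta.
Proof.
move=> b01; have /andP[b0 b1] := b01; rewrite GammaE -lte_fin fineK ?gamma_integral_fin_num//.
apply: (@lt_le_trans _ _ (\int[leb]_(x in `]0%R, 1%R[) (expR (- 1))%:E)%E).
  by rewrite integral_cst//= lebesgue_measure_itv/= lte_fin ltr01 oppr0 adde0 mule1 lte_fin expR_gt0.
rewrite integral_mkcond; apply: ge0_le_integral => //.
- by move=> x _; rewrite patchE; case: ifPn => // _; rewrite lee_fin expR_ge0.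
- by apply: (measurable_restrictT _ _).1.
- exact: measurable_gamma_integrand.
move=> x _; rewrite patchE; case: ifPn => [/set_mem/=|_]; last exact: gamma_integrand_ge0.
rewrite in_itv/= => /andP[x0 x1]; rewrite lee_fin.
apply: (@le_trans _ _ (expR (- x))); first by rewrite ler_expR lerN2 ltW.
rewrite ler_peMl ?expR_ge0// /power_kernel x0.
rewrite -opprB powRN invf_ge1 ?powR_gt0//.
have b10 : 0 <= 1 - beta by rewrite subr_ge0 ltW.
have := @ge0_ler_powR _ _ b10 x 1; rewrite powR1 !nnegrE ler01 (ltW x0) (ltW x1).
exact.
Qed.

(* Tonelli for [x^(b - 1) (y - x)^(a - 1) e^(- y)]: since [a + b = 1], the integral
   in [x] alone is [kernel_convolution a b 0 1] times [e^(- y)]. *)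
Lemma kernel_convolution_Gamma a b : 0 < a -> 0 < b -> a + b = 1 ->
  kernel_convolution a b 0 1 = (Gamma a * Gamma b)%:E.
Proof.
move=> a0 b0 ab.
have a01 : 0 < a < 1 by rewrite a0 -ab ltrDl.
have b01 : 0 < b < 1 by rewrite b0 -ab ltrDr.
rewrite EFinM !GammaE !fineK ?gamma_integral_fin_num//; apply/esym.
pose f (p : R * R) := (power_kernel b p.1 * (power_kernel a (p.2 - p.1) * expR (- p.2)))%:E.
have mf : measurable_fun [set: R * R] f.
  apply/measurable_EFinP; apply: measurable_funM.
    by apply: measurableT_comp; [exact: measurable_power_kernel|exact: measurable_fst].
  apply: measurable_funM; last first.
    by apply: measurableT_comp => //; apply: measurableT_comp.
  by apply: measurableT_comp; [exact: measurable_power_kernel|exact: measurable_funB].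
have f0 p : (0 <= f p)%E.
  by rewrite lee_fin !mulr_ge0 ?power_kernel_ge0// expR_ge0.
have := @fubini_tonelli _ _ _ _ _ lebesgue_measure lebesgue_measure f mf f0.
have -> : (\int[leb]_x \int[leb]_y f (x, y) = gamma_integral a * gamma_integral b)%E.
  rewrite muleC /gamma_integral -ge0_integralZr//.
  - apply: eq_integral => r _; rewrite [X in (_ * X)%E](@ge0_integral_affine _ (- r) 1) ?oner_eq0//.
    + rewrite normr1 mul1e -(ge0_integralZl_EFin leb measurableT).
      * apply: eq_integral => t _; rewrite /f/= -EFinM; congr EFin.
        rewrite mul1r -!mulrA; congr (_ * _); rewrite mulrCA -expRD.
        by rewrite [- r + t]addrC; congr (_ * expR _); ring.
      * by move=> t _; exact: gamma_integrand_ge0.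
      * apply: (measurableT_comp (measurable_gamma_integrand a)).
        by apply: measurable_funD => //; apply: measurable_funM.
      * by rewrite mulr_ge0 ?power_kernel_ge0// expR_ge0.
    + exact: measurable_gamma_integrand.
    + exact: gamma_integrand_ge0.
  - exact: measurable_gamma_integrand.
  - by move=> x _; exact: gamma_integrand_ge0.
  - by apply: integral_ge0 => x _; exact: gamma_integrand_ge0.
move=> ->.
rewrite -[RHS]mule1 -integral_expRN -ge0_integralZl//.
- rewrite [RHS]integral_mkcond; apply: eq_integral => t _.
  rewrite patchE; case: ifPn => [/set_mem/=|].
    rewrite in_itv/= andbT => t0; rewrite -(kernel_convolution_cst ab t0).
    rewrite /kernel_convolution -ge0_integralZr//.
    + by apply: eq_integral => r _; rewrite /f/= -EFinM subr0; congr EFin; ring.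
    + exact: measurable_kernel_product.
    + by move=> r _; rewrite lee_fin mulr_ge0// power_kernel_ge0.
  rewrite notin_setE/= in_itv/= andbT => /negP; rewrite -leNgt => t0.
  have := @kernel_convolution0 a b _ _ t0; rewrite /kernel_convolution => E.
  apply: integral0_eq => r _; rewrite /f/= /power_kernel subr_gt0.
  by have [rt|] := ltP r t; rewrite ?mul0r ?mulr0// ltNge (le_trans (ltW rt) t0) mul0r.
- by apply/measurable_EFinP/measurable_funTS; apply: measurableT_comp.
- exact: kernel_convolution_ge0.
Qed.

(** The primitive is b times the integral of (r - q)^(b - 1) over q in []c, r[]. After exchanging
    the two integrals, the one in r is the Beta constant for every q in []c, t[], and the one in q
    measures that interval. *)
Lemma kernel_primitive_convolution a b c t : 0 < a -> 0 < b -> a + b = 1 -> c <= t ->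
  (\int[leb]_r (power_kernel a (t - r) * power_primitive b (r - c))%:E =
   (b * (Gamma a * Gamma b) * (t - c))%:E)%E.
Proof.
move=> a0 b0 ab ct.
pose f (p : R * R) := (power_kernel a (t - p.1) * power_kernel b (p.1 - p.2) *
  (if c < p.2 then 1 else 0))%:E.
have mf : measurable_fun [set: R * R] f.
  apply/measurable_EFinP; apply: measurable_funM.
    apply: measurable_funM.
      by apply: measurableT_comp; [exact: measurable_power_kernel|exact: measurable_funB].
    by apply: measurableT_comp; [exact: measurable_power_kernel|exact: measurable_funB].
  by apply: measurable_fun_ifT => //; exact: measurable_fun_ltr.
have f0 p : (0 <= f p)%E.
  by rewrite lee_fin !mulr_ge0 ?power_kernel_ge0//; case: ifP.
have E1 r : (power_kernel a (t - r) * power_primitive b (r - c))%:E =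
    (b%:E * \int[leb]_q f (r, q))%E.
  have -> : (\int[leb]_q f (r, q) = (power_kernel a (t - r))%:E *
      (power_primitive b (r - c) / b)%:E)%E.
    have [rc|cr] := leP r c.
      rewrite /power_primitive subr_gt0 ltNge rc mul0r mule0.
      apply: integral0_eq => q _; rewrite /f/=; case: ifPn => [cq|]; last by rewrite mulr0.
      by rewrite /power_kernel !subr_gt0 (ltNge q) (le_trans rc (ltW cq)) mulr0 mul0r.
    have := integral_power_kernel_reflect r b0 (ltW cr).
    rewrite subrr {2}/power_primitive ltxx subr0 => <-.
    rewrite -ge0_integralZl_EFin ?power_kernel_ge0//; last 2 first.
    - by move=> x _; rewrite lee_fin power_kernel_ge0.
    - apply/measurable_EFinP; apply: measurableT_comp; last exact: measurable_funB.
      exact: measurable_power_kernel.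
    rewrite [RHS]integral_mkcond; apply: eq_integral => q _; rewrite /f/= patchE.
    case: ifPn => [cq|cq]; case: ifPn => [/set_mem/=|]; rewrite ?mulr1 ?mulr0//.
    + rewrite notin_setE/= in_itv/= cq/= => /negP; rewrite -leNgt => rq.
      by rewrite /power_kernel !subr_gt0 (ltNge q) rq mulr0.
    + by rewrite in_itv/= (negbTE cq).
  by rewrite -!EFinM; congr EFin; field; exact: lt0r_neq0.
under eq_integral do rewrite E1.
rewrite ge0_integralZl_EFin//; last 3 first.
- by move=> x _; apply: integral_ge0 => q _; exact: f0.
- exact: measurable_fun_fubini_tonelli_F.
- exact: ltW.
rewrite (@fubini_tonelli _ _ _ _ _ lebesgue_measure lebesgue_measure f mf f0).
rewrite -mulrA EFinM; congr (_ * _)%E.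
transitivity (\int[leb]_q (((fun=> (Gamma a * Gamma b)%:E) \_ `]c, t[) q))%E.
  apply: eq_integral => q _; rewrite patchE -(kernel_convolution_Gamma a0 b0 ab).
  case: ifPn => [/set_mem/=|].
    rewrite in_itv/= => /andP[cq qt]; rewrite -(kernel_convolution_cst ab qt).
    by apply: eq_integral => r _; rewrite /f/= cq mulr1.
  rewrite notin_setE/= in_itv/= => /negP; rewrite negb_and -!leNgt => /orP[qc|tq].
    by apply: integral0_eq => r _; rewrite /f/= ltNge qc mulr0.
  apply: integral0_eq => r _; rewrite /f/= /power_kernel !subr_gt0.
  have [rt|] := ltP r t; rewrite ?mul0r// (ltNge q) (le_trans (ltW rt) tq).
  by rewrite mulr0 mul0r.
rewrite -integral_mkcond integral_cst//= lebesgue_measure_itv/= lte_fin.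
have [ct'|tc] := ltP c t; first by rewrite -EFinB -EFinM.
by rewrite mule0 (le_anti (introT andP (conj ct tc))) subrr mulr0.
Qed.

End BetaGamma.

(** * Volterra convolution operators *)

Section BochnerExtensionality.
Context d (T : measurableType d) (R : realType).
Variables (mu : {measure set T -> \bar R}) (D : set T).

Lemma eq_bochner_approx (X : completeNormedModType R) (f g : T -> X) s :
  {in D, f =1 g} -> bochner_approx mu D f s -> bochner_approx mu D g s.
Proof.
move=> fg [ss sf s0]; split=> //.
  by apply: filterS sf => x sf Dx; rewrite -fg ?inE//; exact: sf.
apply: cvg_trans s0; apply: near_eq_cvg; apply: nearW => n.
by apply: eq_integral => x Dx; rewrite fg.
Qed.

Lemma eq_bochner_integrable (X : completeNormedModType R) (f g : T -> X) :
  {in D, f =1 g} -> bochner_integrable mu D f -> bochner_integrable mu D g.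
Proof. by move=> fg [s fs]; exists s; exact: eq_bochner_approx fs. Qed.

Lemma eq_bochner_integral (X : completeNormedModType R) (f g : T -> X) :
  {in D, f =1 g} -> bochner_integral mu D f = bochner_integral mu D g.
Proof.
move=> fg; rewrite /bochner_integral; congr xget; apply/funext => v.
apply/propext; split=> -[s fs sv]; exists s => //.
  exact: eq_bochner_approx fs.
by apply: eq_bochner_approx fs => x Dx; rewrite fg.
Qed.

Lemma bochner_integral0 (X : completeNormedModType R) (f : T -> X) :
  measurable D -> (mu D < +oo)%E -> (forall x, D x -> f x = 0) ->
  bochner_integral mu D f = 0.
Proof.
move=> mD finD f0; rewrite (@eq_bochner_integral _ _ (fun x => 0 *: (0 : X))).
  by rewrite (bochner_integral_cst_vec mD finD _ _).2 ?scaler0//; exact: integrable0.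
by move=> x /set_mem Dx; rewrite scaler0; exact: f0.
Qed.

End BochnerExtensionality.

Lemma strongly_measurable_sub d (T : measurableType d) (R : realType)
    (mu : {measure set T -> \bar R}) (A D : set T) (X : normedModType R) (f : T -> X) :
  measurable A -> A `<=` D -> strongly_measurable mu D f -> strongly_measurable mu A f.
Proof.
move=> mA AD [s fs sf]; exists s; last by apply: filterS sf => x sf /AD.
move=> n; split; first exact: (fs n).1.
move=> y; rewrite -(setIidl AD) -setIA; apply: measurableI => //.
exact: (fs n).2.
Qed.

(** The identity of [D] is a pointwise limit of simple functions [s n]; then [h \o s n] is finitely
    valued and converges to [h] by continuity at the limit point. *)
Lemma strongly_measurable_continuous (R : realType) (D : set R)
    (X : normedModType R) (h : R -> X) :
  measurable D -> (forall x, D x -> {for x, continuous h}) ->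
  strongly_measurable (@lebesgue_measure R) D h.
Proof.
move=> mD ch.
have [s fs sid] :=
  strongly_measurable_measurable (@lebesgue_measure R) mD (@measurable_id _ R D).
exists (fun n => h \o s n); first by move=> n; exact: finitely_valued_comp.
apply: filterS sid => x sid Dx.
by apply: (cvg_comp _ _ (sid Dx)); exact: ch.
Qed.

(** * Convolution of bounded functions with a nonincreasing kernel *)

Section VolterraOperator.
Context {R : realType}.
Local Notation leb := (@lebesgue_measure R).

(** Common setting for fractional integrals of order in []0, 1[] and for ordinary primitives, whose
    kernel is 1 on the positive reals. [K] is the primitive of [k] that vanishes on the nonpositive
    reals; it serves both as operator norm and as modulus of continuity. *)
Record volterra_kernel (k K : R -> R) : Prop := VolterraKernel {
  volterra_kernel_ge0 : forall x, 0 <= k x ;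
  volterra_kernel0 : forall x, x <= 0 -> k x = 0 ;
  volterra_kernel_measurable : measurable_fun [set: R] k ;
  volterra_kernel_nonincreasing : forall x y, 0 < x -> x <= y -> k y <= k x ;
  volterra_kernel_integral : forall a b t, a <= b ->
    (\int[leb]_(r in `]a, b[) (k (t - r))%:E = (K (t - a) - K (t - b))%:E)%E ;
  volterra_primitive0 : forall x, x <= 0 -> K x = 0 ;
  volterra_primitive_nondecreasing : {homo K : x y / x <= y} ;
  volterra_primitive_continuous : continuous K }.

(** [J beta] is convertible to [volterra (g beta)], which lets the results below apply to it
    directly. *)
Definition volterra (X : completeNormedModType R) (k : R -> R) (h : R -> X) t : X :=
  bochner_integral leb `]0, t[ (fun r => k (t - r) *: h r).

Variables (k K : R -> R).
Hypothesis kK : volterra_kernel k K.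
Variable X : completeNormedModType R.
Implicit Types (h : R -> X) (t s c M : R).

Definition sm_bounded t M h := strongly_measurable leb `]0, t[ h /\
  forall r, 0 < r < t -> `|h r| <= M.

Lemma sm_bounded_le s t M h : s <= t -> sm_bounded t M h -> sm_bounded s M h.
Proof.
move=> st [sh hM]; split.
  apply: strongly_measurable_sub sh => //.
  by move=> x /=; rewrite !in_itv/= => /andP[-> xs]; exact: lt_le_trans st.
by move=> r /andP[r0 rs]; apply: hM; rewrite r0 (lt_le_trans rs).
Qed.

Lemma sm_boundedB t M M' h h' : sm_bounded t M h -> sm_bounded t M' h' ->
  sm_bounded t (M + M') (fun r => h r - h' r).
Proof.
move=> [sh hM] [sh' hM']; split; first exact: strongly_measurableB.
move=> r rt; apply: le_trans (ler_normB _ _) _.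
by apply: lerD; [exact: hM|exact: hM'].
Qed.

Lemma lebesgue_measure_oo_lty (a b : R) :
  ((leb : {measure set (measurableTypeR R) -> \bar R}) `]a, b[%classic < +oo)%E.
Proof.
rewrite -[X in (X < _)%E]/(leb `]a, b[%classic) lebesgue_measure_itv/=.
by case: ifP => // _; rewrite -EFinB ltry.
Qed.

Lemma measurable_volterra_kernel t (D : set R) :
  measurable_fun D (fun r => k (t - r)).
Proof.
apply: measurable_funTS; apply: measurableT_comp; last exact: measurable_funB.
exact: volterra_kernel_measurable kK.
Qed.

Lemma integrable_volterra_kernel a b t :
  leb.-integrable `]a, b[ (EFin \o (fun r => k (t - r))).
Proof.
have [ab|ba] := leP a b; last first.
  rewrite set_itv_ge; last by rewrite bnd_simp -leNgt ltW.
  exact: integrable_set0.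
apply/integrableP; split; first by apply/measurable_EFinP; exact: measurable_volterra_kernel.
under eq_integral => r _ do
  rewrite /= ger0_norm ?(volterra_kernel_ge0 kK)//.
by rewrite (volterra_kernel_integral kK)// ltry.
Qed.

Lemma Rintegral_volterra_kernel a b t : a <= b ->
  \int[leb]_(r in `]a, b[) k (t - r) = K (t - a) - K (t - b).
Proof. by move=> ab; rewrite /Rintegral (volterra_kernel_integral kK). Qed.

Lemma volterra_primitive_ge0 x : 0 <= K x.
Proof.
have [x0|x0] := leP x 0; first by rewrite (volterra_primitive0 kK).
rewrite -(volterra_primitive0 kK (lexx 0)).
by apply: (volterra_primitive_nondecreasing kK); exact: ltW.
Qed.

Lemma strongly_measurable_volterra s t h : strongly_measurable leb `]0, s[ h ->
  strongly_measurable leb `]0, s[ (fun r => k (t - r) *: h r).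
Proof.
move=> sh; apply: strongly_measurableZ => //.
by apply: strongly_measurable_measurable => //; exact: measurable_volterra_kernel.
Qed.

Lemma volterra_integrable s t M h : sm_bounded s M h ->
  bochner_integrable leb `]0, s[ (fun r => k (t - r) *: h r).
Proof.
move=> [sh hM]; apply: (bochner_integrable_dominated (mu := leb) (measurable_itv _)
  (lebesgue_measure_oo_lty 0 s) (k := fun r => M * k (t - r))).
- exact: strongly_measurable_volterra.
- apply: eq_integrable (integrableZl _ M (integrable_volterra_kernel 0 s t)) => //.
- apply: aeW => r /=; rewrite in_itv/= => rs.
  rewrite normrZ ger0_norm ?(volterra_kernel_ge0 kK)// mulrC.
  by rewrite ler_wpM2r ?(volterra_kernel_ge0 kK)//; exact: hM.
Qed.

Lemma eq_volterra t h h' : (forall r, 0 < r < t -> h r = h' r) ->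
  volterra k h t = volterra k h' t.
Proof.
move=> hh'; apply: eq_bochner_integral => r /set_mem/=; rewrite in_itv/= => rt.
by rewrite hh'.
Qed.

Lemma volterra_nonpos t h : t <= 0 -> volterra k h t = 0.
Proof.
move=> t0; apply: bochner_integral0 => //; first exact: lebesgue_measure_oo_lty.
by move=> x /=; rewrite in_itv/= => /andP[x0 /(lt_trans x0)]; rewrite ltNge t0.
Qed.

(* The kernel vanishes on negative reals, so that the domain of integration
   can be enlarged. *)
Lemma volterra_widen s t M h : s <= t -> sm_bounded t M h ->
  volterra k h s = bochner_integral leb `]0, t[ (fun r => k (s - r) *: h r).
Proof.
move=> st hM; have sub : `]0, s[ `<=` `]0, t[.
  by move=> x /=; rewrite !in_itv/= => /andP[-> xs]; exact: lt_le_trans st.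
rewrite /volterra -(bochner_integral_restrict (mu := leb) _ (lebesgue_measure_oo_lty 0 t) _ sub _).2 //.
  apply: eq_bochner_integral => r /set_mem/= ; rewrite in_itv/= => /andP[r0 rt].
  case: ifPn => //; rewrite notin_setE/= in_itv/= r0/= => /negP; rewrite -leNgt => sr.
  by rewrite (volterra_kernel0 kK) ?scale0r// subr_le0.
exact: volterra_integrable (sm_bounded_le st hM).
Qed.

Lemma volterraB t M M' h h' : sm_bounded t M h -> sm_bounded t M' h' ->
  volterra k (fun r => h r - h' r) t = volterra k h t - volterra k h' t.
Proof.
move=> hM hM'; rewrite /volterra.
rewrite -(bochner_integralB (mu := leb) _ (lebesgue_measure_oo_lty 0 t) (volterra_integrable t hM)
  (volterra_integrable t hM')).2//.
by apply: eq_bochner_integral => r _; rewrite scalerBr.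
Qed.

Lemma volterra_cst_vec t (p : R -> R) (v : X) :
  leb.-integrable `]0, t[ (EFin \o (fun r => k (t - r) * p r)) ->
  volterra k (fun r => p r *: v) t = (\int[leb]_(r in `]0, t[) (k (t - r) * p r)) *: v.
Proof.
move=> ip; rewrite /volterra -(bochner_integral_cst_vec (mu := leb) _ (lebesgue_measure_oo_lty 0 t) v ip).2//.
by apply: eq_bochner_integral => r _; rewrite scalerA.
Qed.

(** Only the mass [K (t - c)] of the kernel on []c, t[] meets a function that vanishes up to [c].
    This is the source of smallness in the fixed point argument. *)
Lemma volterra_norm_from c t M h : 0 <= M -> 0 <= c -> c <= t ->
  sm_bounded t M h -> (forall r, 0 < r <= c -> h r = 0) ->
  `|volterra k h t| <= M * K (t - c).
Proof.
move=> M0 c0 ct hM h0; rewrite -lee_fin.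
have [sh hM'] := hM.
have sub : `]c, t[ `<=` `]0, t[.
  by move=> x /=; rewrite !in_itv/= => /andP[cx ->]; rewrite (le_lt_trans c0).
have i1 : bochner_integrable leb `]c, t[ (fun r => k (t - r) *: h r).
  apply: (bochner_integrable_dominated (mu := leb) (measurable_itv _)
    (lebesgue_measure_oo_lty c t) (k := fun r => M * k (t - r))).
  - by apply: strongly_measurable_sub (strongly_measurable_volterra _ sh).
  - exact: eq_integrable (integrableZl _ M (integrable_volterra_kernel c t t)).
  - apply: aeW => r /sub/=; rewrite in_itv/= => rs.
    rewrite normrZ ger0_norm ?(volterra_kernel_ge0 kK)// mulrC.
    by rewrite ler_wpM2r ?(volterra_kernel_ge0 kK)//; exact: hM'.
have -> : volterra k h t = bochner_integral leb `]c, t[ (fun r => k (t - r) *: h r).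
  rewrite /volterra -(bochner_integral_restrict (mu := leb) _ (lebesgue_measure_oo_lty 0 t) _ sub i1).2 //.
  apply: eq_bochner_integral => r /set_mem/= ; rewrite in_itv/= => /andP[r0 rt].
  case: ifPn => //; rewrite notin_setE/= in_itv/= rt andbT => /negP; rewrite -leNgt => sr.
  by rewrite h0 ?scaler0// r0.
apply: le_trans (bochner_integral_norm (mu := leb) _ (lebesgue_measure_oo_lty c t) i1
  (k := fun r => M * k (t - r)) _ _ _) _ => //.
- exact: eq_integrable (integrableZl _ M (integrable_volterra_kernel c t t)).
- by move=> r _; rewrite mulr_ge0// (volterra_kernel_ge0 kK).
- apply: aeW => r /sub/=; rewrite in_itv/= => rs.
  rewrite normrZ ger0_norm ?(volterra_kernel_ge0 kK)// mulrC.
  by rewrite ler_wpM2r ?(volterra_kernel_ge0 kK)//; exact: hM'.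
under eq_integral do rewrite EFinM.
rewrite ge0_integralZl_EFin//; last 2 first.
- by move=> r _; rewrite lee_fin (volterra_kernel_ge0 kK).
- by apply/measurable_EFinP; exact: measurable_volterra_kernel.
by rewrite (volterra_kernel_integral kK)// subrr (volterra_primitive0 kK (lexx 0)) subr0.
Qed.

Lemma volterra_norm t M h : 0 <= M -> sm_bounded t M h -> `|volterra k h t| <= M * K t.
Proof.
move=> M0 hM; have [t0|t0] := leP t 0.
  by rewrite volterra_nonpos// normr0 mulr_ge0// volterra_primitive_ge0.
rewrite -[t in leRHS]subr0; apply: volterra_norm_from => //; first exact: ltW.
by move=> r /andP[/lt_le_trans h0 /h0]; rewrite ltxx.
Qed.

Lemma Rintegral_indicator_kernel s t : 0 < s -> s <= t ->
  \int[leb]_(r in `]0, t[) (if r \in `[s, t[%classic then k (t - r) else 0) =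
  K (t - s).
Proof.
move=> s0 st; rewrite /Rintegral.
rewrite (_ : (\int[leb]_(r in `]0%R, t[) _ = \int[leb]_(r in `]s, t[) (k (t - r))%:E)%E).
  rewrite (volterra_kernel_integral kK)// subrr (volterra_primitive0 kK (lexx 0)).
  by rewrite subr0.
rewrite integral_itv_obnd_cbnd; last by apply/measurable_EFinP; exact: measurable_volterra_kernel.
rewrite [RHS](_ : _ = \int[leb]_(r in `]0%R, t[ `&` `[s, t[) (k (t - r))%:E)%E.
  rewrite integral_mkcondr; apply: eq_integral => r _; rewrite patchE.
  by case: ifP.
congr (integral _ _ _); apply/esym/setIidr => r /=; rewrite !in_itv/=.
by move=> /andP[sr ->]; rewrite (lt_le_trans s0 sr).
Qed.

(** The two kernels differ by k(s - r) - k(t - r), which is nonnegative by monotonicity, for r < s,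
    and by k(t - r) for r in [s, t[. The total mass is K(s) - K(t) + 2 K(t - s), at most 2 K(t -
    s). *)
Lemma volterra_modulus s t M h : 0 <= M -> 0 <= s -> s <= t -> sm_bounded t M h ->
  `|volterra k h t - volterra k h s| <= 2 * M * K (t - s).
Proof.
move=> M0 s0 st hM; have [sh hM'] := hM.
move: s0; rewrite le_eqVlt => /orP[/eqP s0|s0].
  rewrite -s0 subr0 (volterra_nonpos _ (lexx 0)) subr0 -mulrA.
  apply: le_trans (volterra_norm M0 hM) _.
  by rewrite ler_peMl ?ler1n// mulr_ge0// volterra_primitive_ge0.
rewrite (volterra_widen st hM) /volterra.
have [_ <-] := bochner_integralB (mu := leb) (measurable_itv _) (lebesgue_measure_oo_lty 0 t)
  (volterra_integrable t hM) (volterra_integrable s hM).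
have [iB _] := bochner_integralB (mu := leb) (measurable_itv _) (lebesgue_measure_oo_lty 0 t)
  (volterra_integrable t hM) (volterra_integrable s hM).
(* On [[s, t[] the term [k (s - r)] is 0, and the factor 2 turns [- k (t - r)] into [k (t - r)];
   thus [p] is the absolute difference of the kernels on the whole of []0, t[]. *)
pose p r := k (s - r) - k (t - r) + 2 * (if r \in `[s, t[%classic then k (t - r) else 0).
have ip1 := integrableB (mu := leb) (measurable_itv _)
  (integrable_volterra_kernel 0 t s) (integrable_volterra_kernel 0 t t).
have ip2 : leb.-integrable `]0, t[
    (EFin \o (fun r => if r \in `[s, t[%classic then k (t - r) else 0)).
  apply: (le_integrable (mu := leb) (measurable_itv _) (g := EFin \o (fun r => k (t - r)))) => //.
  - apply/measurable_EFinP; apply: (measurable_restrict _ _ _).1 => //.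
    exact: measurable_volterra_kernel.
  - move=> r _ /=; rewrite lee_fin; case: ifP => // _.
    by rewrite normr0.
  - exact: integrable_volterra_kernel.
have ip3 := integrableZl (mu := leb) (measurable_itv _) 2 ip2.
have ip : leb.-integrable `]0, t[ (EFin \o p) by exact: (integrableD (mu := leb) (measurable_itv _) ip1 ip3).
have pE r : 0 < r < t -> `|k (t - r) - k (s - r)| = p r.
  move=> /andP[r0 rt]; rewrite /p; have [sr|rs] := leP s r.
    rewrite mem_set/= ?in_itv/= ?sr//.
    rewrite (volterra_kernel0 kK (x := s - r)) ?subr_le0// subr0.
    by rewrite ger0_norm ?(volterra_kernel_ge0 kK)//; ring.
  rewrite memNset/= ?in_itv/= ?leNgt ?rs// mulr0 addr0.
  rewrite distrC ger0_norm// subr_ge0; apply: (volterra_kernel_nonincreasing kK).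
    by rewrite subr_gt0.
  by rewrite lerD2r.
rewrite -lee_fin.
apply: le_trans (bochner_integral_norm (mu := leb) _ (lebesgue_measure_oo_lty 0 t) iB
  (k := fun r => M * p r) _ _ _) _ => //.
- exact: eq_integrable (integrableZl _ M ip).
- by move=> r /=; rewrite in_itv/= => rt; rewrite mulr_ge0// -pE.
- apply: aeW => r /=; rewrite in_itv/= => rt.
  by rewrite -scalerBl normrZ pE// mulrC ler_wpM2r -?pE// hM'.
rewrite (_ : (\int[leb]_(r in `]0%R, t[) (M * p r)%:E)%E =
  (\int[leb]_(r in `]0, t[) (M * p r))%:E); last first.
  rewrite /Rintegral fineK//; apply: integrable_fin_num => //.
  exact: eq_integrable (integrableZl _ M ip).
rewrite lee_fin RintegralZl// [2 * M]mulrC -mulrA ler_wpM2l//.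
have t0 : 0 <= t by exact: le_trans (ltW s0) st.
rewrite RintegralD// RintegralB//; [|exact: integrable_volterra_kernel..].
rewrite !Rintegral_volterra_kernel// RintegralZl// subr0 subrr.
rewrite Rintegral_indicator_kernel//.
have := volterra_primitive_nondecreasing kK st.
by rewrite (volterra_primitive0 kK (lexx 0)) (volterra_primitive0 kK (x := s - t))
  ?subr_le0// !subr0; lra.
Qed.

End VolterraOperator.

(** * Real induction and derivatives *)

Section RealAnalysis.
Context {R : realType}.

(** Let [c] be the supremum of the points up to which [P] holds throughout. Left closure gives
    [P c], and if [c < b] the step to the right passes beyond the supremum. This replaces
    compactness of [[a, b]] in mean value inequalities, step approximation and uniqueness. *)
Lemma real_induction (P : R -> Prop) (a b : R) : a <= b -> P a ->
  (forall c, a <= c < b -> P c ->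
     exists2 d, 0 < d & forall x, c <= x < c + d -> x <= b -> P x) ->
  (forall c, a < c <= b -> (forall x, a <= x < c -> P x) -> P c) ->
  P b.
Proof.
move=> ab Pa Pright Pleft.
pose S := [set x | a <= x <= b /\ forall y, a <= y <= x -> P y].
have Sa : S a.
  by split; [rewrite lexx|move=> y /andP[ay ya]; rewrite (le_anti (introT andP (conj ya ay)))].
have supS : has_sup S by split; [exists a|exists b => x [/andP[]]].
set c := sup S.
have ac : a <= c by exact: ub_le_sup supS.2 _ Sa.
have cb : c <= b by apply: ge_sup; [exists a|move=> x [/andP[]]].
have Plt x : a <= x < c -> P x.
  move=> /andP[ax xc]; have xc0 : 0 < c - x by rewrite subr_gt0.
  have [y [_ Py]] := sup_adherent xc0 supS.
  rewrite -/c opprB addrC subrK => xy; apply: Py; rewrite ax; exact: ltW.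
have Pc : P c.
  have [->//|ac'] := eqVneq c a.
  by apply: Pleft => //; rewrite lt_neqAle eq_sym ac' ac cb.
have [->//|cb'] := eqVneq b c.
have {}cb' : c < b by rewrite lt_neqAle eq_sym cb' cb.
have [d d0 dP] : exists2 d, 0 < d & forall x, c <= x < c + d -> x <= b -> P x.
  by apply: Pright => //; rewrite ac.
pose e := Num.min b (c + d / 2).
have ce : c < e by rewrite lt_min cb' ltrDl divr_gt0.
have : S e.
  have eb : e <= b by rewrite ge_min lexx.
  split; first by rewrite eb (le_trans ac (ltW ce)).
  move=> y /andP[ay ye]; have [yc|cy] := ltP y c; first by apply: Plt; rewrite ay.
  apply: dP; last exact: le_trans eb.
  rewrite cy (le_lt_trans ye)//; apply: (@le_lt_trans _ _ (c + d / 2)).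
    by rewrite ge_min lexx orbT.
  by rewrite ltrD2l ltr_pdivrMr// ltr_pMr// ltr1n.
by move=> /(ub_le_sup supS.2); rewrite -/c leNgt ce.
Qed.

Section Derivative.
Variable X : normedModType R.
Implicit Types F : R -> X.

(** Without the quotient there is no exception at [s = t], and the inequality is directly one on
    increments. *)
Lemma is_derive_bound F (t : R) (v : X) : is_derive t 1 F v <->
  (forall e, 0 < e -> exists2 d, 0 < d & forall s, `|s - t| < d ->
     `|F s - F t - (s - t) *: v| <= e * `|s - t|).
Proof.
split.
  move=> dF e e0.
  have [dFt Fv] := dF; have : h^-1 *: (F (h *: (1 : R) + t) - F t) @[h --> 0^'] --> v.
    by rewrite -[X in _ --> X]Fv; exact: dFt.
  move=> /cvgrPdist_le /(_ _ e0) [d /= d0 dP]; exists d => // s std.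
  have [->|st0] := eqVneq s t; first by rewrite !subrr scale0r subr0 !normr0 mulr0.
  have st : s - t != 0 by rewrite subr_eq0.
  have := dP (s - t); rewrite /ball_/= sub0r normrN => /(_ std st).
  rewrite -[(s - t) *: 1]/((s - t) * 1) mulr1 subrK => vF.
  rewrite (_ : F s - F t - _ = (s - t) *: ((s - t)^-1 *: (F s - F t) - v)).
    by rewrite normrZ mulrC distrC ler_wpM2r.
  by rewrite scalerBr scalerA divff// scale1r.
move=> Fv.
have cv : h^-1 *: (F (h *: (1 : R) + t) - F t) @[h --> 0^'] --> v.
  apply/cvgrPdist_le => e e0; have [d d0 dP] := Fv e e0.
  exists d => //= h; rewrite /ball_/= sub0r normrN => hd h0.
  rewrite -[h *: 1]/(h * 1) mulr1.
  have := dP (h + t); rewrite addrK => /(_ hd).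
  rewrite (_ : F (h + t) - F t - _ = h *: (h^-1 *: (F (h + t) - F t) - v)).
    by rewrite normrZ mulrC ler_pM2r ?normr_gt0// distrC.
  by rewrite scalerBr scalerA divff// scale1r.
by apply: DeriveDef; [apply/cvg_ex; exists v|exact: cvg_lim].
Qed.

End Derivative.

Lemma continuous_bounded_itv (X : normedModType R) (h : R -> X) (a b : R) :
  (forall r, a <= r <= b -> {for r, continuous h}) ->
  exists2 M, 0 <= M & forall r, a <= r <= b -> `|h r| <= M.
Proof.
move=> ch; have [ab|ba] := leP a b; last first.
  by exists 0 => // r /andP[ar rb]; move: (le_trans ar rb); rewrite leNgt ba.
have cn : {within `[a, b], continuous (fun r => `|h r|)}.
  apply: continuous_in_subspaceT => x; rewrite inE/= in_itv/= => xab.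
  by apply: cvg_norm; exact: ch.
have [c _ cP] := EVT_max ab cn.
by exists `|h c| => // r rab; apply: cP; rewrite in_itv.
Qed.

End RealAnalysis.

(** * Fractional kernels, and differentiation of primitives *)

Section FractionalKernels.
Context {R : realType}.
Local Notation leb := (@lebesgue_measure R).
Implicit Types (beta c t s M : R).

(** For positive x this is x^beta / Gamma(beta + 1), with Gamma(beta + 1) written as beta
    Gamma(beta): the primitive of [g beta], equivalently the fractional integral of the constant
    1. *)
Definition fractional_primitive beta (x : R) : R :=
  power_primitive beta x / (beta * Gamma beta).

Lemma volterra_power_kernel beta c : 0 < beta <= 1 -> 0 <= c ->
  volterra_kernel (fun x => c * power_kernel beta x)
    (fun x => c * (power_primitive beta x / beta)).
Proof.
move=> /andP[b0 b1] c0; split.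
- by move=> x; rewrite mulr_ge0// power_kernel_ge0.
- by move=> x x0; rewrite /power_kernel ltNge x0 mulr0.
- by apply: measurable_funM => //; exact: measurable_power_kernel.
- move=> x y x0 xy; have y0 := lt_le_trans x0 xy.
  rewrite ler_wpM2l// /power_kernel x0 y0 -opprB !powRN.
  rewrite lef_pV2 ?posrE ?powR_gt0//.
  by apply: ge0_ler_powR; rewrite ?subr_ge0// ?nnegrE ltW.
- move=> a b t ab; under eq_integral do rewrite EFinM.
  rewrite ge0_integralZl_EFin//; last 2 first.
  + by move=> r _; rewrite lee_fin power_kernel_ge0.
  + apply/measurable_EFinP/measurable_funTS.
    by apply: measurableT_comp; [exact: measurable_power_kernel|exact: measurable_funB].
  rewrite integral_power_kernel_reflect// -EFinM; congr EFin.
  by rewrite mulrBl mulrBr.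
- by move=> x x0; rewrite /power_primitive ltNge x0 mul0r mulr0.
- move=> x y xy; rewrite ler_wpM2l// ler_pM2r ?invr_gt0//.
  exact: power_primitive_nondecreasing.
- move=> x; apply: cvgMl_tmp; apply: cvgMl; exact: continuous_power_primitive.
Qed.

Lemma volterra_fractional beta : 0 < beta < 1 ->
  volterra_kernel (g beta) (fractional_primitive beta).
Proof.
move=> /andP[b0 b1]; have G0 : 0 < Gamma beta by apply: Gamma_gt0; rewrite b0.
have b01 : 0 < beta <= 1 by rewrite b0 ltW.
have Gi : 0 <= (Gamma beta)^-1 by rewrite invr_ge0 ltW.
have := volterra_power_kernel b01 Gi.
rewrite (_ : (fun x => _ * power_kernel beta x) = g beta); last first.
  by apply/funext => x; rewrite /g /power_kernel; case: ifP; rewrite ?mulr0// mulrC.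
rewrite (_ : (fun x => _ * (power_primitive beta x / beta)) = fractional_primitive beta)//.
apply/funext => x; rewrite /fractional_primitive invfM; ring.
Qed.

Lemma volterra_one : volterra_kernel (power_kernel (1 : R)) (power_primitive 1).
Proof.
have b01 : (0 < 1 :> R) && (1 <= 1 :> R) by rewrite ltr01 lexx.
have := volterra_power_kernel b01 ler01.
rewrite (_ : (fun x => 1 * power_kernel 1 x) = power_kernel 1); last first.
  by apply/funext => x; rewrite mul1r.
by rewrite (_ : (fun x => _) = power_primitive 1)//; apply/funext => x; rewrite mul1r divr1.
Qed.

Lemma power_kernel1 (x : R) : power_kernel 1 x = if 0 < x then 1 else 0.
Proof. by rewrite /power_kernel subrr powRr0. Qed.

Lemma power_primitive1 (x : R) : 0 <= x -> power_primitive 1 x = x.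
Proof.
rewrite le_eqVlt => /orP[/eqP <-|x0]; first by rewrite /power_primitive ltxx.
by rewrite /power_primitive x0 powRr1// ltW.
Qed.

Variable X : completeNormedModType R.
Implicit Types h : R -> X.

Lemma primitiveE h t : bochner_integral leb `]0, t[ h = volterra (power_kernel 1) h t.
Proof.
apply: eq_bochner_integral => r /set_mem/=; rewrite in_itv/= => /andP[_ rt].
by rewrite power_kernel1 subr_gt0 rt scale1r.
Qed.

Section VolterraContinuity.
Variables k K : R -> R.
Hypothesis kK : volterra_kernel k K.

Lemma volterra_modulusT s t T M h : 0 <= M -> s <= t -> t <= T -> sm_bounded T M h ->
  `|volterra k h t - volterra k h s| <= 2 * M * K (t - s).
Proof.
move=> M0 st tT hM; have [s0|s0] := leP 0 s.
  by apply: (volterra_modulus kK) => //; exact: sm_bounded_le hM.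
rewrite (volterra_nonpos _ _ (ltW s0)) subr0.
apply: le_trans (volterra_norm kK M0 (sm_bounded_le tT hM)) _.
apply: (@le_trans _ _ (M * K (t - s))).
  rewrite ler_wpM2l// (volterra_primitive_nondecreasing kK)// lerDl oppr_ge0; exact: ltW.
by rewrite -mulrA ler_peMl ?ler1n// mulr_ge0// (volterra_primitive_ge0 kK).
Qed.

(** Time is stopped at [T] because nothing is known of [h] from there on. The modulus of continuity
    is uniform up to [T], which is what lets a bounded right-hand side yield a value at the end
    point. *)
Lemma volterra_stop_continuous T M h : 0 <= M -> sm_bounded T M h ->
  continuous (fun t => volterra k h (Num.min t T)).
Proof.
move=> M0 hM t; apply/cvgrPdist_lt => e e0.
(* Adding 1 keeps the divisor positive when [M = 0]. *)
have M1 : 0 < 2 * M + 1 by rewrite ltr_wpDl// mulr_ge0.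
have e1 : 0 < e / (2 * M + 1) by rewrite divr_gt0.
have : K x @[x --> (0 : R)] --> K 0 by exact: (volterra_primitive_continuous kK).
rewrite (volterra_primitive0 kK (lexx 0)) => /cvgr_lt /(_ _ e1).
move=> [d /= d0 dP]; near=> s.
have main a b : a <= b -> b - a < d ->
    `|volterra k h (Num.min b T) - volterra k h (Num.min a T)| < e.
  move=> ab bad; have mm : Num.min a T <= Num.min b T by rewrite le_min !ge_min ab lexx orbT.
  have mT : Num.min b T <= T by rewrite ge_min lexx orbT.
  apply: le_lt_trans (volterra_modulusT M0 mm mT hM) _.
  have ml : Num.min b T - Num.min a T <= b - a.
    by rewrite /Num.min; case: ifPn; case: ifPn; rewrite -?leNgt; lra.
  have Ke : K (Num.min b T - Num.min a T) < e / (2 * M + 1).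
    apply: le_lt_trans (volterra_primitive_nondecreasing kK ml) _.
    by apply: dP; rewrite /ball_/= sub0r normrN ger0_norm// subr_ge0.
  have K0 := volterra_primitive_ge0 kK (Num.min b T - Num.min a T).
  apply: (@le_lt_trans _ _ ((2 * M + 1) * K (Num.min b T - Num.min a T))).
    by rewrite ler_wpM2r// lerDl.
  by rewrite mulrC -ltr_pdivlMr.
have : `|t - s| < d by near: s; exists d.
have [ts|st] := leP t s.
  by rewrite distrC ger0_norm ?subr_ge0// distrC; exact: main.
by rewrite ger0_norm ?subr_ge0 ?ltW//; exact/main/ltW.
Unshelve. all: by end_near. Qed.

Lemma volterra_continuous h : (forall T, exists2 M, 0 <= M & sm_bounded T M h) ->
  continuous (volterra k h).
Proof.
move=> hM t; have [M M0 hM1] := hM (t + 1).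
have := (volterra_stop_continuous M0 hM1 : continuous _) t; rewrite /continuous_at.
have tt1 : t < t + 1 by rewrite ltrDl.
rewrite (min_l (ltW tt1)); apply: cvg_trans; apply: near_eq_cvg.
near=> s; rewrite min_l//; apply: ltW; near: s; exact: lt_nbhsl.
Unshelve. all: by end_near. Qed.

End VolterraContinuity.

Lemma continuous_sm_bounded h : continuous h ->
  forall T, exists2 M, 0 <= M & sm_bounded T M h.
Proof.
move=> ch T; have [M M0 hM] := @continuous_bounded_itv _ _ h 0 T (fun r _ => ch r).
exists M => //; split; last by move=> r /andP[r0 rT]; apply: hM; rewrite !ltW.
by apply: strongly_measurable_continuous => // x _; exact: ch.
Qed.

Lemma sm_bounded_cst T (v : X) : sm_bounded T `|v| (cst v).
Proof. by split=> //; exact: strongly_measurable_cst. Qed.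

Lemma sm_bounded_from c T M h : 0 <= M -> sm_bounded T M h ->
  sm_bounded T M (fun r => (if c < r then 1 else 0) *: h r).
Proof.
move=> M0 [sh hM]; split.
  apply: strongly_measurableZ => //; apply: strongly_measurable_measurable => //.
  by apply: measurable_funTS; apply: measurable_fun_ifT => //; exact: measurable_fun_ltr.
move=> r rT; case: ifP => _; first by rewrite scale1r; exact: hM.
by rewrite scale0r normr0.
Qed.

(** The left-hand side is the integral of [h - v] over []x, y[], rewritten as the convolution at [y]
    of [h1], which vanishes up to [x] and is bounded by [e] afterwards. *)
Lemma primitive_linearization x y M e h (v : X) : 0 <= M -> 0 <= e -> 0 <= x -> x <= y ->
  sm_bounded y M h -> (forall r, x < r < y -> `|h r - v| <= e) ->
  `|bochner_integral leb `]0, y[ h - bochner_integral leb `]0, x[ h - (y - x) *: v|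
    <= e * (y - x).
Proof.
move=> M0 e0 x0 xy hM hv; have y0 := le_trans x0 xy.
have kK := volterra_one.
have cM := sm_bounded_cst y v.
have h'M := sm_boundedB hM cM.
have M'0 : 0 <= M + `|v| by rewrite addr_ge0.
have Vc z : 0 <= z -> z <= y -> volterra (power_kernel 1) (cst v) z = z *: v.
  move=> z0 zy; have := @volterra_cst_vec R (power_kernel 1) X z (cst 1) v.
  rewrite (_ : (fun r => cst 1 r *: v) = cst v); last by apply/funext => r; rewrite scale1r.
  move=> ->; last first.
    apply: eq_integrable (integrable_volterra_kernel kK 0 z z) => // r _.
    by rewrite /= mulr1.
  under eq_Rintegral do rewrite mulr1.
  by rewrite (Rintegral_volterra_kernel kK)// subrr subr0 !power_primitive1// subr0.
rewrite !primitiveE.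
have -> : volterra (power_kernel 1) h y - volterra (power_kernel 1) h x - (y - x) *: v
    = volterra (power_kernel 1) (fun r => h r - v) y -
      volterra (power_kernel 1) (fun r => h r - v) x.
  rewrite (volterraB kK hM cM) (volterraB kK (sm_bounded_le xy hM) (sm_bounded_le xy cM)).
  rewrite !Vc// scalerBl !opprB addrACA [RHS]addrACA; congr (_ + _).
  exact: addrC.
pose h1 r := (if x < r then 1 else 0 : R) *: (h r - v).
have h1M : sm_bounded y (M + `|v|) h1 by exact: sm_bounded_from.
have -> : volterra (power_kernel 1) (fun r => h r - v) x =
    volterra (power_kernel 1) (fun r => (h r - v) - h1 r) y.
  rewrite (volterra_widen kK xy h'M) /volterra.
  apply: (bochner_integral_ae (mu := leb) _ (lebesgue_measure_oo_lty 0 y) _ _).2 => //.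
    (* At [r = x] itself the kernel [power_kernel 1 (x - r)] is 0 while [h1] does not yet cancel
       [h r - v]; elsewhere the integrands agree. *)
    exists [set x]; split => //; first exact: lebesgue_measure_set1.
    move=> r /= /not_implyP[]; rewrite in_itv/= => /andP[r0 ry] rE.
    apply: contrapT => rx; apply: rE; rewrite !power_kernel1 !subr_gt0 ry scale1r /h1.
    have [rx'|xr] := ltP r x.
      by rewrite ltNge (ltW rx') scale0r subr0 scale1r.
    have -> : x < r by rewrite lt_neqAle xr andbT eq_sym; apply/eqP.
    by rewrite scale1r subrr scale0r.
  by apply: (volterra_integrable kK); exact: (sm_boundedB h'M h1M).
rewrite (volterraB kK h'M h1M) opprB addrC subrK -[y - x](power_primitive1)//; last first.
  by rewrite subr_ge0.
apply: (volterra_norm_from kK) => //.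
- split; first exact: h1M.1.
  move=> r /andP[r0 ry]; rewrite /h1; case: ifPn => xr; last by rewrite scale0r normr0.
  by rewrite scale1r; apply: hv; rewrite xr.
- by move=> r /andP[_ rx]; rewrite /h1 ltNge rx scale0r.
Qed.

Lemma is_derive_primitive t T M h : 0 <= M -> 0 < t < T -> sm_bounded T M h ->
  {for t, continuous h} ->
  is_derive t 1 (fun s => bochner_integral leb `]0, s[ h) (h t).
Proof.
move=> M0 /andP[t0 tT] hM /cvgrPdist_le ch; apply/is_derive_bound => e e0.
have [d /= d0 dP] := ch e e0.
pose d' := Num.min d (Num.min t (T - t)).
exists d'; first by rewrite !lt_min d0 t0 subr_gt0.
move=> s; rewrite !lt_min => /andP[sd /andP[st sT]].
have close r : `|r - t| <= `|s - t| -> `|h r - h t| <= e.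
  by move=> rs; rewrite distrC; apply: dP; rewrite /ball_/= distrC (le_lt_trans rs).
have [ts|st'] := leP t s.
  move: sd sT st close; rewrite (@ger0_norm _ (s - t)) ?subr_ge0// => sd sT st close.
  apply: (primitive_linearization M0 (ltW e0)) => //; first exact: ltW.
    by apply: sm_bounded_le hM; lra.
  move=> r /andP[tr rs]; apply: close.
  by rewrite ger0_norm ?subr_ge0 ?(ltW tr)// lerD2r ltW.
move: sd sT st close; rewrite (@ltr0_norm _ (s - t)) ?subr_lt0// opprB => sd sT st close.
set F := fun x => bochner_integral leb `]0, x[ h.
have -> : F s - F t - (s - t) *: h t = - (F t - F s - (t - s) *: h t).
  by rewrite [RHS]opprB -(opprB s t) scaleNr opprB addrC.
have s0 : 0 <= s by lra.
rewrite normrN; apply: (primitive_linearization M0 (ltW e0) s0 (ltW st')).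
  by apply: sm_bounded_le hM; exact: ltW.
move=> r /andP[sr rt]; apply: close.
by rewrite ltr0_norm ?subr_lt0// opprB lerD2l lerN2 ltW.
Qed.

End FractionalKernels.

(** * Composition of fractional integrals of complementary orders *)

Section Semigroup.
Context {R : realType}.
Local Notation leb := (@lebesgue_measure R).
Variable X : completeNormedModType R.
Implicit Types (h : R -> X) (c t T M : R).

Lemma volterra_step (k K : R -> R) c t (v : X) : volterra_kernel k K -> 0 <= c ->
  volterra k (fun r => (if c < r then 1 else 0) *: v) t = K (t - c) *: v.
Proof.
move=> kK c0; have [tc|ct] := leP t c.
  rewrite (volterra_primitive0 kK) ?subr_le0// scale0r.
  apply: bochner_integral0 => //; first exact: lebesgue_measure_oo_lty.
  move=> r /=; rewrite in_itv/= => /andP[_ rt].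
  by rewrite ltNge (le_trans (ltW rt) tc)/= scale0r scaler0.
have E : (fun r => k (t - r) * (if c < r then 1 else 0)) =1
    (fun r => k (t - r)) \_ `]c, +oo[.
  move=> r; rewrite patchE; have [cr|rc] := ltP c r.
    by rewrite mem_set/= ?in_itv/= ?cr// mulr1.
  by rewrite memNset/= ?in_itv/= ?ltNge ?rc// mulr0.
have sub : `]0, t[ `&` `]c, +oo[ = `]c, t[%classic.
  apply/seteqP; split=> r /=; rewrite !in_itv/= ?andbT.
    by move=> [/andP[_ ->] ->].
  by move=> /andP[cr ->]; rewrite cr (le_lt_trans c0 cr).
have ik : leb.-integrable `]0, t[
    (EFin \o (fun r => k (t - r) * (if c < r then 1 else 0))).
  apply: (le_integrable (mu := leb) (measurable_itv _) (g := EFin \o (fun r => k (t - r)))).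
  - apply/measurable_EFinP; apply: measurable_funM.
      exact: (measurable_volterra_kernel kK).
    apply: measurable_funTS; apply: measurable_fun_ifT => //.
    exact: measurable_fun_ltr.
  - move=> r _; rewrite lee_fin; case: ifP => _; first by rewrite mulr1.
    by rewrite mulr0 normr0.
  - exact: (integrable_volterra_kernel kK).
rewrite volterra_cst_vec//; congr (_ *: v).
rewrite /Rintegral (_ : (\int[leb]_(r in `]0%R, t[) _)%E =
    (\int[leb]_(r in `]c, t[) (k (t - r))%:E)%E).
  by rewrite (volterra_kernel_integral kK) ?ltW// subrr (volterra_primitive0 kK (lexx 0))
    subr0.
rewrite -sub integral_mkcondr; apply: eq_integral => r _.
by rewrite E !patchE; case: ifP.
Qed.

Definition locally_sm_bounded h := forall T, exists2 M, 0 <= M & sm_bounded T M h.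

Lemma locally_sm_bounded_step c (v : X) :
  locally_sm_bounded (fun r => (if c < r then 1 else 0) *: v).
Proof.
move=> T; exists `|v| => //; apply: sm_bounded_from => //; exact: sm_bounded_cst.
Qed.

Lemma locally_sm_boundedB h h' : locally_sm_bounded h -> locally_sm_bounded h' ->
  locally_sm_bounded (fun r => h r - h' r).
Proof.
move=> hb hb' T; have [M M0 hM] := hb T; have [M' M'0 hM'] := hb' T.
by exists (M + M'); [exact: addr_ge0|exact: sm_boundedB].
Qed.

Lemma volterra_locally_sm_bounded (k K : R -> R) h : volterra_kernel k K ->
  locally_sm_bounded h -> locally_sm_bounded (volterra k h).
Proof.
by move=> kK hb; apply: continuous_sm_bounded; exact: (volterra_continuous kK hb).
Qed.

Lemma volterra_locallyB (k K : R -> R) h h' t : volterra_kernel k K ->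
  locally_sm_bounded h -> locally_sm_bounded h' ->
  volterra k (fun r => h r - h' r) t = volterra k h t - volterra k h' t.
Proof.
move=> kK hb hb'; have [M M0 hM] := hb t; have [M' M'0 hM'] := hb' t.
exact: (volterraB kK hM hM').
Qed.

Variables a b : R.
Hypotheses (a0 : 0 < a) (b0 : 0 < b) (ab1 : a + b = 1).
Opaque Gamma powR bochner_integral.

Let a01 : 0 < a < 1. Proof. by rewrite a0 -ab1 ltrDl. Qed.
Let b01 : 0 < b < 1. Proof. by rewrite b0 -ab1 ltrDr. Qed.
Let ka := volterra_fractional a01.
Let kb := volterra_fractional b01.

(** The function integrated is [J b] of a step at [c], so this is the composition rule on a step.
    The Gamma factors of the two kernels cancel the Beta constant. *)
Lemma J_fractional_primitive c t (v : X) : 0 <= c ->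
  J a (fun r => fractional_primitive b (r - c) *: v) t = power_primitive 1 (t - c) *: v.
Proof.
move=> c0; have [tc|ct] := leP t c.
  rewrite /power_primitive subr_gt0 ltNge tc scale0r.
  apply: bochner_integral0 => //; first exact: lebesgue_measure_oo_lty.
  move=> r /=; rewrite in_itv/= => /andP[_ rt].
  rewrite (volterra_primitive0 kb) ?scale0r ?scaler0// subr_le0.
  exact: le_trans (ltW rt) tc.
have Ga0 := Gamma_gt0 a01; have Gb0 := Gamma_gt0 b01.
have E r : g a (t - r) * fractional_primitive b (r - c) =
    (b * (Gamma a * Gamma b))^-1 *
    (power_kernel a (t - r) * power_primitive b (r - c)).
  rewrite /g /fractional_primitive /power_kernel; case: ifP => _; last by rewrite !mul0r mulr0.
  by move: (Gamma a) (Gamma b) => Ga Gb; rewrite !invfM; ring.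
have c1 : 0 <= (b * (Gamma a * Gamma b))^-1 by rewrite invr_ge0 !mulr_ge0 ?ltW.
have mpp : measurable_fun [set: R]
    (fun r => (power_kernel a (t - r) * power_primitive b (r - c))%:E).
  apply/measurable_EFinP; apply: measurable_funM.
    by apply: measurableT_comp; [exact: measurable_power_kernel|exact: measurable_funB].
  by apply: measurableT_comp; [exact: measurable_power_primitive|exact: measurable_funB].
have I : (\int[leb]_(r in `]0%R, t[)
    (g a (t - r) * fractional_primitive b (r - c))%:E = (t - c)%:E)%E.
  under eq_integral do rewrite E EFinM.
  rewrite ge0_integralZl_EFin//; last 2 first.
  - move=> r _; rewrite lee_fin; apply: mulr_ge0; first exact: power_kernel_ge0.
    exact: power_primitive_ge0.
  - exact: measurable_funTS.
  transitivity ((b * (Gamma a * Gamma b))^-1%:E *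
      \int[leb]_r (power_kernel a (t - r) * power_primitive b (r - c))%:E)%E.
    congr (_ * _)%E; rewrite integral_mkcond; apply: eq_integral => r _.
    rewrite patchE; case: ifPn => //; rewrite notin_setE/= in_itv/= => /negP.
    rewrite negb_and -!leNgt => /orP[r0|tr].
      by rewrite /power_primitive subr_gt0 ltNge (le_trans r0 c0) mulr0.
    by rewrite /power_kernel subr_gt0 ltNge tr mul0r.
  rewrite kernel_primitive_convolution ?ltW// -EFinM; congr EFin.
  by move: (Gamma a) (Gamma b) Ga0 Gb0 => Ga Gb Ga0 Gb0; field; rewrite !lt0r_neq0.
rewrite -[LHS]/(volterra (g a) _ t) volterra_cst_vec; last first.
  apply/integrableP; split.
    apply/measurable_EFinP/measurable_funTS.
    rewrite (_ : (fun r => _) = (fun r => (b * (Gamma a * Gamma b))^-1 *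
      (power_kernel a (t - r) * power_primitive b (r - c)))); last exact/funext.
    by apply: measurable_funM => //; apply/measurable_EFinP.
  rewrite (_ : (\int[leb]_(r in _) _)%E = (t - c)%:E) ?ltry// -I.
  apply: eq_integral => r _ /=; rewrite ger0_norm// mulr_ge0//.
    exact: (volterra_kernel_ge0 ka).
  exact: (volterra_primitive_ge0 kb).
by rewrite /Rintegral I/= power_primitive1// subr_ge0 ltW.
Qed.

Let semigroup h := locally_sm_bounded h /\
  forall t, J a (J b h) t = volterra (power_kernel 1) h t.

Let semigroup_step c (v : X) : 0 <= c ->
  semigroup (fun r => (if c < r then 1 else 0) *: v).
Proof.
move=> c0; split; first exact: locally_sm_bounded_step.
move=> t; rewrite (volterra_step _ _ volterra_one c0) -(J_fractional_primitive t v c0).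
by apply: eq_volterra => r _; exact: (volterra_step _ _ kb).
Qed.

Let semigroupB h h' : semigroup h -> semigroup h' -> semigroup (fun r => h r - h' r).
Proof.
move=> [hb hE] [hb' hE']; split; first exact: locally_sm_boundedB.
move=> t; rewrite (volterra_locallyB t volterra_one hb hb') -hE -hE'.
rewrite -(volterra_locallyB _ ka (volterra_locally_sm_bounded kb hb)
  (volterra_locally_sm_bounded kb hb')).
by apply: eq_volterra => r _; exact: (volterra_locallyB _ kb).
Qed.

(** By real induction on the end point [t], keeping [s] constant, equal to [v], beyond [t]:
    subtracting one more step at [c] of height [v - h c] resets that value to [h c], which is close
    to [h] just after [c]. *)
Let semigroup_approx h e T : continuous h -> 0 < e -> 0 <= T -> exists2 s, semigroup s &
  forall r, 0 < r <= T -> `|h r - s r| <= e.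
Proof.
move=> ch e0 T0.
pose P t := exists s v, [/\ semigroup s, forall r, 0 < r <= t -> `|h r - s r| <= e &
  forall r, t < r -> s r = v].
suff [s [v [ss sP _]]] : P T by exists s.
have extend c x : 0 <= c -> c <= x -> P c ->
    (forall r, c < r <= x -> `|h r - h c| <= e) -> P x.
  move=> c0 cx [s [v [ss sP sv]]] hc.
  have vE : v - (v - h c) = h c by rewrite opprB addrC subrK.
  exists (fun r => s r - (if c < r then 1 else 0 : R) *: (v - h c)), (h c); split.
  - by apply: semigroupB; [exact: ss|exact: semigroup_step].
  - move=> r /andP[r0 rx]; have [cr|rc] := ltP c r.
      by rewrite scale1r sv// vE; apply: hc; rewrite cr.
    by rewrite scale0r subr0; apply: sP; rewrite r0.
  - by move=> r xr; rewrite (le_lt_trans cx xr) scale1r sv ?(le_lt_trans cx xr).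
apply: (real_induction (a := 0)) => //.
- exists (fun r => (if 0 < r then 1 else 0 : R) *: (0 : X)), 0; split.
  + exact: semigroup_step.
  + by move=> r /andP[/lt_le_trans /[apply]]; rewrite ltxx.
  + by move=> r r0; rewrite scaler0.
- move=> c /andP[c0 _] Pc; have /cvgrPdist_le/(_ _ e0)[d /= d0 dP] := ch c.
  exists d => // x /andP[cx xd] _; apply: (extend c) => // r /andP[cr rx].
  rewrite distrC; apply: dP; rewrite /ball_/= ltr0_norm ?subr_lt0//; lra.
- move=> c /andP[c0 _] Pc.
  (* To reach [c] from the left the last step is placed at [x], with value [h x]; both [h x] and
     [h r] are within [e / 2] of [h c]. *)
  have e2 : 0 < e / 2 by rewrite divr_gt0.
  have /cvgrPdist_le/(_ _ e2)[d /= d0 dP] := ch c.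
  pose x := Num.max 0 (c - d / 2).
  have xc : x < c by rewrite gt_max c0 ltrBlDr ltrDl divr_gt0.
  have x0 : 0 <= x by rewrite le_max lexx.
  have cx : c - x <= d / 2 by rewrite lerBlDr -lerBlDl le_max lexx orbT.
  have close r : x <= r -> r <= c -> `|h c - h r| <= e / 2.
    by move=> xr rc; apply: dP; rewrite /ball_/= ger0_norm ?subr_ge0//; lra.
  apply: (extend x) => //; [exact: ltW|by apply: Pc; rewrite x0|].
  move=> r /andP[xr rc]; rewrite -(subrK (h c) (h r)) -addrA [e]splitr.
  apply: le_trans (ler_normD _ _) _; apply: lerD; last by apply: close => //; exact: ltW.
  by rewrite distrC; apply: close => //; exact: ltW.
Qed.

(* Both sides are continuous in [h] for the uniform norm, so that it is enough to
   treat step functions, i.e. indicators of half-lines [c, +oo[. *)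
Lemma J_semigroup h t : continuous h -> J a (J b h) t = bochner_integral leb `]0, t[ h.
Proof.
move=> ch; rewrite primitiveE; have [t0|t0] := leP t 0.
  by rewrite -[J _ _ _]/(volterra _ _ _) !volterra_nonpos.
have hb := continuous_sm_bounded ch.
pose C := fractional_primitive b t * fractional_primitive a t + power_primitive 1 t.
have Cb := volterra_primitive_ge0 kb t; have Ca := volterra_primitive_ge0 ka t.
have C0 : 0 <= C by rewrite addr_ge0 ?power_primitive_ge0// mulr_ge0.
apply/eqP; rewrite -subr_eq0 -normr_le0; apply/ler_addgt0Pr => e e0; rewrite add0r.
pose d := e / (C + 1).
have C1 : 0 < C + 1 by rewrite ltr_wpDl.
have d0 : 0 < d by rewrite divr_gt0.
have [s [sb sE] sP] := semigroup_approx ch d0 (ltW t0).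
have hsd : sm_bounded t d (fun r => h r - s r).
  have [M M0 [smM _]] := locally_sm_boundedB hb sb t.
  by split => // r /andP[r0 rt]; apply: sP; rewrite r0 ltW.
have hsb := locally_sm_boundedB hb sb.
have E : J a (J b h) t - volterra (power_kernel 1) h t =
    J a (J b (fun r => h r - s r)) t - volterra (power_kernel 1) (fun r => h r - s r) t.
  rewrite (volterra_locallyB _ volterra_one hb sb) -sE.
  rewrite [J a (J b (fun r => h r - s r)) t](_ : _ = J a (J b h) t - J a (J b s) t).
    by rewrite opprB addrA subrK.
  rewrite -(volterra_locallyB _ ka (volterra_locally_sm_bounded kb hb)
    (volterra_locally_sm_bounded kb sb)).
  by apply: eq_volterra => r _; exact: (volterra_locallyB _ kb).
rewrite E; apply: le_trans (ler_normB _ _) _.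
have Jb : sm_bounded t (d * fractional_primitive b t) (J b (fun r => h r - s r)).
  have [M M0 [smM _]] := volterra_locally_sm_bounded kb hsb t.
  split; first exact: smM.
  move=> r /andP[r0 rt]; apply: le_trans (volterra_norm kb (ltW d0) (sm_bounded_le (ltW rt) hsd)) _.
  apply: ler_wpM2l; first exact: ltW.
  apply: (volterra_primitive_nondecreasing kb); exact: ltW.
have B1 := volterra_norm ka (mulr_ge0 (ltW d0) Cb) Jb.
have B2 := volterra_norm volterra_one (ltW d0) hsd.
apply: le_trans (lerD B1 B2) _; rewrite -mulrA -mulrDr -/C /d mulrAC.
rewrite (ler_pdivrMr _ _ C1); apply: ler_wpM2l; first exact: ltW.
by rewrite lerDl ler01.
Qed.

End Semigroup.

(** * Weak derivatives *)

Section AbsoluteContinuity.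
Context {R : realType}.
Local Notation leb := (@lebesgue_measure R).
Variable X : completeNormedModType R.

(** A mean value inequality: it suffices to control short increments that begin or end at each given
    point [c], since real induction chains them together. *)
Lemma increments_le (G : R -> X) (psi : R -> R) (a b : R) : a <= b ->
  (forall c, a <= c <= b -> exists2 d, 0 < d & forall x y, a <= x -> y <= b ->
    x = c \/ y = c -> x <= y -> y - x < d -> `|G y - G x| <= psi y - psi x) ->
  `|G b - G a| <= psi b - psi a.
Proof.
move=> ab local.
apply: (real_induction (P := fun t => `|G t - G a| <= psi t - psi a) ab).
- by rewrite !subrr normr0.
- move=> c /andP[ac cb] Pc; have [d d0 dP] := local c (introT andP (conj ac (ltW cb))).
  exists d => // x /andP[cx xd] xb; rewrite -(subrK (G c) (G x)) -addrA.
  apply: le_trans (ler_normD _ _) _.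
  have := dP c x ac xb (or_introl erefl) cx; rewrite ltrBlDl => /(_ xd).
  by move: Pc; lra.
- move=> c /andP[ac cb] Pc; have [d d0 dP] := local c (introT andP (conj (ltW ac) cb)).
  pose x := Num.max a (c - d / 2).
  have xc : x < c by rewrite gt_max ac ltrBlDr ltrDl divr_gt0.
  have ax : a <= x by rewrite le_max lexx.
  have xd : c - d / 2 <= x by rewrite le_max lexx orbT.
  have := dP x c ax cb (or_intror erefl) (ltW xc).
  have cxd : c - x < d by lra.
  move=> /(_ cxd) Gxc; have := Pc x; rewrite ax xc => /(_ isT).
  rewrite -(subrK (G x) (G c)) -addrA.
  by have := ler_normD (G c - G x) (G x - G a); move: Gxc; lra.
Qed.

(* A null set containing the exceptional points lies in an open set [U] with
   [\int_U m < e]; near a point of [U] the increments of [G] are controlled by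
   those of [psi t = \int_(U `&` ]a, t[) m], near the other points by the slope [e]. *)
Lemma ae_derive0_constant (G : R -> X) (m : R -> R) (T a b : R) :
  leb.-integrable `]0, T[ (EFin \o m) -> (forall r, 0 <= m r) ->
  (forall x y, 0 < x -> x <= y -> y < T ->
    (`|G y - G x|%:E <= \int[leb]_(r in `]x, y[) (m r)%:E)%E) ->
  {ae leb, forall t, t \in `]0, T[ -> is_derive t 1 G 0} ->
  0 < a -> a <= b -> b < T -> G a = G b.
Proof.
move=> im m0 Gm /ae_nullP[N [mN N0 dG]] a0 ab bT.
pose p := m \_ `]0, T[.
have p0 r : 0 <= p r by rewrite /p patchE; case: ifP.
have ip : leb.-integrable setT (EFin \o p).
  rewrite /p -restrict_EFin.
  exact: (integrable_mkcond (mu := leb) (EFin \o m) (measurable_itv _)).1 im.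
have mp D : measurable D -> measurable_fun D (EFin \o p).
  by move=> mD; apply: measurable_funTS; exact: measurable_int ip.
suff main e : 0 < e -> `|G b - G a| <= e * (b - a) + e.
  apply/esym/eqP; rewrite -subr_eq0 -normr_le0; apply/ler_addgt0Pr => e e0.
  have ba1 : 0 < b - a + 1 by rewrite ltr_wpDl// subr_ge0.
  have := main (e / (b - a + 1)) (divr_gt0 e0 ba1); rewrite add0r.
  by rewrite -[X in _ <= _ + X]mulr1 -mulrDr divfK// lt0r_neq0.
move=> e0; have [d [d0 dP]] := integral_normr_continuous ip e0.
have [U [oU NU Ud]] : exists U : set R,
    [/\ open U, N `<=` U & (leb (U `\` N) < d%:E)%E].
  by apply: lebesgue_regularity_outer => //; rewrite N0.
have mU : measurable U by exact: open_measurable.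
have leU : (leb U < d%:E)%E.
  rewrite -(setDUK NU); apply: (@le_lt_trans _ _ (leb N + leb (U `\` N))%E).
    by apply: measureU2 => //; exact: measurableD.
  by rewrite [X in (X + _)%E]N0 add0e.
pose I (A : set R) := (\int[leb]_(r in A) (p r)%:E)%E.
have IE A : measurable A -> I A \is a fin_num.
  by move=> mA; apply: integrable_fin_num => //; exact: integrableS ip.
have Ile A B : measurable A -> measurable B -> A `<=` B -> (I A <= I B)%E.
  move=> mA mB AB; apply: ge0_subset_integral => //.
    by apply: mp.
  by move=> r _; rewrite lee_fin.
pose V t := U `&` `]a, t[%classic.
have mV t : measurable (V t) by exact: measurableI.
pose psi t := fine (I (V t)).
have psi0 t : 0 <= psi t by apply: fine_ge0; apply: integral_ge0 => r _; rewrite lee_fin.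
have psie t : psi t <= e.
  apply/ltW; rewrite -lte_fin fineK ?IE//.
  apply: (@le_lt_trans _ _ (I U)); first by apply: Ile => //; exact: subIsetl.
  have := dP U mU leU; rewrite /Rintegral -lte_fin fineK.
    by under eq_integral do rewrite ger0_norm//.
  by under eq_integral do rewrite ger0_norm//; exact: IE.
have psi_mono x y : x <= y -> psi x <= psi y.
  move=> xy; rewrite -lee_fin !fineK ?IE//; apply: Ile => //.
  apply: setIS => r /=; rewrite !in_itv/= => /andP[->] /lt_le_trans; exact.
have psi_incr x y : a <= x -> x <= y -> y <= b -> `]x, y[ `<=` U ->
    `|G y - G x| <= psi y - psi x.
  move=> ax xy yb xyU; rewrite -lee_fin; apply: le_trans (Gm x y _ xy _) _.
  - exact: lt_le_trans ax.
  - exact: le_lt_trans bT.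
  rewrite EFinB !fineK ?IE// leeBrDl ?IE//.
  rewrite (_ : (\int[leb]_(r in `]x, y[) (m r)%:E)%E = I `]x, y[%classic); last first.
    apply: eq_integral => r /set_mem/=; rewrite in_itv/= => /andP[xr ry].
    rewrite /p patchE mem_set//= in_itv/= (lt_trans _ xr) ?(lt_le_trans a0 ax)//.
    by rewrite (lt_trans ry) ?(le_lt_trans yb bT).
  rewrite -ge0_integral_setU//.
  - apply: Ile => //; first exact: measurableU.
    move=> r [[Ur /=]|/= xyr]; rewrite ?in_itv/=.
      by move=> /andP[ar rx]; split => //=; rewrite in_itv/= ar (lt_le_trans rx).
    split; [exact: xyU|]; move: xyr; rewrite /= !in_itv/= => /andP[xr ->].
    by rewrite (le_lt_trans ax).
  - exact: mV.
  - by apply: mp; apply: measurableU => //; exact: mV.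
  - by move=> r _; rewrite lee_fin.
  - apply/disj_setPS => r [[_ /=]]; rewrite !in_itv/= => /andP[_ rx] /andP[xr _].
    by move: (lt_trans rx xr); rewrite ltxx.
have := @increments_le G (fun t => e * t + psi t) a b ab.
rewrite opprD addrACA -mulrBr => main.
apply: le_trans (main _) _; last by rewrite lerD2l; have := psie b; have := psi0 a; lra.
move=> c /andP[ac cb]; have [Nc|nNc] := pselect (N c).
  have /nbhs_ballP[r /= r0 rU] : nbhs c U.
    by move: oU; rewrite openE => /(_ c (NU _ Nc)).
  exists r => // x y ax yb xyc xy yxr; rewrite opprD addrACA -mulrBr.
  apply: (@le_trans _ _ (psi y - psi x)); last first.
    by rewrite lerDr mulr_ge0 ?subr_ge0// ltW.
  apply: psi_incr => // s /=; rewrite in_itv/= => /andP[xs sy]; apply: rU.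
  rewrite -ball_normE /ball_/= ltr_norml; case: xyc => [<-|<-]; lra.
have cT : c \in `]0, T[ by rewrite in_itv/= (lt_le_trans a0)//= (le_lt_trans cb).
have /is_derive_bound/(_ _ e0)[r r0 rP] := dG c nNc cT.
exists r => // x y ax yb xyc xy yxr; rewrite opprD addrACA -mulrBr.
apply: (@le_trans _ _ (e * (y - x))); last first.
  by rewrite lerDl subr_ge0 psi_mono.
have yx0 : 0 <= y - x by rewrite subr_ge0.
case: xyc => [xc|yc].
  have := rP y; rewrite -xc ger0_norm// => /(_ yxr).
  by rewrite scaler0 subr0.
have := rP x; rewrite -yc -(normrN (x - y)) opprB ger0_norm// => /(_ yxr).
by rewrite scaler0 subr0 distrC.
Qed.

End AbsoluteContinuity.

(** * Piecewise cubic test functions *)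

Section WeakDerivative.
Context {R : realType}.
Local Notation leb := (@lebesgue_measure R).

Definition clamp01 (x : R) : R := Num.min (Num.max x 0) 1.

(** The cubic that joins 0 to 1 on [0, 1] with derivative 6 x (1 - x), which vanishes at both ends;
    hence the extension by constants is C^1. *)
Definition smoothstep (x : R) : R := 3 * clamp01 x ^+ 2 - 2 * clamp01 x ^+ 3.

Definition smoothstep' (x : R) : R := 6 * clamp01 x * (1 - clamp01 x).

Variant clamp01_spec (x : R) : R -> Type :=
| Clamp01Left of x <= 0 : clamp01_spec x 0
| Clamp01Mid of 0 <= x & x <= 1 : clamp01_spec x x
| Clamp01Right of 1 <= x : clamp01_spec x 1.

Lemma clamp01P x : clamp01_spec x (clamp01 x).
Proof.
rewrite /clamp01; have [x0|x0] := leP x 0.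
  by rewrite min_l//; exact: Clamp01Left.
have [x1|x1] := leP x 1; first by apply: Clamp01Mid => //; exact: ltW.
by apply: Clamp01Right; exact: ltW.
Qed.

(** On [0, 1] the second derivative 6 - 12 x is at most 6 in absolute value, whence the constant 3 =
    6 / 2. In each of the nine positions of [x] and [y] the inequality is a linear combination of
    the nonnegative products supplied. *)
Lemma smoothstep_taylor x y :
  `|smoothstep y - smoothstep x - smoothstep' x * (y - x)| <= 3 * (y - x) ^+ 2.
Proof.
have h := sqr_ge0 (y - x); have hx := sqr_ge0 x; have hy := sqr_ge0 y.
rewrite /smoothstep /smoothstep' ler_norml.
case: (clamp01P x) => [x0|x0 x1|x1]; case: (clamp01P y) => [y0|y0 y1|y1];
  apply/andP.
- by split; lra.
- have a1 : 0 <= y ^+ 2 * (1 - y) by rewrite mulr_ge0 ?subr_ge0.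
  have a2 : 0 <= y ^+ 2 * y by rewrite mulr_ge0.
  have a3 : 0 <= (- x) * (2 * y - x) by apply: mulr_ge0; lra.
  by split; lra.
- have a1 : 0 <= (y - 1) * (y + 1) by apply: mulr_ge0; lra.
  have a3 : 0 <= (- x) * (2 * y - x) by apply: mulr_ge0; lra.
  by split; lra.
- have a1 : 0 <= x * (1 - x) * (x - y) by rewrite !mulr_ge0//; lra.
  have a2 : 0 <= x ^+ 2 * x by rewrite mulr_ge0.
  have a3 : 0 <= x ^+ 2 * (- y) by rewrite mulr_ge0// oppr_ge0.
  have a4 : 0 <= x * (- y) by rewrite mulr_ge0// oppr_ge0.
  by split; lra.
- have a1 : 0 <= (y - x) ^+ 2 * x by rewrite mulr_ge0.
  have a2 : 0 <= (y - x) ^+ 2 * y by rewrite mulr_ge0.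
  have a3 : 0 <= (y - x) ^+ 2 * (1 - x) by rewrite mulr_ge0 ?subr_ge0.
  have a4 : 0 <= (y - x) ^+ 2 * (1 - y) by rewrite mulr_ge0 ?subr_ge0.
  by split; lra.
- have b1 := sqr_ge0 (1 - x); have b2 := sqr_ge0 (y - 1).
  have a1 : 0 <= x * (1 - x) * (y - x) by rewrite !mulr_ge0//; lra.
  have a2 : 0 <= (1 - x) ^+ 2 * (1 - x) by rewrite mulr_ge0 ?subr_ge0.
  have a3 : 0 <= (1 - x) ^+ 2 * (y - 1) by rewrite mulr_ge0 ?subr_ge0.
  have a4 : 0 <= (1 - x) * (y - 1) by rewrite mulr_ge0 ?subr_ge0.
  by split; lra.
- have a1 : 0 <= (x - 1) * (x + 1) by apply: mulr_ge0; lra.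
  have a3 : 0 <= (- y) * (2 * x - y) by apply: mulr_ge0; lra.
  by split; lra.
- have b1 := sqr_ge0 (1 - y).
  have a1 : 0 <= (1 - y) ^+ 2 * y by rewrite mulr_ge0.
  have a2 : 0 <= (1 - y) ^+ 2 * (1 - y) by rewrite mulr_ge0 ?subr_ge0.
  have a3 : 0 <= (x - 1) * (x + 1 - 2 * y) by apply: mulr_ge0; lra.
  by split; lra.
- by split; lra.
Qed.

Lemma smoothstep'_lipschitz x y :
  `|smoothstep' y - smoothstep' x| <= 6 * `|y - x|.
Proof.
rewrite /smoothstep' ler_norml; have [xy|yx] := leP x y.
  rewrite ger0_norm ?subr_ge0//.
  case: (clamp01P x) => [x0|x0 x1|x1]; case: (clamp01P y) => [y0|y0 y1|y1];
  apply/andP; split; nra.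
rewrite ltr0_norm ?subr_lt0//.
case: (clamp01P x) => [x0|x0 x1|x1]; case: (clamp01P y) => [y0|y0 y1|y1];
  apply/andP; split; nra.
Qed.

Section Step.
Variables a d : R.
Hypothesis d0 : 0 < d.

(** Rises from 0 at [a] to 1 at [a + d]. Its derivative [step_fun'] is a continuous probability
    density concentrated on that interval, so that averages against it approximate point values. *)
Definition step_fun (t : R) : R := smoothstep ((t - a) / d).
Definition step_fun' (t : R) : R := smoothstep' ((t - a) / d) / d.

Lemma step_fun_left t : t <= a -> step_fun t = 0.
Proof.
move=> ta; have : (t - a) / d <= 0 by rewrite ler_pdivrMr// mul0r subr_le0.
rewrite /step_fun /smoothstep; case: clamp01P => [_|x0 x1|x1] x2; [lra| |lra].
have -> : (t - a) / d = 0 by lra.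
lra.
Qed.

Lemma step_fun_right t : a + d <= t -> step_fun t = 1.
Proof.
move=> ta; have : 1 <= (t - a) / d by rewrite ler_pdivlMr// mul1r lerBrDl.
rewrite /step_fun /smoothstep; case: clamp01P => [x1|x0 x1|x1] x2; [lra| |lra].
have -> : (t - a) / d = 1 by lra.
lra.
Qed.

Lemma step_fun_ge0 t : 0 <= step_fun t.
Proof.
rewrite /step_fun /smoothstep; case: clamp01P => [_|x0 x1|_]; [lra| |lra].
set x := _ / d in x0 x1 *; have h := sqr_ge0 x.
have : 0 <= x ^+ 2 * (1 - x) by rewrite mulr_ge0 ?subr_ge0.
by lra.
Qed.

Lemma step_fun_le1 t : step_fun t <= 1.
Proof.
rewrite /step_fun /smoothstep; case: clamp01P => [_|x0 x1|_]; [lra| |lra].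
set x := _ / d in x0 x1 *; have h := sqr_ge0 (1 - x).
have : 0 <= (1 - x) ^+ 2 * x by rewrite mulr_ge0.
by lra.
Qed.

Lemma step_fun'_ge0 t : 0 <= step_fun' t.
Proof.
apply: divr_ge0; last exact: ltW.
rewrite /smoothstep'; case: clamp01P => [_|x0 x1|_]; [lra| |lra].
by apply: mulr_ge0; lra.
Qed.

Lemma step_fun'_out t : ~ (a < t < a + d) -> step_fun' t = 0.
Proof.
move=> /negP; rewrite negb_and -!leNgt => /orP[ta|at_].
  have : (t - a) / d <= 0 by rewrite ler_pdivrMr// mul0r subr_le0.
  rewrite /step_fun' /smoothstep'; case: clamp01P => [_ _|x0 x1 x2|x1 x2]; last by lra.
    by rewrite mulr0 mul0r mul0r.
  have -> : (t - a) / d = 0 by lra.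
  by rewrite mulr0 mul0r mul0r.
have : 1 <= (t - a) / d by rewrite ler_pdivlMr// mul1r lerBrDl.
rewrite /step_fun' /smoothstep'; case: clamp01P => [x0 x1|x0 x1 x2|x1 x2]; first by lra.
  have -> : (t - a) / d = 1 by lra.
  by rewrite subrr mulr0 mul0r.
by rewrite subrr mulr0 mul0r.
Qed.

Lemma is_derive_step_fun (t : R) : is_derive t (1 : R) step_fun (step_fun' t).
Proof.
apply: (@is_derive_bound R R^o _ _ _).2 => e e0.
(* After rescaling the remainder is at most [3 * (s - t) ^+ 2 / d ^+ 2], which this radius brings
   below [e] times the distance of [s] and [t]. *)
exists (e * d ^+ 2 / 3); first by rewrite !mulr_gt0// exprn_gt0.
move=> s std; rewrite /step_fun /step_fun'.
have := smoothstep_taylor ((t - a) / d) ((s - a) / d).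
have -> : (s - a) / d - (t - a) / d = (s - t) / d by rewrite -mulrBl opprB addrA subrK.
rewrite (_ : (s - t) *: (smoothstep' ((t - a) / d) / d : R^o) =
    smoothstep' ((t - a) / d) * ((s - t) / d)); last first.
  by rewrite /GRing.scale/=; ring.
move=> /le_trans; apply; rewrite expr_div_n mulrA ler_pdivrMr ?exprn_gt0//.
rewrite -(real_normK (num_real (s - t))).
have e1 : 3 * `|s - t| <= e * d ^+ 2 by move: std; rewrite ltr_pdivlMr// mulrC => /ltW.
have := ler_wpM2l (normr_ge0 (s - t)) e1; lra.
Qed.

Lemma continuous_step_fun' : continuous step_fun'.
Proof.
move=> t; apply: cvgMl; apply/cvgrPdist_lt => e e0; near=> s.
apply: le_lt_trans (smoothstep'_lipschitz _ _) _.
rewrite -mulrBl opprB addrA subrK normrM (@gtr0_norm _ d^-1) ?invr_gt0//.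
rewrite mulrA ltr_pdivrMr// mulrC -ltr_pdivlMr//.
by near: s; exists (e * d / 6) => //=; rewrite divr_gt0// mulr_gt0.
Unshelve. all: by end_near. Qed.

End Step.

Variable X : completeNormedModType R.

Lemma is_derive_scale (phi : R -> R) (dphi : R) (h : R -> X) (dh : X) (t : R) :
  is_derive t 1 phi dphi -> is_derive t 1 h dh ->
  is_derive t 1 (fun s => phi s *: h s) (dphi *: h t + phi t *: dh).
Proof.
move=> [dp pE] [dhh hE].
have cp : {for t, continuous phi}.
  by apply: differentiable_continuous; exact/derivable1_diffP.
have cv : k^-1 *: (phi (k *: (1 : R) + t) *: h (k *: (1 : R) + t) - phi t *: h t)
    @[k --> 0^'] --> dphi *: h t + phi t *: dh.
  have E k : k^-1 *: (phi (k *: (1 : R) + t) *: h (k *: (1 : R) + t) - phi t *: h t)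
    = (k^-1 *: (phi (k *: (1 : R) + t) - phi t)) *: h t +
       phi (k *: (1 : R) + t) *: (k^-1 *: (h (k *: (1 : R) + t) - h t)).
    move: (phi (_ + t)) (h (_ + t)) => p1 h1.
    rewrite -[k^-1 *: (p1 - phi t)]/(k^-1 * (p1 - phi t)) -scalerA.
    rewrite [p1 *: (_ *: _)]scalerA [p1 * _]mulrC -scalerA -scalerDr.
    by congr (_ *: _); rewrite scalerBl scalerBr [RHS]addrC addrA subrK.
  under eq_fun do rewrite E.
  apply: cvgD.
    by apply: cvgZl; rewrite -[X in _ --> X]pE; exact: dp.
  apply: cvgZ; last by rewrite -[X in _ --> X]hE; exact: dhh.
  have ct : k *: (1 : R) + t @[k --> (0 : R)^'] --> t.
    rewrite -[X in _ --> X]add0r -[X in X + _](scale0r (1 : R)).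
    apply: cvgD; last exact: cvg_cst.
    by apply: cvgZl; apply: cvg_within_filter; exact: cvg_id.
  exact: (cvg_comp _ _ ct cp).
by apply: DeriveDef; [apply/cvg_ex; exists (dphi *: h t + phi t *: dh)|exact: cvg_lim].
Qed.

End WeakDerivative.

(** * Classical and weak derivatives *)

Section WeakDerivativeTheory.
Context {R : realType}.
Local Notation leb := (@lebesgue_measure R).
Variable X : completeNormedModType R.
Implicit Types (h w : R -> X) (a b d e t T M : R).

Lemma sm_bounded_integrable T M h : sm_bounded T M h ->
  bochner_integrable leb `]0, T[ h.
Proof.
move=> hM; apply: eq_bochner_integrable (volterra_integrable volterra_one T hM).
move=> r /set_mem/=; rewrite in_itv/= => /andP[_ rT].
by rewrite power_kernel1 subr_gt0 rT scale1r.
Qed.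

Lemma derive0_constant (G : R -> X) a b : a <= b ->
  (forall t, a <= t <= b -> is_derive t 1 G 0) -> G a = G b.
Proof.
move=> ab dG; apply/esym/eqP; rewrite -subr_eq0 -normr_le0.
apply/ler_addgt0Pr => e e0; rewrite add0r.
have ba1 : 0 < b - a + 1 by rewrite ltr_wpDl// subr_ge0.
pose s := e / (b - a + 1); have s0 : 0 < s by rewrite divr_gt0.
apply: (@le_trans _ _ (s * b - s * a)); last first.
  by rewrite -mulrBr /s mulrAC ler_pdivrMr// ler_wpM2l ?ltW// ltrDl.
apply: (@increments_le _ _ G (fun t => s * t)) => // c cab.
have /is_derive_bound/(_ _ s0)[r r0 rP] := dG c cab.
exists r => // x y ax yb xyc xy yxr; rewrite -mulrBr.
have yx0 : 0 <= y - x by rewrite subr_ge0.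
case: xyc => [xc|yc].
  have := rP y; rewrite -xc ger0_norm// => /(_ yxr).
  by rewrite scaler0 subr0.
have := rP x; rewrite -yc -(normrN (x - y)) opprB ger0_norm// => /(_ yxr).
by rewrite scaler0 subr0 distrC.
Qed.

Lemma compact_support_sm_bounded T a b h : 0 < a -> b < T ->
  (forall t, 0 < t < T -> {for t, continuous h}) ->
  (forall t, t \notin `[a, b] -> h t = 0) ->
  exists2 M, 0 <= M & sm_bounded T M h.
Proof.
move=> a0 bT ch h0.
have [M M0 hM] : exists2 M, 0 <= M & forall r, a <= r <= b -> `|h r| <= M.
  apply: continuous_bounded_itv => r /andP[ar rb]; apply: ch.
  by rewrite (lt_le_trans a0)//= (le_lt_trans rb).
exists M => //; split.
  apply: strongly_measurable_continuous => // x /=; rewrite in_itv/=; exact: ch.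
move=> r _; have [rab|/h0 ->] := boolP (r \in `[a, b]); last by rewrite normr0.
by apply: hM; move: rab; rewrite in_itv.
Qed.

(** [P - H] has zero derivative inside []0, T[] only, so its constancy is used on [[n, T - n]], at
    whose ends [H] is already 0. The two remaining pieces of the integral contribute at most
    [3 * M * n]. *)
Lemma bochner_integral_derive_compact T a b (H H' : R -> X) :
  0 < T -> 0 < a -> b < T ->
  (forall t, 0 < t < T -> is_derive t 1 H (H' t)) ->
  (forall t, 0 < t < T -> {for t, continuous H'}) ->
  (forall t, t \notin `[a, b] -> H t = 0) ->
  (forall t, t \notin `[a, b] -> H' t = 0) ->
  bochner_integral leb `]0, T[ H' = 0.
Proof.
move=> T0 a0 bT dH cH' H0 H'0.
have [M M0 hM] := compact_support_sm_bounded a0 bT cH' H'0.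
pose P t := bochner_integral leb `]0, t[ H'.
apply/eqP; rewrite -[bochner_integral _ _ _]/(P T) -normr_le0.
apply/ler_addgt0Pr => e e0; rewrite add0r.
have M1 : 0 < 3 * M + 1 by rewrite ltr_wpDl// mulr_ge0.
(* In order: [n] lies before the support, [T - n] after it, [n <= T - n], and the error [3 * M * n]
   is at most [e]. *)
pose n := Num.min (Num.min (a / 2) ((T - b) / 2)) (Num.min (T / 2) (e / (3 * M + 1))).
have n0 : 0 < n by rewrite !lt_min !divr_gt0// subr_gt0.
have na : n <= a / 2 by rewrite !ge_min lexx.
have nb : n <= (T - b) / 2 by rewrite !ge_min lexx orbT.
have nT : n <= T / 2 by rewrite !ge_min lexx !orbT.
have ne : n <= e / (3 * M + 1) by rewrite !ge_min lexx !orbT.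
have dG t : n <= t <= T - n -> is_derive t 1 (P - H) 0.
  move=> tn; rewrite -(subrr (H' t)); have tT : 0 < t < T by lra.
  by apply: is_deriveB; [apply: (is_derive_primitive M0 tT hM); exact: cH'|exact: dH].
have nTn : n <= T - n by lra.
have := derive0_constant nTn dG.
rewrite -[(P - H) n]/(P n - H n) -[(P - H) (T - n)]/(P (T - n) - H (T - n)).
rewrite !H0 ?subr0 ?in_itv/= ?negb_and -?ltNge; last 2 first.
- by apply/orP; right; lra.
- by apply/orP; left; lra.
move=> Pn.
have Pn1 : `|P n| <= M * n.
  rewrite /P primitiveE -[n in leRHS](power_primitive1 (ltW n0)).
  have nT' : n <= T by lra.
  exact: (volterra_norm volterra_one M0 (sm_bounded_le nT' hM)).
have Tn : T - n <= T by lra.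
have Pn2 : `|P T - P (T - n)| <= 2 * M * n.
  rewrite /P !primitiveE -[n in leRHS](power_primitive1 (ltW n0)).
  have := volterra_modulusT volterra_one M0 Tn (lexx T) hM.
  by rewrite (_ : T - (T - n) = n)// opprB addrC subrK.
rewrite -(subrK (P (T - n)) (P T)); apply: le_trans (ler_normD _ _) _.
rewrite Pn in Pn1; apply: (@le_trans _ _ ((3 * M + 1) * n)); last first.
  by rewrite mulrC -ler_pdivlMr.
by have := mulr_ge0 M0 (ltW n0); lra.
Qed.

(** Integration by parts: [phi t *: h t] has compact support in []0, T[], so its derivative has
    integral 0. The assumptions concern the open interval, so [w] may blow up at 0, as the kernel
    [g (1 - alpha)] does. *)
Lemma weak_derivative_classical T h w : 0 < T ->
  (forall t, 0 < t < T -> is_derive t 1 h (w t)) ->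
  (forall t, 0 < t < T -> {for t, continuous w}) -> weak_derivative T h w.
Proof.
move=> T0 dh cw phi [dphi cphi' [a [b [a0 bT phi0]]]].
have ch t : 0 < t < T -> {for t, continuous h}.
  move=> /dh [dht _]; apply: differentiable_continuous; exact/derivable1_diffP.
have cphi t : {for t, continuous phi}.
  by apply: differentiable_continuous; exact/derivable1_diffP.
have phi'0 t : t \notin `[a, b] -> derive1 phi t = 0.
  move=> tab; rewrite derive1E -(derive_cst (0 : R) t (1 : R)); apply: near_eq_derive.
  move: tab; rewrite in_itv/= negb_and -!ltNge => /orP[ta|bt].
    near=> s; apply: phi0; rewrite in_itv/= negb_and -!ltNge; apply/orP; left.
    by near: s; exact: lt_nbhsl.
  near=> s; apply: phi0; rewrite in_itv/= negb_and -!ltNge; apply/orP; right.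
  by near: s; exact: lt_nbhsr.
have s1 : exists2 M, 0 <= M & sm_bounded T M (fun t => derive1 phi t *: h t).
  apply: (compact_support_sm_bounded a0 bT) => t tT; last by rewrite phi'0// scale0r.
  by apply: cvgZ; [exact: cphi'|exact: ch].
have s2 : exists2 M, 0 <= M & sm_bounded T M (fun t => phi t *: w t).
  apply: (compact_support_sm_bounded a0 bT) => t tT; last by rewrite phi0// scale0r.
  by apply: cvgZ; [exact: cphi|exact: cw].
have [M1 _ /sm_bounded_integrable i1] := s1.
have [M2 _ /sm_bounded_integrable i2] := s2.
apply/eqP; rewrite -addr_eq0.
rewrite -(bochner_integralD (mu := leb) _ (lebesgue_measure_oo_lty 0 T) i1 i2).2//.
apply/eqP/(@bochner_integral_derive_compact T a b (fun t => phi t *: h t)) => //.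
- move=> t tT; apply: is_derive_scale; last exact: dh.
  by rewrite derive1E; apply: DeriveDef => //; exact: dphi.
- move=> t tT; apply: cvgD; apply: cvgZ.
  + exact: cphi'.
  + exact: ch.
  + exact: cphi.
  + exact: cw.
- by move=> t tab; rewrite phi0// scale0r.
- by move=> t tab; rewrite phi0// phi'0// !scale0r addr0.
Unshelve. all: by end_near. Qed.

Lemma integrable_step_fun' T a d : 0 < d -> 0 < a -> a + d < T ->
  leb.-integrable `]0, T[ (EFin \o step_fun' a d) /\
  \int[leb]_(t in `]0, T[) step_fun' a d t = 1.
Proof.
move=> d0 a0 adT; have T0 : 0 < T by lra.
have I : (\int[leb]_(t in `]0%R, T[) (step_fun' a d t)%:E = 1%:E)%E.
  transitivity ((step_fun a d T - step_fun a d 0)%:E).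
    apply: (ge0_FTC2_oo T0).
    - by move=> x _; exact: step_fun'_ge0.
    - by move=> x _; exact: continuous_step_fun'.
    - by move=> x _; exact: is_derive_step_fun.
    - apply: cvg_at_right_filter; apply: differentiable_continuous.
      by apply/derivable1_diffP; have [] := is_derive_step_fun a d0 0.
    - apply: cvg_at_left_filter; apply: differentiable_continuous.
      by apply/derivable1_diffP; have [] := is_derive_step_fun a d0 T.
  by rewrite step_fun_right ?step_fun_left ?subr0// ltW.
split; last by rewrite /Rintegral I.
apply/integrableP; split.
  apply/measurable_EFinP; apply: measurable_funTS.
  by apply: continuous_measurable_fun; exact: continuous_step_fun'.
under eq_integral do rewrite /= ger0_norm ?step_fun'_ge0//.
by rewrite I ltry.
Qed.

Lemma mollification T a d e h v : 0 < d -> 0 < a -> a + d < T -> 0 <= e ->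
  continuous h -> (forall r, a <= r <= a + d -> `|h r - v| <= e) ->
  bochner_integrable leb `]0, T[ (fun t => step_fun' a d t *: h t) /\
  `|bochner_integral leb `]0, T[ (fun t => step_fun' a d t *: h t) - v| <= e.
Proof.
move=> d0 a0 adT e0 ch hv.
have [is' Is'] := integrable_step_fun' d0 a0 adT.
have [ci cE] := bochner_integral_cst_vec (mu := leb) (measurable_itv _)
  (lebesgue_measure_oo_lty 0 T) v is'.
have [M M0 hM] : exists2 M, 0 <= M & sm_bounded T M (fun t => step_fun' a d t *: h t).
  apply: (compact_support_sm_bounded a0 adT) => [t _|t].
    by apply: cvgZ; [exact: continuous_step_fun'|exact: ch].
  rewrite in_itv/= negb_and -!ltNge => tad.
  rewrite step_fun'_out ?scale0r// => /andP[at_ tad'].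
  by case/orP: tad; [rewrite ltNge (ltW at_)|rewrite ltNge (ltW tad')].
have hi := sm_bounded_integrable hM; split => //.
rewrite -[v in X in X <= _]scale1r -Is' -cE.
rewrite -(bochner_integralB (mu := leb) _ (lebesgue_measure_oo_lty 0 T) hi ci).2//.
rewrite -lee_fin.
have ei : leb.-integrable `]0, T[ (EFin \o (fun t => e * step_fun' a d t)).
  exact: eq_integrable (integrableZl (mu := leb) (measurable_itv _) e is').
apply: le_trans (bochner_integral_norm (mu := leb) _ (lebesgue_measure_oo_lty 0 T) _ ei _ _) _ => //.
- exact: (bochner_integralB (mu := leb) _ (lebesgue_measure_oo_lty 0 T) hi ci).1.
- by move=> t _; rewrite mulr_ge0// step_fun'_ge0.
- apply: aeW => t _; rewrite -scalerBr normrZ ger0_norm ?step_fun'_ge0// mulrC.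
  have [tad|/(step_fun'_out d0) ->] := pselect (a < t < a + d); last by rewrite !mulr0.
  rewrite ler_wpM2r ?step_fun'_ge0//; apply: hv.
  by case/andP: tad => ? ?; rewrite !ltW.
rewrite [leLHS](_ : _ = (\int[leb]_(t in `]0, T[) (e * step_fun' a d t))%:E).
  by rewrite RintegralZl// Is' mulr1.
by rewrite /Rintegral fineK//; apply: integrable_fin_num.
Qed.

(* The test functions approximate the indicator function of [x, y]. *)
Lemma weak_derivative_increment T h w (m : R -> R) x y : continuous h ->
  bochner_integrable leb `]0, T[ w ->
  (forall r, 0 <= m r) -> leb.-integrable `]0, T[ (EFin \o m) ->
  {ae leb, forall r, `]0, T[%classic r -> `|w r| <= m r} ->
  weak_derivative T h w -> 0 < x -> x <= y -> y < T ->
  (`|h y - h x|%:E <= \int[leb]_(r in `]x, y[) (m r)%:E)%E.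
Proof.
move=> ch wi m0 im wm dw x0; rewrite le_eqVlt => /orP[/eqP <- _|xy yT].
  by rewrite subrr normr0 integral_ge0// => r _; rewrite lee_fin.
apply/lee_addgt0Pr => e0_ e00; pose e := e0_ / 2.
have e0 : 0 < e by rewrite divr_gt0.
have /cvgrPdist_le/(_ _ e0)[d1 /= d10 d1P] := ch x.
have /cvgrPdist_le/(_ _ e0)[d2 /= d20 d2P] := ch y.
(* The last term makes [phi] finish rising at [x + d] no later than it begins to fall at [y - d];
   the others keep [h] close to [h x] and to [h y] on these two ramps. *)
pose d := Num.min (d1 / 2) (Num.min (d2 / 2) ((y - x) / 2)).
have d0 : 0 < d by rewrite !lt_min !divr_gt0// subr_gt0.
have dd1 : d <= d1 / 2 by rewrite ge_min lexx.
have dd2 : d <= d2 / 2 by rewrite !ge_min lexx orbT.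
have dxy : d <= (y - x) / 2 by rewrite !ge_min lexx !orbT.
have xdT : x + d < T by lra.
have yd0 : 0 < y - d by lra.
have ydT : y - d + d < T by lra.
have hx r : x <= r <= x + d -> `|h r - h x| <= e.
  move=> /andP[xr rx]; rewrite distrC; apply: d1P; rewrite /ball_/= distrC.
  rewrite ger0_norm ?subr_ge0//; lra.
have hy r : y - d <= r <= y - d + d -> `|h r - h y| <= e.
  move=> /andP[yr ry]; rewrite distrC; apply: d2P; rewrite /ball_/= ger0_norm; lra.
have [i1 B1] := mollification d0 x0 xdT (ltW e0) ch hx.
have [i2 B2] := mollification d0 yd0 ydT (ltW e0) ch hy.
pose phi t := step_fun x d t - step_fun (y - d) d t.
have dphi (t : R) : is_derive t (1 : R) phi (step_fun' x d t - step_fun' (y - d) d t).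
  exact: is_deriveB (is_derive_step_fun x d0 t) (is_derive_step_fun (y - d) d0 t).
have phiE : derive1 phi = fun t => step_fun' x d t - step_fun' (y - d) d t.
  by apply/funext => t; rewrite derive1E; have [] := dphi t.
have phi_out t : ~ (x < t < y) -> phi t = 0.
  move=> /negP; rewrite negb_and -!leNgt => /orP[tx|yt].
    by rewrite /phi !step_fun_left ?subrr//; lra.
  by rewrite /phi !step_fun_right ?subrr//; lra.
have cphi : C1c T phi.
  split.
  - by move=> t; have [] := dphi t.
  - rewrite phiE => t; apply: cvgB; exact: continuous_step_fun'.
  - exists x, y; split => // t; rewrite in_itv/= => txy; apply: phi_out.
    by move=> /andP[xt ty]; move: txy; rewrite (ltW xt) (ltW ty).
have phi1 t : `|phi t| <= 1.
  have := step_fun_ge0 x d t; have := step_fun_le1 x d t.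
  have := step_fun_ge0 (y - d) d t; have := step_fun_le1 (y - d) d t.
  by rewrite ler_norml /phi => *; apply/andP; split; lra.
have := dw _ cphi; rewrite phiE.
have -> : bochner_integral leb `]0, T[
    (fun t => (step_fun' x d t - step_fun' (y - d) d t) *: h t) =
  bochner_integral leb `]0, T[
    (fun t => step_fun' x d t *: h t - step_fun' (y - d) d t *: h t).
  by apply: eq_bochner_integral => t _; rewrite scalerBl.
rewrite (bochner_integralB (mu := leb) _ (lebesgue_measure_oo_lty 0 T) i1 i2).2//.
set I1 := bochner_integral _ _ _ in B1 *; set I2 := bochner_integral _ _ _ in B2 *.
set I3 := bochner_integral _ _ _ => I123.
have I3le : (`|I3|%:E <= \int[leb]_(r in `]x, y[) (m r)%:E)%E.
  have sub : `]x, y[ `<=` `]0, T[.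
    by move=> r /=; rewrite !in_itv/= => /andP[xr ry]; rewrite (lt_trans x0)//= (lt_trans ry).
  have sphi : strongly_measurable leb `]0, T[ (fun t => phi t *: w t).
    apply: strongly_measurableZ; last exact: (bochner_integrable_strongly_measurable
      (mu := leb) _ (lebesgue_measure_oo_lty 0 T)).
    apply: strongly_measurable_continuous => // t _.
    by apply: differentiable_continuous; apply/derivable1_diffP; have [] := dphi t.
  have wphi : {ae leb, forall r, `]0, T[%classic r -> `|phi r *: w r| <= (m \_ `]x, y[) r}.
    apply: (@filterS _ _ (ae_filter_ringOfSetsType (@lebesgue_measure R)) _ _ _ wm).
    move=> r {}wm rT; rewrite patchE normrZ; case: ifPn => [_|].
      by apply: le_trans (wm rT); rewrite ler_piMl.
    by rewrite notin_setE/= in_itv/= => /phi_out ->; rewrite normr0 mul0r.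
  have ip : leb.-integrable `]0, T[ (EFin \o m \_ `]x, y[).
    apply: (le_integrable (mu := leb) (measurable_itv _) (g := EFin \o m)) => //.
    - rewrite -restrict_EFin; apply: (measurable_restrict _ _ _).1 => //.
      by apply: measurable_funS (measurable_int _ im) => //; exact: subIsetl.
    - by move=> r _; rewrite lee_fin patchE; case: ifP => // _; rewrite normr0.
  have := bochner_integral_norm (mu := leb) _ (lebesgue_measure_oo_lty 0 T) _ ip _ wphi.
  rewrite (_ : (\int[leb]_(r in `]0%R, T[) ((m \_ `]x, y[) r)%:E)%E =
      (\int[leb]_(r in `]x, y[) (m r)%:E)%E); last first.
    rewrite -[in RHS](setIidr sub) integral_mkcondr; apply: eq_integral => r _.
    by rewrite !patchE; case: ifP.
  apply => //; last by move=> r _; rewrite patchE; case: ifP.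
  by apply: (bochner_integrable_dominated (mu := leb) _ (lebesgue_measure_oo_lty 0 T) sphi ip).
apply: (@le_trans _ _ (`|I3|%:E + e0_%:E)%E); last exact: leeD.
rewrite -EFinD lee_fin.
have aux (p q r : X) : p - q = - r -> h y - h x = - (q - h y) + (p - h x) + r.
  by move=> pq; rewrite -[r]opprK -pq !opprB -addrA [p - h x + _]addrC !subrKA.
rewrite (aux _ _ _ I123).
apply: le_trans (ler_normD _ _) _; rewrite addrC lerD2l.
apply: le_trans (ler_normD _ _) _; rewrite normrN.
by rewrite [e0_]splitr; apply: lerD.
Qed.

End WeakDerivativeTheory.

(** * The integral equation *)

Section Limits.
Context {R : realType}.

Lemma geometric_lt (C e : R) : 0 <= C -> 0 < e -> exists n : nat, C / 2 ^+ n < e.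
Proof.
move=> C0 e0; have Ce : 0 <= C / e by rewrite divr_ge0// ltW.
exists (Num.bound (C / e)); rewrite ltr_pdivrMr ?exprn_gt0//.
rewrite mulrC -ltr_pdivrMr//; apply: lt_trans (archi_boundP Ce) _.
by rewrite -natrX ltr_nat ltn_expl.
Qed.

Lemma le_geometric_le (x y C : R) : 0 <= C -> (forall n : nat, x <= y + C / 2 ^+ n) ->
  x <= y.
Proof.
move=> C0 xy; apply/ler_addgt0Pr => e e0; have [n Cn] := geometric_lt C0 e0.
by apply: le_trans (xy n) _; rewrite lerD2l ltW.
Qed.

(** Telescoping against [2 * C / 2 ^+ n]. The Picard iteration is carried out pointwise in time; the
    explicit rate is what makes its convergence uniform. *)
Lemma geometric_limit (X : completeNormedModType R) (a : nat -> X) (C : R) : 0 <= C ->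
  (forall n, `|a n.+1 - a n| <= C / 2 ^+ n) ->
  exists l, forall n, `|l - a n| <= 2 * C / 2 ^+ n.
Proof.
move=> C0 aC.
have dist n k : `|a (n + k)%N - a n| <= 2 * C / 2 ^+ n - 2 * C / 2 ^+ (n + k).
  elim: k => [|k IH]; first by rewrite addn0 !subrr normr0.
  rewrite addnS -(subrK (a (n + k)%N) (a (n + k).+1)) -addrA.
  apply: le_trans (ler_normD _ _) _; have := aC (n + k)%N; move: IH.
  rewrite exprS invfM; lra.
have dist2 n m : (n <= m)%N -> `|a m - a n| <= 2 * C / 2 ^+ n.
  move=> nm; have := dist n (m - n)%N; rewrite subnKC// => /le_trans; apply.
  by rewrite gerBl divr_ge0 ?mulr_ge0// exprn_ge0.
have C2 : 0 <= 2 * C by rewrite mulr_ge0.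
have /cvg_ex[l al] : cvg (a n @[n --> \oo]).
  apply/cauchy_cvgP/cauchy_exP => e e0; have [N NP] := geometric_lt C2 e0.
  exists (a N); exists N => // n /= Nn; rewrite -ball_normE /ball_/= distrC.
  by apply: le_lt_trans NP; exact: dist2.
exists l => n.
have nal : `|a m - a n| @[m --> \oo] --> `|l - a n|.
  by apply: cvg_norm; apply: cvgB => //; exact: cvg_cst.
by apply: (cvgr_to_le nal); exists n => // m /=; exact: dist2.
Qed.

Lemma continuous_left_eq0 (X : normedModType R) (z : R -> X) (a c : R) : a < c ->
  continuous z -> (forall t, a <= t < c -> z t = 0) -> z c = 0.
Proof.
move=> ac cz z0; apply/eqP; rewrite -normr_le0; apply/ler_addgt0Pr => e e0; rewrite add0r.
have /cvgrPdist_le/(_ _ e0)[d /= d0 dP] := cz c.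
pose s := Num.max a (c - d / 2).
have sc : s < c by rewrite gt_max ac; lra.
have sa : a <= s by rewrite le_max lexx.
have sd : c - d / 2 <= s by rewrite le_max lexx orbT.
have := dP s; rewrite /ball_/= ger0_norm ?subr_ge0 ?(ltW sc)//.
by rewrite (z0 s) ?sa// subr0; apply; lra.
Qed.

Lemma clamp_continuous (a b : R) : continuous (fun t : R => Num.min (Num.max t a) b).
Proof.
move=> t; have cm : Num.max s a @[s --> t] --> Num.max t a.
  exact: (cvg_comp _ _ (cvg_pair (@cvg_id _ (nbhs t)) (cvg_cst a))
    (@max_continuous _ R (t, a))).
exact: (cvg_comp _ _ (cvg_pair cm (cvg_cst b)) (@min_continuous _ R (Num.max t a, b))).
Qed.

End Limits.

(** * Equivalence of the Cauchy problem with the integral equation *)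

Section IntegralEquation.
Context {R : realType} {X : completeNormedModType R}.
Local Notation leb := (@lebesgue_measure R).
Variables (alpha : R) (f : R * X -> X) (u0 : X).
Hypotheses (alpha01 : 0 < alpha < 1)
  (cf : {within [set p : R * X | 0 <= p.1], continuous f}).
Implicit Types (u v : R -> X) (tau t s : R).
Opaque Gamma powR bochner_integral.

Let beta := 1 - alpha.
Let alpha0 : 0 < alpha. Proof. by case/andP: alpha01. Qed.
Let beta0 : 0 < beta. Proof. by rewrite subr_gt0; case/andP: alpha01. Qed.
Let beta01 : 0 < beta < 1.
Proof. by rewrite beta0 /= /beta ltrBlDr ltrDl. Qed.
Let ab1 : alpha + beta = 1. Proof. by rewrite /beta addrC subrK. Qed.
Let ba1 : beta + alpha = 1. Proof. by rewrite /beta subrK. Qed.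
Let kalpha := volterra_fractional alpha01.
Let kbeta := volterra_fractional beta01.

(* [f] is unconstrained at negative times. *)
Definition rhs u (t : R) : X := f (Num.max t 0, u t).

Lemma continuous_ext_f : continuous (fun p : R * X => f (Num.max p.1 0, p.2)).
Proof.
move=> p; pose q (p : R * X) := (Num.max p.1 0, p.2).
have c1 : (fun x : R * X => x.1) x @[x --> p] --> p.1 by exact: cvg_fst.
have cm : Num.max x.1 0 @[x --> p] --> Num.max p.1 0.
  exact: (cvg_comp _ _ (cvg_pair c1 (cvg_cst (0 : R))) (@max_continuous _ R (p.1, 0))).
have c2 : (fun x : R * X => x.2) x @[x --> p] --> p.2 by exact: cvg_snd.
have cq (S : set (R * X)) : nbhs (q p) S -> \forall x \near p, S (q x).
  exact: (cvg_pair cm c2).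
have qA x : 0 <= (q x).1 by rewrite /= le_max lexx orbT.
have /subspace_continuousP/(_ (q p) (qA p)) cfq := cf.
by move=> A /cfq /cq; apply: filterS => x /(_ (qA x)).
Qed.

Lemma continuous_rhs u : continuous u -> continuous (rhs u).
Proof.
move=> cu t; have cq (S : set (R * X)) : nbhs (t, u t) S -> \forall s \near t, S (s, u s).
  exact: (cvg_pair (@cvg_id _ (nbhs t)) (cu t)).
by move=> A /(@continuous_ext_f (t, u t)) /cq.
Qed.

Lemma rhsE u t : 0 <= t -> rhs u t = f (t, u t).
Proof. by move=> t0; rewrite /rhs max_l. Qed.

(** Continuity is asked on the whole line, to which a function given on an interval is extended by
    clamping time. The case [tau = 0] is meaningful: the constant [u0] is a solution there, from
    which local existence starts. *)
Definition integral_solution tau u := continuous u /\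
  forall t, 0 <= t <= tau -> u t = u0 + J alpha (rhs u) t.

Lemma integral_solution0 tau u : 0 <= tau -> integral_solution tau u -> u 0 = u0.
Proof.
move=> tau0 [_ ->]; last by rewrite lexx.
by rewrite -[J _ _ _]/(volterra _ _ _) volterra_nonpos// addr0.
Qed.

Lemma integral_solution_le tau tau' u : tau <= tau' ->
  integral_solution tau' u -> integral_solution tau u.
Proof.
move=> tt [cu uE]; split => // t /andP[t0 tt']; apply: uE.
by rewrite t0 (le_trans tt').
Qed.

Lemma locally_sm_bounded_continuous u : continuous u -> locally_sm_bounded u.
Proof. by move=> cu T; exact: continuous_sm_bounded. Qed.

Lemma J_cst t (v : X) : J beta (cst v) t = fractional_primitive beta t *: v.
Proof.
have := volterra_step t v kbeta (lexx 0); rewrite subr0 => <-.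
by apply: eq_volterra => r /andP[r0 _]; rewrite r0 scale1r.
Qed.

Lemma is_derive_fractional_primitive t : 0 < t ->
  is_derive t (1 : R) (fractional_primitive beta) (g beta t).
Proof.
move=> t0; have G0 := Gamma_gt0 beta01.
have dp := @is_derive_power_primitive R beta _ t0.
rewrite (_ : fractional_primitive beta =
    (beta * Gamma beta)^-1 \*: (power_primitive beta : R -> R^o)).
  rewrite (_ : g beta t = (beta * Gamma beta)^-1 *: (beta * power_kernel beta t : R^o)).
    exact: is_deriveZ.
  rewrite /g /power_kernel t0 /GRing.scale/= invfM mulrACA mulVf ?lt0r_neq0//.
  by rewrite mul1r mulrC.
by apply/funext => s; rewrite /fractional_primitive mulrC.
Qed.

Lemma continuous_g t : 0 < t -> {for t, continuous (g beta)}.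
Proof.
move=> t0; rewrite (_ : g beta = fun s => power_kernel beta s / Gamma beta).
  by apply: cvgMl; exact: continuous_power_kernel.
by apply/funext => s; rewrite /g /power_kernel; case: ifP; rewrite ?mul0r.
Qed.

Lemma integral_g x y : x <= y ->
  (\int[leb]_(r in `]x, y[) (g beta r)%:E =
  (fractional_primitive beta y - fractional_primitive beta x)%:E)%E.
Proof.
move=> xy; have G0 := Gamma_gt0 beta01.
transitivity (\int[leb]_(r in `]x, y[) ((Gamma beta)^-1%:E * (power_kernel beta r)%:E))%E.
  apply: eq_integral => r _; rewrite -EFinM /g /power_kernel.
  by case: ifP => _; [rewrite mulrC|rewrite mulr0].
rewrite ge0_integralZl_EFin//.
- rewrite integral_power_kernel// -EFinM; congr EFin.
  by rewrite /fractional_primitive mulrC -mulrA -invfM mulrBl.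
- by move=> r _; rewrite lee_fin power_kernel_ge0.
- by apply/measurable_EFinP/measurable_funTS; exact: measurable_power_kernel.
- by rewrite invr_ge0 ltW.
Qed.

Lemma integrable_g x y : x <= y -> leb.-integrable `]x, y[ (EFin \o g beta).
Proof.
move=> xy; apply/integrableP; split.
  by apply/measurable_EFinP/measurable_funTS; exact: (volterra_kernel_measurable kbeta).
under eq_integral do rewrite /= ger0_norm ?(volterra_kernel_ge0 kbeta)//.
by rewrite integral_g// ltry.
Qed.

(** Links the two functions in [caputo_derivative]: the W^{1,1} condition concerns [J beta u], the
    derivative almost everywhere concerns the fractional integral of [u - u 0]. *)
Lemma J_subK u t : continuous u ->
  J beta u t = J beta (fun r => u r - u0) t + fractional_primitive beta t *: u0.
Proof.
move=> cu; have lu := locally_sm_bounded_continuous cu.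
have lc : locally_sm_bounded (cst u0).
  by apply: locally_sm_bounded_continuous => x; exact: cvg_cst.
have -> : J beta (fun r => u r - u0) t = J beta u t - J beta (cst u0) t.
  exact: (volterra_locallyB t kbeta lu lc).
by rewrite J_cst subrK.
Qed.

Lemma integral_solution_J tau v t : integral_solution tau v -> t <= tau ->
  J beta (fun r => v r - u0) t = bochner_integral leb `]0, t[ (rhs v).
Proof.
move=> [cv vE] ttau; rewrite -(J_semigroup beta0 alpha0 ba1 t (continuous_rhs cv)).
apply: eq_volterra => r /andP[r0 rt].
by rewrite vE ?(ltW r0) ?(le_trans (ltW rt) ttau)// addrC addKr.
Qed.

Lemma local_solution_integral_solution tau u v : 0 < tau ->
  integral_solution tau v -> (forall t, 0 <= t <= tau -> u t = v t) ->
  local_solution alpha f u0 tau u.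
Proof.
move=> tau0 sv uv; have [cv vE] := sv.
have u0E : u 0 = u0.
  by rewrite uv ?lexx ?ltW//; exact: integral_solution0 (ltW tau0) sv.
have cw := continuous_rhs cv.
have inE_ t : t \in `[0, tau] -> 0 <= t <= tau by rewrite in_itv.
have Juv t : t <= tau -> J beta u t = J beta v t.
  move=> ttau; apply: eq_volterra => r /andP[r0 rt].
  by rewrite uv// (ltW r0) (le_trans (ltW rt)).
have Juv0 t : t <= tau -> J beta (fun r => u r - u 0) t = J beta (fun r => v r - u0) t.
  move=> ttau; apply: eq_volterra => r /andP[r0 rt].
  by rewrite u0E uv// (ltW r0) (le_trans (ltW rt)).
have cuw : {within `[0, tau], continuous u}.
  apply: (@subspace_eq_continuous _ _ _ v); last exact: continuous_subspaceT.
  by move=> t; rewrite inE/= => /inE_ /uv.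
have [M M0 wM] := continuous_sm_bounded cw tau.
(* The weak derivative of [J beta v]: the first term differentiates the contribution of the initial
   value and is integrable although unbounded near 0; the second is the derivative of
   [J beta (v - u0)]. *)
pose w' t := g beta t *: u0 + rhs v t.
split=> //; exists (fun t => f (t, u t)); last by [].
split.
  apply: (@subspace_eq_continuous _ _ _ (rhs v)); last exact: continuous_subspaceT.
  move=> t; rewrite inE/= => /inE_ t01; have /andP[t0 _] := t01.
  by rewrite (rhsE _ t0) -uv.
split=> //.
- have cJ := volterra_continuous kbeta (locally_sm_bounded_continuous cv).
  have inE2 t : t \in `]0, tau[%classic -> t <= tau.
    by rewrite inE/= in_itv/= => /andP[_ /ltW].
  split.
    apply: (eq_bochner_integrable (mu := leb) (f := J beta v)).
      by move=> t /inE2 ttau; exact: esym (Juv t ttau).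
    have [M' _ JM] := continuous_sm_bounded cJ tau.
    exact: sm_bounded_integrable JM.
  exists w'.
    have := bochner_integral_cst_vec (mu := leb) (measurable_itv _)
      (lebesgue_measure_oo_lty 0 tau) u0 (integrable_g (ltW tau0)).
    move=> [gi _].
    exact: (bochner_integralD (mu := leb) (measurable_itv _)
      (lebesgue_measure_oo_lty 0 tau) gi (sm_bounded_integrable wM)).1.
  have wd : weak_derivative tau (J beta v) w'.
    apply: weak_derivative_classical => // t /andP[t0 ttau].
      apply: (@near_eq_is_derive _ _ _ (fun s =>
        fractional_primitive beta s *: u0 + bochner_integral leb `]0, s[ (rhs v))).
        near=> s; rewrite (J_subK s cv) [RHS]addrC; congr (_ + _).
        apply/esym/(integral_solution_J sv); apply: ltW; near: s; exact: lt_nbhsl.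
      apply: is_deriveD.
        have := is_derive_scale (is_derive_fractional_primitive t0) (is_derive_cst u0 t (1 : R)).
        by rewrite scaler0 addr0.
      by apply: (is_derive_primitive M0 _ wM); [rewrite t0|exact: cw].
    apply: cvgD; last exact: cw.
    by apply: cvgZl; exact: continuous_g.
  move=> phi phiC; rewrite -(wd _ phiC); apply: eq_bochner_integral => t /inE2 ttau.
  by rewrite (Juv t ttau).
- apply: aeW => t; rewrite in_itv/= => /andP[t0 ttau].
  apply: (@near_eq_is_derive _ _ _ (fun s => bochner_integral leb `]0, s[ (rhs v))).
    near=> s; have stau : s <= tau by apply: ltW; near: s; exact: lt_nbhsl.
    by rewrite (Juv0 s stau); apply/esym/(integral_solution_J sv).
  rewrite uv ?(ltW t0) ?(ltW ttau)// -rhsE ?ltW//.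
  by apply: (is_derive_primitive M0 _ wM); [rewrite t0|exact: cw].
Unshelve. all: by end_near. Qed.

Lemma primitive_eq0 (z : R -> X) tau : continuous z ->
  (forall t, t <= tau -> bochner_integral leb `]0, t[ z = 0) ->
  forall t, 0 < t <= tau -> z t = 0.
Proof.
move=> cz z0; have main t : 0 < t < tau -> z t = 0.
  move=> /andP[t0 ttau]; have tT : 0 < t < tau by rewrite t0.
  have [M M0 zM] := continuous_sm_bounded cz tau.
  have [_ <-] := is_derive_primitive M0 tT zM (cz t).
  rewrite -(derive_cst (0 : X) t (1 : R)); apply: near_eq_derive.
  near=> s; apply: z0; apply: ltW; near: s; exact: lt_nbhsl.
move=> t /andP[t0]; rewrite le_eqVlt => /orP[/eqP tE|tt]; last by apply: main; rewrite t0.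
rewrite tE in t0 *.
have tau2 : tau / 2 < tau by lra.
apply: (continuous_left_eq0 tau2 cz) => s /andP[s2 st]; apply: main; apply/andP; split; lra.
Unshelve. all: by end_near. Qed.

(* [J beta (v - u0)] minus the primitive of [rhs v] has zero derivative almost
   everywhere and its increments are bounded by integrals, hence it vanishes. Thus
   [y = v - u0 - J alpha (rhs v)] satisfies [J beta y = 0], and the primitive of
   [y], which is [J alpha (J beta y)], vanishes as well. *)
Lemma local_solution_stop tau u : 0 < tau -> local_solution alpha f u0 tau u ->
  exists2 v, integral_solution tau v & forall t, 0 <= t <= tau -> v t = u t.
Proof.
move=> tau0 [u0E [w [cw [cu [_ [z zi dz]] dJ]] wE]].
have inE_ t : 0 <= t <= tau -> t \in `[0, tau] by rewrite in_itv.
pose c t := Num.min (Num.max t 0) tau.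
have c01 t : 0 <= c t <= tau.
  by rewrite /c le_min ge_min le_max !lexx (ltW tau0) !orbT.
have cE t : 0 <= t <= tau -> c t = t.
  by move=> /andP[t0 tt]; rewrite /c max_l// min_l.
have cc : continuous c by exact: clamp_continuous.
pose v t := u (c t).
have vE t : 0 <= t <= tau -> v t = u t by move=> t01; rewrite /v cE.
have cv : continuous v.
  move=> t A; have /subspace_continuousP/(_ (c t) (inE_ _ (c01 t))) cut := cu.
  have cS (S : set R) : nbhs (c t) S -> \forall s \near t, S (c s) by exact: cc.
  by move=> /cut/cS; apply: filterS => s /(_ (inE_ _ (c01 s))).
exists v => //; split => //.
have cw' := continuous_rhs cv.
have wE' t : 0 <= t <= tau -> w t = rhs v t.
  by move=> t01; rewrite wE ?inE_// rhsE ?vE//; case/andP: t01.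
have v0 : v 0 = u0 by rewrite vE ?lexx ?ltW.
have lv := locally_sm_bounded_continuous cv.
have lw := locally_sm_bounded_continuous cw'.
have lu0 : locally_sm_bounded (cst u0).
  by apply: locally_sm_bounded_continuous => x; exact: cvg_cst.
have cvu0 : continuous (fun r => v r - u0).
  by move=> x; apply: cvgB; [exact: cv|exact: cvg_cst].
have [M M0 wM] := lw tau.
have Juv t : t <= tau -> J beta u t = J beta v t.
  move=> ttau; apply: eq_volterra => r /andP[r0 rt].
  by rewrite vE// (ltW r0) (le_trans (ltW rt)).
have inE2 t : t \in `]0, tau[%classic -> t <= tau.
  by rewrite inE/= in_itv/= => /andP[_ /ltW].
have dz' : weak_derivative tau (J beta v) z.
  move=> phi phiC; rewrite -(dz _ phiC); apply: eq_bochner_integral => t /inE2 ttau.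
  by rewrite -(Juv t ttau).
have cJ := volterra_continuous kbeta lv.
have [m [m0 im zm]] := bochner_integrable_dominating (mu := leb) (measurable_itv _)
  (lebesgue_measure_oo_lty 0 tau) zi.
pose P t := bochner_integral leb `]0, t[ (rhs v).
have PE t : P t = volterra (power_kernel 1) (rhs v) t by exact: primitiveE.
pose G t := J beta (fun r => v r - u0) t - P t.
have GE t : G t = J beta v t - fractional_primitive beta t *: u0 - P t.
  by rewrite /G (J_subK t cv) addrK.
(* One term for each part of [G]: [m] dominates the weak derivative of [J beta v], the second is for
   the contribution of the initial value, and [2 * M] comes from the modulus of continuity of the
   primitive [P]. *)
pose m' r := m r + (`|u0| * g beta r + 2 * M).
have im2 : leb.-integrable `]0, tau[ (EFin \o (fun r => `|u0| * g beta r)).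
  exact: eq_integrable (integrableZl (mu := leb) (measurable_itv _) `|u0|
    (integrable_g (ltW tau0))).
have im3 : leb.-integrable `]0, tau[ (EFin \o cst (2 * M)).
  apply/integrableP; split; first exact/measurable_EFinP/measurable_cst.
  rewrite /= integral_cst//; apply: lte_mul_pinfty => //.
  exact: lebesgue_measure_oo_lty.
have im' : leb.-integrable `]0, tau[ (EFin \o m').
  exact: (integrableD (mu := leb) (measurable_itv _) im
    (integrableD (mu := leb) (measurable_itv _) im2 im3)).
have m'0 r : 0 <= m' r.
  by rewrite !addr_ge0// mulr_ge0// (volterra_kernel_ge0 kbeta).
have Gincr x y : 0 < x -> x <= y -> y < tau ->
    (`|G y - G x|%:E <= \int[leb]_(r in `]x, y[) (m' r)%:E)%E.
  move=> x0 xy yt.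
  have sub : `]x, y[ `<=` `]0, tau[.
    by move=> r /=; rewrite !in_itv/= => /andP[xr ry]; rewrite (lt_trans x0)//= (lt_trans ry).
  have I0 := weak_derivative_increment cJ zi m0 im zm dz' x0 xy yt.
  have meas (k : R -> R) : leb.-integrable `]0, tau[ (EFin \o k) ->
      measurable_fun `]x, y[ (EFin \o k).
    by move=> ik; apply: measurable_funS (measurable_int _ ik).
  have g0 r : 0 <= `|u0| * g beta r by rewrite mulr_ge0// (volterra_kernel_ge0 kbeta).
  rewrite /m'; under eq_integral do rewrite !EFinD.
  rewrite ge0_integralD//; last 4 first.
  - by move=> r _; rewrite lee_fin.
  - exact: meas im.
  - by move=> r _; rewrite -EFinD lee_fin addr_ge0// mulr_ge0.
  - exact: (emeasurable_funD (meas _ im2) (meas _ im3)).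
  rewrite ge0_integralD//; last 3 first.
  - by move=> r _; rewrite lee_fin.
  - exact: meas im2.
  - by move=> r _; rewrite lee_fin mulr_ge0.
  rewrite (_ : (\int[leb]_(r in `]x, y[) (`|u0| * g beta r)%:E)%E =
    (`|u0| * (fractional_primitive beta y - fractional_primitive beta x))%:E); last first.
    under eq_integral do rewrite EFinM.
    rewrite ge0_integralZl_EFin//; first by rewrite integral_g// -EFinM.
      by move=> r _; rewrite lee_fin (volterra_kernel_ge0 kbeta).
    by apply: measurable_funS (measurable_int _ (integrable_g (ltW tau0))).
  rewrite integral_cst//= lebesgue_measure_itv/= lte_fin.
  have yx : (if x < y then (y - x)%:E else 0%E) = (y - x)%:E.
    case: ltP => // yx; by rewrite (le_anti (introT andP (conj xy yx))) subrr.
  rewrite -EFinB yx -EFinM -EFinD.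
  have -> : G y - G x = (J beta v y - J beta v x) +
      (- ((fractional_primitive beta y - fractional_primitive beta x) *: u0) - (P y - P x)).
    have aux (a1 a2 a3 b1 b2 b3 : X) : a1 - a2 - a3 - (b1 - b2 - b3) =
        a1 - b1 + (- (a2 - b2) - (a3 - b3)).
      by rewrite opprD addrACA (opprD b1) (addrACA a1) -[LHS]addrA -!opprD.
    rewrite (GE x) (GE y) scalerBl; exact: aux.
  apply: le_trans (_ : _ <= (`|J beta v y - J beta v x| + (`|u0| *
    (fractional_primitive beta y - fractional_primitive beta x) + 2 * M * (y - x)))%:E)%E _.
    rewrite lee_fin; apply: le_trans (ler_normD _ _) _; rewrite lerD2l.
    apply: le_trans (ler_normB _ _) _; apply: lerD.
      rewrite normrN normrZ ger0_norm 1?mulrC// subr_ge0.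
      exact: (volterra_primitive_nondecreasing kbeta).
    rewrite !PE -(@power_primitive1 _ (y - x)) ?subr_ge0//.
    exact: (volterra_modulusT volterra_one M0 xy (ltW yt) wM).
  by rewrite [X in (X <= _)%E]EFinD; exact: leeD I0 (lexx _).
have Gder : {ae leb, forall t, t \in `]0, tau[ -> is_derive t 1 G 0}.
  apply: (@filterS _ _ (ae_filter_ringOfSetsType (@lebesgue_measure R)) _ _ _ dJ).
  move=> t dJt tT; have := tT; rewrite in_itv/= => t01; have /andP[t0 tt] := t01.
  rewrite -(subrr (w t)).
  apply: (@is_deriveB _ _ _ (J beta (fun r => v r - u0)) P).
    apply: near_eq_is_derive (dJt tT).
    near=> s; apply: eq_volterra => r /andP[r0 rs].
    rewrite u0E vE// (ltW r0)/= ltW// (lt_trans rs)//; near: s; exact: lt_nbhsl.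
  rewrite wE' ?(ltW t0) ?(ltW tt)//.
  by apply: (is_derive_primitive M0 t01 wM); exact: cw'.
have Gcst a b : 0 < a -> a <= b -> b < tau -> G a = G b.
  exact: (ae_derive0_constant im' m'0 Gincr Gder).
have cG : continuous G.
  move=> x; apply: cvgB.
    exact: (volterra_continuous kbeta (locally_sm_bounded_continuous cvu0)).
  rewrite (_ : P = volterra (power_kernel 1) (rhs v)); last exact/funext.
  exact: (volterra_continuous volterra_one lw).
have G00 t : t <= 0 -> G t = 0.
  move=> t0; rewrite /G PE -[J _ _ _]/(volterra _ _ _) !volterra_nonpos//.
  by rewrite subrr.
have G0 t : t < tau -> G t = 0.
  move=> tt; have [|t0] := leP t 0; first exact: G00.
  apply/eqP; rewrite -normr_le0; apply/ler_addgt0Pr => e e0; rewrite add0r.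
  have /cvgrPdist_le/(_ _ e0)[d /= d0 dP] := cG 0.
  pose s := Num.min t (d / 2).
  have s0 : 0 < s by rewrite lt_min t0 divr_gt0.
  have st : s <= t by rewrite ge_min lexx.
  have sd : s <= d / 2 by rewrite ge_min lexx orbT.
  rewrite -(Gcst s t s0 st tt).
  have := dP s; rewrite /ball_/= (G00 0)// !sub0r !normrN gtr0_norm//; apply; lra.
pose y t := v t - u0 - J alpha (rhs v) t.
have cJa := volterra_continuous kalpha lw.
have cy : continuous y by move=> x; apply: cvgB; [exact: cvu0|exact: cJa].
have Jy t : t < tau -> J beta y t = 0.
  move=> tt; rewrite -(G0 t tt) /G /P -(J_semigroup beta0 alpha0 ba1 t cw').
  exact: (volterra_locallyB t kbeta (locally_sm_bounded_continuous cvu0)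
    (locally_sm_bounded_continuous cJa)).
have y0 := @primitive_eq0 y tau cy.
move=> t t01; have /andP[t0 tt] := t01.
have [t00|tn0] := eqVneq t 0.
  rewrite t00 v0 (_ : J alpha _ 0 = 0) ?addr0//.
    exact: volterra_nonpos.
apply/eqP; rewrite addrC -subr_eq -subr_eq0; apply/eqP.
apply: y0; last by rewrite lt_neqAle eq_sym tn0 t0.
move=> s st; rewrite -(J_semigroup alpha0 beta0 ab1 s cy).
apply: bochner_integral0 => //; first exact: lebesgue_measure_oo_lty.
move=> r /=; rewrite in_itv/= => /andP[_ rs].
by rewrite Jy ?scaler0// (lt_le_trans rs).
Unshelve. all: by end_near. Qed.

End IntegralEquation.


(** * Contraction estimate and uniqueness *)

Section Wellposedness.
Context {R : realType} {X : completeNormedModType R}.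
Variables (alpha : R) (f : R * X -> X) (u0 : X).
Hypotheses (alpha01 : 0 < alpha < 1)
  (cf : {within [set p : R * X | 0 <= p.1], continuous f}).
Implicit Types (u v : R -> X) (c d tau t s L r E : R).
Opaque Gamma powR bochner_integral.

Let kalpha := volterra_fractional alpha01.
Local Notation K := (fractional_primitive alpha).
Local Notation solution := (integral_solution alpha f u0).

Lemma fractional_primitive_small e : 0 < e -> exists2 d, 0 < d & K d <= e.
Proof.
move=> e0; have : K x @[x --> (0 : R)] --> K 0 by exact: (volterra_primitive_continuous kalpha).
rewrite (volterra_primitive0 kalpha (lexx 0)) => /cvgr_le /(_ _ e0)[d /= d0 dP].
exists (d / 2); first by rewrite divr_gt0.
apply: dP; rewrite /ball_/= sub0r normrN gtr0_norm ?divr_gt0//; lra.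
Qed.

(** Although [J alpha] remembers the whole past, agreement of [u] and [v] up to [c] removes that
    past from the difference, and the Lipschitz condition is needed only in one ball around
    [(c, x0)]. *)
Lemma rhs_contraction c d L r (x0 : X) u v E : 0 <= c -> 0 <= L -> 0 <= E ->
  continuous u -> continuous v ->
  (forall t y z, 0 <= t -> ball (c, x0) r (t, y) -> ball (c, x0) r (t, z) ->
    `|f (t, y) - f (t, z)| <= L * `|y - z|) ->
  (forall t, 0 <= t <= c -> u t = v t) ->
  (forall t, c <= t <= d ->
    [/\ ball (c, x0) r (t, u t), ball (c, x0) r (t, v t) & `|u t - v t| <= E]) ->
  forall t, c <= t <= d ->
  `|J alpha (rhs f u) t - J alpha (rhs f v) t| <= L * E * K (t - c).
Proof.
move=> c0 L0 E0 cu cv lip uv uvE t /andP[ct td].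
have lu := locally_sm_bounded_continuous (continuous_rhs cf cu).
have lv := locally_sm_bounded_continuous (continuous_rhs cf cv).
rewrite -[J alpha _ t]/(volterra _ _ t) -[J alpha (rhs f v) t]/(volterra _ _ t).
rewrite -(volterra_locallyB t kalpha lu lv).
have rhs0 s : 0 < s <= c -> rhs f u s - rhs f v s = 0.
  by move=> /andP[s0 sc]; rewrite /rhs uv ?subrr// (ltW s0).
apply: (volterra_norm_from kalpha) => //; first exact: mulr_ge0.
have [M M0 [smM _]] := locally_sm_boundedB lu lv t.
split => // s /andP[s0 st]; have [sc|cs] := leP s c.
  by rewrite rhs0 ?s0// normr0 mulr_ge0.
have scd : c <= s <= d by rewrite (ltW cs) (ltW (lt_le_trans st td)).
have [bu bv uvs] := uvE s scd.
rewrite !rhsE ?(ltW s0)//; apply: le_trans (lip s _ _ (ltW s0) bu bv) _.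
exact: ler_wpM2l.
Qed.

Hypothesis lipf : locally_lipschitz f.

(** Real induction on the length of the interval of agreement. Beyond [c] both solutions stay for a
    while in a ball where [f] is Lipschitz, and applying the integral equation repeatedly halves the
    bound on their difference each time. *)
Lemma integral_solution_unique tau u v : 0 <= tau -> solution tau u -> solution tau v ->
  forall t, 0 <= t <= tau -> u t = v t.
Proof.
move=> tau0 su sv; have [cu uE] := su; have [cv vE] := sv.
have uv0 : u 0 = v 0 by rewrite (integral_solution0 tau0 su) (integral_solution0 tau0 sv).
apply: (real_induction (P := fun c => forall t, 0 <= t <= c -> u t = v t) tau0).
- by move=> t t0; rewrite -(le_anti t0).
- move=> c /andP[c0 ctau] uvc; have [L [r [L0 r0 lip]]] := lipf (u c) c0.
  have uvcc : u c = v c by apply: uvc; rewrite c0 lexx.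
  have /cvgrPdist_lt/(_ _ r0)[d1 /= d10 d1P] := cu c.
  have /cvgrPdist_lt/(_ _ r0)[d2 /= d20 d2P] := cv c.
  have L2 : 0 < 2 * L by rewrite mulr_gt0.
  (* Mass at most [1 / (2 * L)] makes the contraction factor at most 1/2. *)
  have [d3 d30 d3P] := fractional_primitive_small (divr_gt0 ltr01 L2).
  pose d := Num.min (Num.min d1 d2) (Num.min d3 r).
  have d0 : 0 < d by rewrite !lt_min d10 d20 d30 r0.
  have dd1 : d <= d1 by rewrite !ge_min lexx.
  have dd2 : d <= d2 by rewrite !ge_min lexx orbT.
  have dd3 : d <= d3 by rewrite !ge_min lexx !orbT.
  have ddr : d <= r by rewrite !ge_min lexx !orbT.
  exists d => // x /andP[cx xd] xtau.
  have inb t : c <= t <= x -> `|u c - u t| < r /\ `|v c - v t| < r /\ `|c - t| < r.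
    move=> /andP[ct tx]; have ctn : `|c - t| = t - c by rewrite distrC ger0_norm ?subr_ge0.
    by split; [apply: d1P|split; [apply: d2P|]]; rewrite /ball_/= ctn; lra.
  (* The initial bound is the diameter of the ball of radius [r] around the common value
     [u c = v c]. *)
  have bound (n : nat) : forall t, c <= t <= x -> `|u t - v t| <= 2 * r / 2 ^+ n.
    elim: n => [|n IH] t tcx.
      have [h1 [h2 _]] := inb t tcx; rewrite expr0 divr1.
      rewrite -(subrK (u c) (u t)) -addrA; apply: le_trans (ler_normD _ _) _.
      by rewrite distrC {2}uvcc; lra.
    have /andP[ct tx] := tcx; have t0 := le_trans c0 ct.
    have ttau : 0 <= t <= tau by rewrite t0 (le_trans tx).
    rewrite uE// vE// opprD addrACA subrr add0r.
    have E0 : 0 <= 2 * r / 2 ^+ n by rewrite divr_ge0 ?mulr_ge0 ?exprn_ge0// ltW.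
    apply: le_trans (rhs_contraction c0 (ltW L0) E0 cu cv _ uvc _ tcx) _.
    - exact: lip.
    - move=> s sx; have [h1 [h2 h3]] := inb s sx; split.
      + by split => //=; rewrite -ball_normE.
      + by split => //=; rewrite -ball_normE /ball_/= ?uvcc.
      + exact: IH.
    have Kt : K (t - c) <= 1 / (2 * L).
      apply: le_trans (volterra_primitive_nondecreasing kalpha _) d3P; lra.
    apply: le_trans (ler_wpM2l (mulr_ge0 (ltW L0) E0) Kt) _.
    rewrite le_eqVlt exprS; apply/orP; left; apply/eqP; field.
    by rewrite (lt0r_neq0 L0) expf_neq0.
  move=> t /andP[t0 tx]; have [tc|ct] := leP t c; first by apply: uvc; rewrite t0.
  apply/eqP; rewrite -subr_eq0 -normr_le0.
  apply: (@le_geometric_le _ _ _ (2 * r)); first by rewrite mulr_ge0// ltW.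
  by move=> n; rewrite add0r; apply: bound; rewrite (ltW ct).
- move=> c /andP[c0 ctau] uvc t /andP[t0]; rewrite le_eqVlt => /orP[/eqP ->|tc].
    apply/eqP; rewrite -subr_eq0; apply/eqP.
    apply: (@continuous_left_eq0 _ _ (fun s => u s - v s) 0 c c0).
      by move=> s; apply: cvgB; [exact: cu|exact: cv].
    move=> s /andP[s0 sc]; rewrite (uvc s) ?subrr//; first by rewrite s0.
    by rewrite s0 lexx.
  by apply: (uvc t); rewrite ?t0// lexx.
Qed.

End Wellposedness.

(** * Extension beyond a point, and up to a finite end point *)

Section Continuation.
Context {R : realType} {X : completeNormedModType R}.
Variables (alpha : R) (f : R * X -> X) (u0 : X).
Hypotheses (alpha01 : 0 < alpha < 1)
  (cf : {within [set p : R * X | 0 <= p.1], continuous f}).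
Implicit Types (u v : R -> X) (c d tau t s L r E : R).
Opaque Gamma powR bochner_integral.

Let kalpha := volterra_fractional alpha01.
Local Notation K := (fractional_primitive alpha).
Local Notation solution := (integral_solution alpha f u0).

Lemma locally_bounded_f c (x0 : X) : 0 <= c -> exists2 r, 0 < r &
  forall t y, 0 <= t -> ball (c, x0) r (t, y) -> `|f (t, y)| <= `|f (c, x0)| + 1.
Proof.
move=> c0; have := @continuous_ext_f _ _ f cf (c, x0).
rewrite /continuous_at /= (max_l c0) => /cvgrPdist_le/(_ _ ltr01)/nbhs_ballP[r /= r0 rP].
exists r => // t y t0 /rP; rewrite /= max_l// => fty.
rewrite -(subrK (f (c, x0)) (f (t, y))) addrC; apply: le_trans (ler_normD _ _) _.
by rewrite lerD2l distrC.
Qed.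

(* The Picard iterates are started from [u] frozen after [c], and each of them
   is constant outside [0, c + d]. *)
Lemma integral_solution_extend c u : locally_lipschitz f -> 0 <= c -> solution c u ->
  exists2 d, 0 < d & exists v, solution (c + d) v.
Proof.
move=> lipf c0 [cu uE]; pose x0 := u c.
have [L [r [L0 r0 lip]]] := lipf c x0 c0.
have [r2 r20 r2B] := locally_bounded_f x0 c0.
have cru := continuous_rhs cf cu.
have [M1 M10 [_ uM1]] := continuous_sm_bounded cru c.
(* [M] bounds the right-hand side along every admissible function up to [c + d]: [M1] before [c],
   where it coincides with [u], and [B] afterwards, where it stays near [x0]. *)
pose B := `|f (c, x0)| + 1; pose M := M1 + B.
have B0 : 0 <= B by rewrite addr_ge0.
have M0 : 0 <= M by rewrite addr_ge0.
pose r1 := Num.min r r2; have r10 : 0 < r1 by rewrite lt_min r0.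
have r1r : r1 <= r by rewrite ge_min lexx.
have r1r2 : r1 <= r2 by rewrite ge_min lexx orbT.
(* Admissibility uses the closed ball of radius [rho], which is preserved by limits; since
   [rho < r1] it lies inside the open balls where [f] is Lipschitz and bounded. *)
pose rho := r1 / 2; have rho0 : 0 < rho by rewrite divr_gt0.
have rhor : rho < r1 by rewrite /rho; lra.
have M21 : 0 < 2 * M + 1 by rewrite ltr_wpDl// mulr_ge0.
have L2 : 0 < 2 * L by rewrite mulr_gt0.
(* [d1] brings the modulus of continuity [2 * M * K] below [rho], so that iterates stay admissible;
   [d2] brings the contraction factor down to 1/2. *)
have [d1 d10 d1K] := fractional_primitive_small alpha01 (divr_gt0 rho0 M21).
have [d2 d20 d2K] := fractional_primitive_small alpha01 (divr_gt0 ltr01 L2).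
pose d := Num.min (Num.min d1 d2) rho.
have d0 : 0 < d by rewrite !lt_min d10 d20 rho0.
have dd1 : d <= d1 by rewrite !ge_min lexx.
have dd2 : d <= d2 by rewrite !ge_min lexx orbT.
have drho : d <= rho by rewrite !ge_min lexx orbT.
have Kle t e : t - c <= d -> d <= e -> K (t - c) <= K e.
  move=> td de; apply: (volterra_primitive_nondecreasing kalpha); exact: le_trans de.
have KM t : t <= c + d -> 2 * M * K (t - c) <= rho.
  rewrite -lerBlDl => td; apply: le_trans (ler_wpM2l _ (le_trans (Kle _ _ td dd1) d1K)) _.
    by rewrite mulr_ge0.
  rewrite mulrCA ger_pMr// ler_pdivrMr// mul1r lerDl; exact: ler01.
have KL t E : 0 <= E -> t <= c + d -> L * E * K (t - c) <= E / 2.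
  move=> E0; rewrite -lerBlDl => td.
  apply: le_trans (ler_wpM2l _ (le_trans (Kle _ _ td dd2) d2K)) _.
    by rewrite mulr_ge0// ltW.
  rewrite le_eqVlt; apply/orP; left; apply/eqP; field; exact: lt0r_neq0.
have cd0 : 0 <= c + d by rewrite addr_ge0// ltW.
have ccd : c <= c + d by rewrite lerDl ltW.
exists d => //.
pose cl t := Num.min (Num.max t 0) (c + d).
have ccl : continuous cl by exact: clamp_continuous.
have clE t : 0 <= t <= c + d -> cl t = t.
  by move=> /andP[t0 td]; rewrite /cl max_l// min_l.
have cl01 t : 0 <= cl t <= c + d.
  by rewrite /cl le_min ge_min le_max !lexx cd0 !orbT.
have clK t : cl (cl t) = cl t by apply: clE; exact: cl01.
pose T v t := u0 + J alpha (rhs f v) (cl t).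
pose admissible v := [/\ continuous v, forall t, 0 <= t <= c -> v t = u t &
  forall t, c <= t <= c + d -> `|v t - x0| <= rho].
have in_ball v t q : admissible v -> r1 <= q -> c <= t <= c + d -> ball (c, x0) q (t, v t).
  move=> [_ _ vb] rq tcd; have /andP[ct td] := tcd; split => /=.
    rewrite -ball_normE /ball_/= distrC ger0_norm ?subr_ge0//.
    by move: td; rewrite -lerBlDl => td; lra.
  by rewrite -ball_normE /ball_/= distrC (le_lt_trans (vb t tcd))// (lt_le_trans rhor).
have JT v t : admissible v -> 0 <= t <= c -> u0 + J alpha (rhs f v) t = u t.
  move=> [_ vu _] tc; rewrite (uE t tc); congr (_ + _); apply: eq_volterra => s /andP[s0 st].
  by rewrite /rhs vu// (ltW s0)/= ltW// (lt_le_trans st)//; case/andP: tc.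
have rhs_sm v : admissible v -> sm_bounded (c + d) M (rhs f v).
  move=> av; have [cv vu _] := av; have [_ _ [sm _]] := continuous_sm_bounded (continuous_rhs cf cv) (c + d).
  split=> // s /andP[s0 scd]; rewrite rhsE ?(ltW s0)//; have [sc|cs] := leP c s.
    apply: le_trans (r2B s _ (ltW s0) (in_ball _ _ _ av r1r2 _)) _.
      by rewrite sc ltW.
    by rewrite /M lerDr.
  rewrite vu ?(ltW s0) ?(ltW cs)// -(rhsE _ _ (ltW s0)).
  by apply: le_trans (uM1 s _) _; [rewrite s0|rewrite lerDl].
have adT v : admissible v -> admissible (T v).
  move=> av; have [cv vu vb] := av; split.
  - have cJ := volterra_continuous kalpha (locally_sm_bounded_continuous (continuous_rhs cf cv)).
    move=> t; apply: cvgD; first exact: cvg_cst.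
    exact: (cvg_comp _ _ (ccl t) (cJ (cl t))).
  - move=> t tc; rewrite /T clE; first exact: JT.
    by case/andP: tc => -> tc; rewrite (le_trans tc).
  - move=> t /andP[ct td]; rewrite /T clE ?td ?(le_trans c0)// /x0.
    rewrite -(JT v c av) ?lexx ?c0// opprD addrACA subrr add0r.
    apply: le_trans (volterra_modulusT kalpha M0 ct td (rhs_sm v av)) _.
    exact: KM.
pose v0 t := u (Num.min (cl t) c).
have ad0 : admissible v0.
  split.
  - move=> t.
    have cm : Num.min (cl s) c @[s --> t] --> Num.min (cl t) c.
      exact: (cvg_comp _ _ (cvg_pair (ccl t) (cvg_cst c)) (@min_continuous _ R (cl t, c))).
    exact: (cvg_comp _ _ cm (cu (Num.min (cl t) c))).
  - move=> t /andP[t0 tc]; rewrite /v0 clE ?t0 ?(le_trans tc)// min_l//.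
  - move=> t /andP[ct td]; rewrite /v0 clE ?td ?(le_trans c0)// min_r//.
    by rewrite subrr normr0 ltW.
pose vs n := iter n T v0.
have ads n : admissible (vs n) by elim: n => [//|n]; exact: adT.
have vs_cl n t : vs n (cl t) = vs n t.
  by case: n => [|n]; rewrite /vs/= /v0 /T clK.
have C0 : 0 <= 2 * rho by rewrite mulr_ge0// ltW.
have contract v w E : admissible v -> admissible w -> 0 <= E ->
    (forall t, c <= t <= c + d -> `|v t - w t| <= E) ->
    forall t, c <= t <= c + d -> `|T v t - T w t| <= E / 2.
  move=> av aw E0 vw t tcd; have /andP[ct td] := tcd.
  have [cv vu _] := av; have [cw wu _] := aw.
  rewrite /T clE ?td ?(le_trans c0)// opprD addrACA subrr add0r.
  apply: le_trans (KL t E E0 td).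
  apply: (rhs_contraction alpha01 cf c0 (ltW L0) E0 cv cw lip) tcd.
    by move=> s sc; rewrite vu// wu.
  move=> s scd; split; [exact: in_ball|exact: in_ball|exact: vw].
have step n t : `|vs n.+1 t - vs n t| <= 2 * rho / 2 ^+ n.
  rewrite -vs_cl -(vs_cl n); have /andP[t0 td] := cl01 t.
  have [tc|ct] := leP (cl t) c.
    have [_ h1 _] := ads n.+1; have [_ h2 _] := ads n.
    by rewrite h1 ?h2 ?t0// subrr normr0 divr_ge0 ?exprn_ge0.
  move: (cl t) ct td => {t0}t; move=> ct td; have : c <= t <= c + d by rewrite (ltW ct).
  move: t {ct td}; elim: n => [|n IH] t tcd.
    have [_ _ /(_ t tcd) h1] := ads 1%N; have [_ _ /(_ t tcd) h2] := ads 0%N.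
    rewrite expr0 divr1 -(subrK x0 (vs 1%N t)) -addrA; apply: le_trans (ler_normD _ _) _.
    by rewrite [in X in _ + X]distrC mulr_natl mulr2n lerD.
  rewrite exprS invfM mulrCA mulrC.
  have E0 : 0 <= 2 * rho / 2 ^+ n by rewrite divr_ge0 ?exprn_ge0.
  exact: (contract _ _ _ (ads n.+1) (ads n) E0 IH t tcd).
have [l lP] := choice (fun t => geometric_limit C0 (fun n => step n t)).
have C20 : 0 <= 2 * (2 * rho) by rewrite mulr_ge0.
have limit_eq t (x : X) : (forall n, vs n t = x) -> l t = x.
  move=> vx; apply/eqP; rewrite -subr_eq0 -normr_le0.
  by apply: (le_geometric_le C20) => m; rewrite add0r -{1}(vx m).
have al : admissible l.
  split.
  - move=> t; apply/cvgrPdist_le => e e0; have [n nP] := geometric_lt C20 (divr_gt0 e0 (ltr0Sn R 2)).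
    have [/(_ t) cvn _ _] := ads n; have e30 : 0 < e / 3 by rewrite divr_gt0.
    move: cvn => /cvgrPdist_le/(_ _ e30); apply: filterS => s vts.
    have h1 := lP t n; have h2 := lP s n.
    have := ler_distD (vs n t) (l t) (l s); have := ler_distD (vs n s) (vs n t) (l s).
    rewrite (distrC (vs n s) (l s)); lra.
  - by move=> t tc; apply: limit_eq => n; have [_ h _] := ads n; exact: h.
  - move=> t tcd; apply: (le_geometric_le C20) => n; have [_ _ /(_ t tcd) h] := ads n.
    rewrite -(subrK (vs n t) (l t)) -addrA; apply: le_trans (ler_normD _ _) _.
    by rewrite [leRHS]addrC; exact: lerD (lP t n) h.
have [cl_ lu _] := al; exists l; split => // t /andP[t0 td].
have [tc|ct] := leP t c; first by rewrite (JT l t al) ?lu ?t0.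
have tcd : c <= t <= c + d by rewrite (ltW ct).
apply/eqP; rewrite -subr_eq0 -normr_le0.
rewrite -[t in J alpha _ t]clE ?t0// -/(T l t).
(* [l] is within [q / 2] of iterate [n.+1], which is [T] of iterate [n]; the latter is within [q] of
   [l], hence their images under [T] are within [q / 2]. *)
apply: (le_geometric_le C20) => n; rewrite add0r; set q := 2 * (2 * rho) / 2 ^+ n.
rewrite -(subrK (vs n.+1 t) (l t)) -addrA [leRHS]splitr.
apply: le_trans (ler_normD _ _) _; apply: lerD.
  by rewrite /q -[leRHS]mulrA -invfM -exprSr; exact: lP.
have q0 : 0 <= q by rewrite divr_ge0 ?exprn_ge0.
by apply: (contract _ _ _ (ads n) al q0 _ t tcd) => s _; rewrite distrC.
Qed.

(** The convolution with [rhs f u] uses values of [u] inside []0, omega[] only, so it makes sense up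
    to [omega] without a value of [u] there. Stopping it at [omega] gives a function continuous on
    the whole line. *)
Lemma integral_solution_close omega u M : 0 < omega -> 0 <= M ->
  (forall tau, 0 < tau < omega -> exists2 v, solution tau v &
     forall t, 0 <= t <= tau -> v t = u t) ->
  (forall t, 0 < t < omega -> `|rhs f u t| <= M) -> exists v, solution omega v.
Proof.
move=> w0 M0 sol rM.
(* [u] is only known to agree with some solution on each shorter interval; its continuity at [t] is
   read off from the one that lives up to [(t + omega) / 2]. *)
have near_u t : 0 < t < omega -> exists2 v, continuous v & \forall s \near t, v s = u s.
  move=> /andP[t0 tw]; have tw2 : t < (t + omega) / 2 by lra.
  have tau1 : 0 < (t + omega) / 2 < omega by apply/andP; split; lra.
  have [v [cv _] vu] := sol _ tau1; exists v => //.
  near=> s; apply: vu; rewrite !ltW//; near: s; [exact: lt_nbhsl|exact: lt_nbhsr].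
have ru : sm_bounded omega M (rhs f u).
  split=> //; apply: strongly_measurable_continuous => // t /=; rewrite in_itv/= => t01.
  have [v cv vu] := near_u t t01.
  have vt : v t = u t by exact: nbhs_singleton vu.
  have rE : rhs f u t = rhs f v t by rewrite /rhs vt.
  have crv : rhs f v s @[s --> t] --> rhs f u t.
    by rewrite rE; exact: (continuous_rhs cf cv).
  apply: cvg_trans crv; apply: near_eq_cvg; apply: filterS vu => s vs.
  by rewrite /rhs vs.
pose v t := u0 + J alpha (rhs f u) (Num.min t omega).
have cv : continuous v.
  by move=> t; apply: cvgD; [exact: cvg_cst|exact: (volterra_stop_continuous kalpha M0 ru : continuous _)].
have vu t : 0 < t < omega -> v t = u t.
  move=> t01; have [v' [_ v'E] v'u] := sol t t01; have /andP[t0 tw] := t01.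
  have tt : 0 <= t <= t by rewrite lexx ltW.
  rewrite -(v'u t tt) (v'E t tt) /v (min_l (ltW tw)); congr (_ + _).
  apply: eq_volterra => s /andP[s0 st]; by rewrite /rhs v'u ?(ltW s0) ?(ltW st).
exists v; split; first exact: cv.
move=> t /andP[t0 tw]; rewrite {1}/v (min_l tw); congr (_ + _).
apply: eq_volterra => s /andP[s0 st]; rewrite /rhs vu// s0.
exact: lt_le_trans st tw.
Unshelve. all: by end_near. Qed.

End Continuation.

(** The limsup is an infimum of suprema over left neighbourhoods. If it is not infinite, one of
    these suprema is not, and its real value is the bound. *)
Lemma limf_esup_left_bounded (R : realType) (w : R -> R) (omega : R) :
  limf_esup (fun t => (w t)%:E) omega^'- <> +oo%E ->
  exists M s, s < omega /\ forall t, s < t < omega -> w t <= M.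
Proof.
move=> /eqP; rewrite limf_esupE => w_oo.
have [V [Vw sup_oo]] : exists V, omega^'- V /\ ereal_sup ((fun t => (w t)%:E) @` V) <> +oo%E.
  apply: contrapT => noV; move/eqP: w_oo; apply; apply/ereal_inf_pinfty => _ [V Vw <-] /=.
  by apply: contrapT => sup_oo; apply: noV; exists V.
have wsup t : V t -> ((w t)%:E <= ereal_sup ((fun t => (w t)%:E) @` V))%E.
  by move=> Vt; apply: ereal_sup_ubound; exists t.
have [d /= d0 dV] := Vw; exists (fine (ereal_sup ((fun t => (w t)%:E) @` V))), (omega - d).
split; first by rewrite gtrBl.
move=> t /andP[st tw]; have /wsup : V t.
  by apply: dV => //=; rewrite gtr0_norm ?subr_gt0// ltrBlDr -ltrBlDl.
by case: ereal_sup sup_oo => // r _; rewrite lee_fin.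
Qed.

(** * The alternative between global existence and blow-up *)

Unset Implicit Arguments.

Theorem theorem10 (R : realType) (X : completeNormedModType R)
  (alpha : R) (u0 : X) (f : R * X -> X) :
  0 < alpha < 1 ->
  {within [set p : R * X | 0 <= p.1], continuous f} ->
  locally_lipschitz f ->
  maps_bounded_to_bounded f ->
  (exists u : R -> X, global_solution alpha f u0 u) \/
  (exists (omega : R) (u : R -> X),
     [/\ 0 < omega,
         local_solution_upto alpha f u0 omega u,
         ~ admits_continuation alpha f u0 omega u &
         limf_esup (fun t => `|u t|%:E) omega^'- = +oo%E]).
Proof.
move=> alpha01 cf lipf bf.
pose solution := integral_solution alpha f u0.
(* The trivial solution on [[0, 0]]; extending it beyond 0 is local existence. *)
have sol0 : solution 0 (cst u0).
  split=> [t|t /le_anti <-]; first exact: cvg_cst.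
  by rewrite (_ : J alpha _ 0 = 0) ?addr0//; exact: volterra_nonpos.
pose T := [set tau | 0 < tau /\ exists v, solution tau v].
have T_down tau s : T tau -> 0 < s <= tau -> T s.
  by move=> [_ [v sv]] /andP[s0 st]; split=> //; exists v; exact: integral_solution_le sv.
have T0 : T !=set0.
  have [d d0 sd] := integral_solution_extend alpha01 cf lipf (lexx 0) sol0.
  by exists d; split=> //; rewrite add0r in sd.
(* One solution is chosen for each existence time. For the other times the choice is the constant
   [u0], about which nothing is claimed. *)
have [U UP] : {U : R -> R -> X & forall tau, T tau -> solution tau (U tau)}.
  apply: (choice (P := fun tau v => T tau -> solution tau v)) => tau.
  by have [[_ [v sv]]|nT] := pselect (T tau); [exists v|exists (cst u0)].
have UE tau s t : T tau -> T s -> 0 <= t <= tau -> t <= s -> U tau t = U s t.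
  move=> Ttau Ts /andP[t0 ttau] ts.
  apply: (integral_solution_unique alpha01 cf lipf t0); last by rewrite t0 lexx.
    exact: integral_solution_le (UP _ Ttau).
  exact: integral_solution_le (UP _ Ts).
have [T_all|nT_all] := pselect (forall tau, 0 < tau -> T tau).
  (* The time [|t| + 1] is positive and exceeds [t], so the chosen solution covers [t]; by
     uniqueness the result agrees with every [U tau] on [[0, tau]]. *)
  left; exists (fun t => U (`|t| + 1) t) => tau tau0.
  apply: (local_solution_integral_solution alpha01 cf tau0 (UP _ (T_all _ tau0))).
  have t1 (t : R) : 0 < `|t| + 1 by rewrite ltr_wpDl.
  move=> t /andP[t0 ttau] /=; apply: (UE _ _ _ (T_all _ (t1 t)) (T_all _ tau0)) => //.
  by rewrite t0 ler_wpDr// ler_norm.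
right; have [b b0 nTb] : exists2 b, 0 < b & ~ T b.
  apply: contrapT => nb; apply: nT_all => tau tau0.
  by apply: contrapT => nTtau; apply: nb; exists tau.
have supT : has_sup T.
  split=> //; exists b => s Ts; rewrite leNgt; apply/negP => bs.
  by apply: nTb; apply: T_down Ts _; rewrite b0 ltW.
pose omega := sup T.
have T_le s : T s -> s <= omega by move=> Ts; exact: ub_le_sup supT.2 _ Ts.
have w0 : 0 < omega by have [s Ts] := T0; exact: lt_le_trans Ts.1 (T_le _ Ts).
have T_lt s : 0 < s < omega -> T s.
  move=> /andP[s0 sw]; have ws : 0 < omega - s by rewrite subr_gt0.
  have [r Tr] := sup_adherent ws supT; rewrite subKr => sr.
  by apply: T_down Tr _; rewrite s0 ltW.
have nTw : ~ T omega.
  move=> [_ [v sv]]; have [d d0 sd] := integral_solution_extend alpha01 cf lipf (ltW w0) sv.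
  have : T (omega + d) by split=> //; exact: addr_gt0.
  by move/T_le; rewrite leNgt ltrDl d0.
(* For [0 <= t < omega] the midpoint is an existence time beyond [t], so all chosen solutions are
   glued into one function. *)
pose u t := U ((t + omega) / 2) t.
have uE tau t : 0 < tau < omega -> 0 <= t <= tau -> u t = U tau t.
  move=> tauw /andP[t0 ttau]; have /andP[tau0 tauw'] := tauw.
  by apply: UE => //; [apply: T_lt|exact: T_lt|]; apply/andP; split; lra.
exists omega, u; split=> //.
- move=> tau tauw; have /andP[tau0 _] := tauw; have sU := UP _ (T_lt _ tauw); split.
    by apply: (local_solution_integral_solution alpha01 cf tau0 sU) => t; exact: uE.
  move=> v /(local_solution_stop alpha01 cf tau0)[v' sv' v'v] t; rewrite in_itv/= => ttau.
  rewrite (uE tau)// -v'v//.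
  exact: (integral_solution_unique alpha01 cf lipf (ltW tau0) sv' sU).
- move=> [tau [v [wtau sv _]]]; have tau0 := lt_le_trans w0 wtau.
  have [v' sv' _] := local_solution_stop alpha01 cf tau0 sv.
  apply: nTw; apply: (T_down tau); last by rewrite w0.
  by split=> //; exists v'.
- apply: contrapT => /limf_esup_left_bounded[M [s [sw sM]]].
  (* A positive time in []s, omega[]: up to [s1] the function [u] coincides with the continuous
     [U s1], hence is bounded, and afterwards the bound [M] from the limsup holds. *)
  pose s1 := Num.max (omega / 2) ((s + omega) / 2).
  have s1w : s1 < omega by rewrite gt_max; apply/andP; split; lra.
  have ws1 : omega / 2 <= s1 by rewrite le_max lexx.
  have ss1 : (s + omega) / 2 <= s1 by rewrite le_max lexx orbT.
  have s10 : 0 < s1 < omega by rewrite s1w andbT; lra.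
  have [cU _] := UP _ (T_lt _ s10).
  have [M1 M10 UM1] := @continuous_bounded_itv _ _ (U s1) 0 s1 (fun t _ => cU t).
  have uM t : 0 < t < omega -> `|u t| <= M1 + `|M|.
    move=> /andP[t0 tw]; have [ts|st] := leP t s1.
      have ts1 : 0 <= t <= s1 by rewrite ltW.
      by rewrite (uE s1)//; apply: le_trans (UM1 _ ts1) _; rewrite lerDl.
    apply: (@le_trans _ _ M); first by apply: sM; apply/andP; split; lra.
    by apply: le_trans (ler_norm _) _; rewrite lerDr.
  (* The norm of a pair is the maximum of the norms, so this radius accommodates both [t < omega]
     and [u t], and [A] contains the graph of [u] over []0, omega[]. *)
  pose A := [set p : R * X | 0 <= p.1 /\ `|p| <= omega + M1 + `|M|].
  have [N [_ NP]] : bounded_set (f @` A).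
    apply: bf; first by move=> p [].
    exists (omega + M1 + `|M|); split; first exact: num_real.
    by move=> M' MM' p [_ pM]; exact: le_trans pM (ltW MM').
  have ruN t : 0 < t < omega -> `|rhs f u t| <= `|N| + 1.
    move=> tw; have /andP[t0 tw'] := tw; rewrite (rhsE _ _ (ltW t0)).
    have N1 : N < `|N| + 1 by rewrite ltr_pwDr ?ler_norm.
    apply: (NP _ N1 (f (t, u t))); exists (t, u t) => //; split=> /=; first exact: ltW.
    rewrite prod_normE/= ge_max gtr0_norm// -addrA.
    rewrite ler_wpDr ?addr_ge0//; last exact: ltW.
    by rewrite (le_trans (uM t tw))// lerDr ltW.
  have N0 : 0 <= `|N| + 1 by rewrite addr_ge0.
  apply: nTw; split=> //.
  apply: (integral_solution_close alpha01 cf w0 N0 _ ruN) => tau tauw.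
  by exists (U tau); [exact: UP _ (T_lt _ tauw)|move=> t ttau; rewrite (uE tau)].
Qed.
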